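(* Let $N=\operatorname{rank}(L)$ be even and $k\in\mathbb{N}$ even with $k>2+N$. Then $E_{k,1}$ is a holomorphic Jacobi form on $\mathcal{H}\times(L\otimes\mathbb{C})$, with Fourier expansion \[E_{k,1}(\tau,\mathfrak{z})=\Theta_{S,0,0}(\tau,\mathfrak{z})+\sum_{n=1}^{\infty}\sum_{\substack{\lambda\in S^{-1}\mathbb{Z}^N\\ n>\frac12(\lambda,\lambda)}}\beta_{k,1}(n,\lambda)e^{2\pi\mathrm{i} n\tau}e^{2\pi\mathrm{i}(\lambda,\mathfrak{z})},\] where \[\beta_{k,1}(n,\lambda)=\frac{\Delta^{k-N/2-1}}{\operatorname{vol}(L)}\,\frac{\mathrm{i}^{k-N}(-2\pi)^{k-N/2}}{\zeta(k-N)\,(k-N/2-1)!}\sum_{a=1}^{\infty}\frac{N_a(Q^\vee)}{a^{k-1}},\] with $\Delta=n-\frac12(\lambda,\lambda)$, $Q^\vee(x)=\frac{(x,x)-2(\lambda,x)+2n}{2}$ and $N_a(Q^\vee)=\#\{x\in\mathbb{Z}^N/a\mathbb{Z}^N\,|\,Q^\vee(x)\equiv0\bmod a\}$.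
   Context: $L=\mathbb{Z}^N$ with Gram matrix $S\in\mathbb{Z}^{N\times N}$ symmetric positive definite with even diagonal, $(x,y)=x^tSy$ extended $\mathbb{C}$-bilinearly; $L^\vee=S^{-1}\mathbb{Z}^N$; $\operatorname{vol}(L)=(\det S)^{1/2}$ is the covolume of $L$; $\zeta$ is the Riemann zeta function. Slash actions for index $m=1$: $(\phi|_{k,1}\left(\begin{smallmatrix}a&b\\c&d\end{smallmatrix}\right))(\tau,\mathfrak{z})=(c\tau+d)^{-k}e^{-\pi\mathrm{i}\frac{c(\mathfrak{z},\mathfrak{z})}{c\tau+d}}\phi(\frac{a\tau+b}{c\tau+d},\frac{\mathfrak{z}}{c\tau+d})$ and $(\phi|_1[x,y])(\tau,\mathfrak{z})=e^{\pi\mathrm{i}((x,x)\tau+2(x,\mathfrak{z}))}\phi(\tau,\mathfrak{z}+x\tau+y)$ ($x,y\in L$), an action of $\Gamma^J=\mathrm{SL}(2,\mathbb{Z})\ltimes(L\times L)$. A holomorphic Jacobi form of weight $k$, index $1$ is a holomorphic $\phi$ invariant under $\Gamma^J$ with Fourier expansion $\sum_{n\in\mathbb{Z},l\in L^\vee,2n-(l,l)\ge0}f(n,l)e^{2\pi\mathrm{i} n\tau+2\pi\mathrm{i}(l,\mathfrak{z})}$. With $\Gamma^J_\infty=\{g\,;\,1|_{k,1}g=1\}$, $E_{k,1}=\sum_{g\in\Gamma^J_\infty\backslash\Gamma^J}1|_{k,1}g$, explicitly $E_{k,1}(\tau,\mathfrak{z})=\frac12\sum_{\gcd(c,d)=1}\sum_{x\in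 L}(c\tau+d)^{-k}\exp\big(\pi\mathrm{i}\frac{(x,x)(a\tau+b)+2(x,\mathfrak{z})-c(\mathfrak{z},\mathfrak{z})}{c\tau+d}\big)$ with $ad-bc=1$. $\Theta_{S,0,0}(\tau,\mathfrak{z})=\sum_{x\in\mathbb{Z}^N}\exp(\pi\mathrm{i}((x,x)\tau+2(x,\mathfrak{z})))$. *)

(* Defs.v *)
From HB Require Import structures.
From mathcomp Require Import all_boot all_order all_algebra.
From mathcomp Require Import finmap complex.
From mathcomp Require Import all_classical all_reals all_analysis.
From mathcomp Require Import summability.

Set Implicit Arguments.
Unset Strict Implicit.
Unset Printing Implicit Defensive.

Import Order.TTheory GRing.Theory Num.Theory.
Import numFieldNormedType.Exports.

Local Open Scope classical_set_scope.
Local Open Scope complex_scope.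
Local Open Scope ring_scope.

(* numFieldNormedType only covers abstract number fields; this equips the concrete
   type R[i] with the same topology, that of its norm. *)
HB.instance Definition _ (R : rcfType) := NormedModule.copy R[i] R[i]^o.

Section complex_analysis.
Context {R : realType}.

Definition cexp (w : R[i]) : R[i] :=
  (expR (complex.Re w))%:C * (cos (complex.Im w) +i* sin (complex.Im w)).

Definition upper_half_plane : set R[i] := [set t | 0 < complex.Im t].

Definition abs_summable (I : choiceType) (D : set I) (f : I -> R[i]) : Prop :=
  esum.summable D (fun i => (Normc.normc (f i))%:E).

(* Limit of the finite partial sums along the net of finite subsets of D. *)
Definition csum (I : choiceType) (D : set I) (f : I -> R[i]) : R[i] :=
  summability.sum (f \_ D).

(* Complex Frechet differentiability at every point of H x C^N. *)
Definition holomorphic (N : nat) (phi : R[i] -> 'cV[R[i]]_N -> R[i]) : Prop :=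
  forall p : R[i] * 'cV[R[i]]_N, upper_half_plane p.1 ->
    differentiable (fun q => phi q.1 q.2) p.

(* Dirichlet series of the Riemann zeta function; only meaningful for s > 1. *)
Definition zeta (s : R) : R := limn (series (riemannR s)).

End complex_analysis.

Definition form (A : nzRingType) (N : nat) (S : 'M[int]_N) (x y : 'cV[A]_N) : A :=
  (x^T *m map_mx intr S *m y) 0 0.

Definition pos_def (R : realType) (N : nat) (S : 'M[int]_N) : Prop :=
  forall x : 'cV[R]_N, x != 0 -> 0 < form S x x.

Definition dual_lattice (R : realType) (N : nat) (S : 'M[int]_N)
    : set 'cV[R]_N :=
  range (fun v : 'cV[int]_N => invmx (map_mx intr S) *m map_mx intr v).

Definition covolume (R : realType) (N : nat) (S : 'M[int]_N) : R :=
  Num.sqrt (\det S)%:~R.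

Section jacobi_group.

Definition SL2Z : Type := {M : 'M[int]_2 | \det M == 1}.
HB.instance Definition _ := SubChoice.on SL2Z.

Fact SL2Z_mul_subproof (M P : SL2Z) : \det (val M *m val P) == 1.
Proof. by rewrite det_mulmx (eqP (valP M)) (eqP (valP P)) mulr1. Qed.

Fact SL2Z_one_subproof : \det (1%:M : 'M[int]_2) == 1.
Proof. by rewrite det1. Qed.

Fact SL2Z_inv_subproof (M : SL2Z) : \det (invmx (val M)) == 1.
Proof. by rewrite det_inv (eqP (valP M)) invr1. Qed.

Definition SL2Z_mul (M P : SL2Z) : SL2Z := Sub (val M *m val P) (SL2Z_mul_subproof M P).
Definition SL2Z_one : SL2Z := Sub 1%:M SL2Z_one_subproof.
Definition SL2Z_inv (M : SL2Z) : SL2Z := Sub (invmx (val M)) (SL2Z_inv_subproof M).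

Fact SL2Z_unitmx (M : SL2Z) : val M \in unitmx.
Proof. by rewrite unitmxE (eqP (valP M)) unitr1. Qed.

(* The pair (x, y) of vectors of Z^N is stored as the N x 2 matrix with columns
   x and y, so that SL(2,Z) acts by X |-> X *m M, i.e.
   (x, y) |-> (a x + c y, b x + d y). *)
Definition jacobi_group (N : nat) : Type := (SL2Z * 'M[int]_(N, 2))%type.
HB.instance Definition _ N := Choice.on (jacobi_group N).

Variable N : nat.
Implicit Types g h : jacobi_group N.

Definition jacobi_mul g h : jacobi_group N :=
  (SL2Z_mul g.1 h.1, g.2 *m val h.1 + h.2).
Definition jacobi_one : jacobi_group N := (SL2Z_one, 0).
Definition jacobi_inv g : jacobi_group N :=
  (SL2Z_inv g.1, - (g.2 *m invmx (val g.1))).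

Fact jacobi_mulA : associative jacobi_mul.
Proof.
move=> [M X] [P Y] [Q Z]; congr pair; first by apply: val_inj; exact: mulmxA.
by rewrite /= mulmxDl addrA mulmxA.
Qed.

Fact jacobi_mul1 : left_id jacobi_one jacobi_mul.
Proof.
move=> [M X]; congr pair; first by apply: val_inj; exact: mul1mx.
by rewrite /= mul0mx add0r.
Qed.

Fact jacobi_mulg1 : right_id jacobi_one jacobi_mul.
Proof.
move=> [M X]; congr pair; first by apply: val_inj; exact: mulmx1.
by rewrite /= mulmx1 addr0.
Qed.

Fact jacobi_mulV : left_inverse jacobi_one jacobi_inv jacobi_mul.
Proof.
move=> [M X]; congr pair.
  by apply: val_inj; rewrite /= mulVmx// SL2Z_unitmx.
by rewrite /= mulNmx mulmxKV ?SL2Z_unitmx// addNr.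
Qed.

Fact jacobi_mulgV : right_inverse jacobi_one jacobi_inv jacobi_mul.
Proof.
move=> [M X]; congr pair.
  by apply: val_inj; rewrite /= mulmxV// SL2Z_unitmx.
by rewrite /= subrr.
Qed.

HB.instance Definition _ := isGroup.Build (jacobi_group N)
  jacobi_mulA jacobi_mul1 jacobi_mulg1 jacobi_mulV jacobi_mulgV.

End jacobi_group.

Section jacobi_forms.
Context {R : realType}.
Variables (N : nat) (k : nat) (S : 'M[int]_N).
Implicit Types (phi : R[i] -> 'cV[R[i]]_N -> R[i]) (t : R[i]) (z : 'cV[R[i]]_N).

Local Notation pii := (pi%:C * 'i : R[i]).

Definition slash_SL2Z (M : SL2Z) phi t z : R[i] :=
  let a := (val M 0 0)%:~R in let b := (val M 0 1)%:~R in
  let c := (val M 1 0)%:~R in let d := (val M 1 1)%:~R in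
  let j := c * t + d in
  j ^- k * cexp (- (pii * (c * form S z z / j)))
    * phi ((a * t + b) / j) (j^-1 *: z).

Definition slash_lattice (X : 'M[int]_(N, 2)) phi t z : R[i] :=
  let x := map_mx intr (col 0 X) in let y := map_mx intr (col 1 X) in
  cexp (pii * (form S x x * t + 2 * form S x z)) * phi t (z + t *: x + y).

Definition slash (g : jacobi_group N) phi : R[i] -> 'cV[R[i]]_N -> R[i] :=
  slash_lattice g.2 (slash_SL2Z g.1 phi).

Definition fourier_mode (n : int) (l : 'cV[R]_N) t z : R[i] :=
  cexp (2 * pii * n%:~R * t + 2 * pii * form S (map_mx (real_complex R) l) z).

Definition jacobi_fourier_support : set (int * 'cV[R]_N) :=
  [set p | dual_lattice S p.2 /\ 0 <= 2 * p.1%:~R - form S p.2 p.2].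

Definition holomorphic_jacobi_form phi : Prop :=
  [/\ holomorphic phi,
      (forall g t z, upper_half_plane t -> slash g phi t z = phi t z)
    & exists f : int -> 'cV[R]_N -> R[i], forall t z, upper_half_plane t ->
        let term p := f p.1 p.2 * fourier_mode p.1 p.2 t z in
        abs_summable jacobi_fourier_support term /\
        phi t z = csum jacobi_fourier_support term].

Definition GammaJ_infty : set (jacobi_group N) :=
  [set g | forall t z, upper_half_plane t -> slash g (fun _ _ => 1) t z = 1].

Definition right_cosets : set (set (jacobi_group N)) :=
  range (fun g => [set (h * g)%g | h in GammaJ_infty]).

(* 1 | g for an arbitrary element g of the coset C; the value does not depend
   on g. *)
Definition eisenstein_term (C : set (jacobi_group N)) t z : R[i] :=
  slash (xget 1%g C) (fun _ _ => 1) t z.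

Definition eisenstein t z : R[i] :=
  csum right_cosets (fun C => eisenstein_term C t z).

Definition theta t z : R[i] :=
  csum [set: 'cV[int]_N] (fun v =>
    let x := map_mx intr v in
    cexp (pii * (form S x x * t + 2 * form S x z))).

Definition Delta (n : nat) (l : 'cV[R]_N) : R := n%:R - form S l l / 2.

Definition Qdual (n : nat) (l : 'cV[R]_N) (v : 'cV[int]_N) : R :=
  let x := map_mx intr v in
  (form S x x - 2 * form S l x + 2 * n%:R) / 2.

(* Z^N / a Z^N is represented by the vectors with entries in {0, ..., a - 1}. *)
Definition Ncount (n : nat) (l : 'cV[R]_N) (a : nat) : nat :=
  #|[pred v : 'cV['I_a]_N |
      `[< exists m : int,
            Qdual n l (map_mx (fun i : 'I_a => (i : nat)%:Z) v)
            = a%:R * m%:~R >]]|.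

(* N is even, hence N./2 = N / 2, and the truncated subtractions are exact as
   soon as k > N + 2; the series over a >= 1 is indexed by a = i.+1. *)
Definition beta (n : nat) (l : 'cV[R]_N) : R[i] :=
  (Delta n l ^+ (k - N./2 - 1) / covolume R S)%:C
  * (('i : R[i]) ^+ (k - N) * ((- (2 * pi)) ^+ (k - N./2))%:C
     / (zeta (k - N)%:R * ((k - N./2 - 1)`!)%:R)%:C)
  * (limn (series (fun i => (Ncount n l i.+1)%:R / i.+1%:R ^+ (k - 1) : R)))%:C.

Definition eisenstein_fourier_support : set (nat * 'cV[R]_N) :=
  [set p | [/\ (1 <= p.1)%N, dual_lattice S p.2 & form S p.2 p.2 / 2 < p.1%:R]].

End jacobi_forms.

(* Main.v *)
(* Each coset of GammaJ_infty is determined by the bottom row (c, d) of a matrix, up to sign, and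
   a vector u of Z^N. The cosets with c = 0 give the theta series. For c >= 1, writing u = d x + c y
   with x modulo c turns the sum over u into a finite sum over x of shifted theta series; this finite
   sum makes sense for every d and scales by b^(N - k) when (c, d) is replaced by (b c, b d), so
   multiplying by zeta (k - N) completes the sum to all pairs with c >= 1. Theta inversion in y,
   then the Lipschitz formula in m, where d = d0 + c m, produce the Fourier expansion, and summing
   over d0 modulo c leaves the number of solutions of Q^vee(x) = 0 modulo c.

   Theta inversion in dimension one and the Lipschitz formula are both obtained as limits of the
   Fourier inversion formula on Z/M, and the N-dimensional case follows by Schur complements.
   Invariance is a reindexing of the cosets, and holomorphy follows from the Fourier expansion. *)

Require Import Defs.
From HB Require Import structures.
From mathcomp Require Import all_boot all_order all_algebra.
From mathcomp Require Import finmap complex.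
From mathcomp Require Import all_classical all_reals all_analysis.
From mathcomp Require Import summability ring lra zify.
Set Implicit Arguments.
Unset Strict Implicit.
Unset Printing Implicit Defensive.
Import Order.TTheory GRing.Theory Num.Theory.
Import numFieldNormedType.Exports.
Import Normc.
Local Open Scope classical_set_scope.
Local Open Scope complex_scope.
Local Open Scope ring_scope.

(* The imported libraries export another [form]. *)
Local Notation form := Defs.form.

(** No integral is taken anywhere: every passage to the limit is dominated convergence for sums
    ([tannery]). The obstacle is to find majorants uniform in M, and the chord bound |1 - e(m/M)| >=
    2|m|/M for centred residues supplies them. The Gaussian integral survives only as [gconst], a
    limit of Riemann sums. Self-duality of the theta series forces its value at 1, scaling by
    squares of integer ratios reveals the logarithmic derivative -1/(2 al), and following an
    exponential path selects the branch of al^(-1/2) on the right half plane.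

    For v in Z^N and l = S^-1 v the number (l, l)/2 is rational. The Lipschitz formula is thus
    needed only for shifts s/D, and choosing M divisible by D turns such a shift into a residue
    class. Evenness of N makes (w/i)^(N/2) an integral power. The condition k > N + 2 is what
    absolute convergence asks for: the sum over Z^N costs a factor |c t + d|^N, which leaves an
    exponent of at least 3 for the sum over the pairs (c, d). *)

Section Modulus.
Variable R : realType.
Implicit Types (x y : R[i]) (r s : R).

Lemma normr_normc x : `|x| = (normc x)%:C. Proof. by []. Qed.

Lemma normc_ge0 x : 0 <= normc x.
Proof. by rewrite -ler0c -normr_normc. Qed.

Lemma normcD x y : normc (x + y) <= normc x + normc y.
Proof. exact: le_normcD. Qed.

Lemma normcB x y : normc (x - y) <= normc x + normc y.
Proof. by apply: (le_trans (normcD _ _)); rewrite normcN. Qed.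

Lemma normcBC x y : normc (x - y) = normc (y - x).
Proof. by rewrite -normcN opprB. Qed.

Lemma normc_tri y x z : normc (x - z) <= normc (x - y) + normc (y - z).
Proof. by rewrite -[x - z](subrKA y) normcD. Qed.

Lemma normcX x n : normc (x ^+ n) = normc x ^+ n.
Proof. by elim: n => [|n IH]; rewrite ?normc1 // !exprS normcM IH. Qed.

Lemma normc_real r : normc r%:C = `|r|.
Proof. by rewrite /normc /= expr0n addr0 sqrtr_sqr. Qed.

Lemma normc_real_ge0 r : 0 <= r -> normc r%:C = r.
Proof. by move=> r0; rewrite normc_real ger0_norm. Qed.

Lemma normc_eq0 x : (normc x == 0) = (x == 0).
Proof. by apply/eqP/eqP => [/eq0_normc //|->]; rewrite normc0. Qed.

Lemma normc_gt0 x : (0 < normc x) = (x != 0).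
Proof. by rewrite lt_neqAle normc_ge0 andbT eq_sym normc_eq0. Qed.

Lemma normc_sum I (s : seq I) (P : pred I) (f : I -> R[i]) :
  normc (\sum_(i <- s | P i) f i) <= \sum_(i <- s | P i) normc (f i).
Proof.
elim/big_rec2: _ => [|i y1 y2 _ h]; first by rewrite normc0.
by apply: (le_trans (normcD _ _)); rewrite lerD2l.
Qed.

Lemma cReD x y : complex.Re (x + y) = complex.Re x + complex.Re y.
Proof. by case: x y => ? ? []. Qed.
Lemma cImD x y : complex.Im (x + y) = complex.Im x + complex.Im y.
Proof. by case: x y => ? ? []. Qed.
Lemma cReN x : complex.Re (- x) = - complex.Re x. Proof. by case: x. Qed.
Lemma cImN x : complex.Im (- x) = - complex.Im x. Proof. by case: x. Qed.
Lemma cReM x y : complex.Re (x * y) =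
  complex.Re x * complex.Re y - complex.Im x * complex.Im y.
Proof. by case: x y => ? ? []. Qed.
Lemma cImM x y : complex.Im (x * y) =
  complex.Re x * complex.Im y + complex.Im x * complex.Re y.
Proof. by case: x y => ? ? []. Qed.

Lemma normc_sqr x : normc x ^+ 2 = complex.Re x ^+ 2 + complex.Im x ^+ 2.
Proof. by case: x => a b /=; rewrite sqr_sqrtr // addr_ge0 ?sqr_ge0. Qed.

Lemma Re_le_normc x : `|complex.Re x| <= normc x.
Proof. by rewrite -sqrtr_sqr; case: x => a b /=; rewrite ler_wsqrtr // lerDl sqr_ge0. Qed.

Lemma Im_le_normc x : `|complex.Im x| <= normc x.
Proof. by rewrite -sqrtr_sqr; case: x => a b /=; rewrite ler_wsqrtr // lerDr sqr_ge0. Qed.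

Lemma normc_le_ReIm x : normc x <= `|complex.Re x| + `|complex.Im x|.
Proof.
rewrite -(ler_pXn2r (n := 2)) ?nnegrE ?normc_ge0 ?addr_ge0 //.
rewrite normc_sqr sqrrD !real_normK ?num_real // lerD2r lerDl.
by rewrite mulrn_wge0 // mulr_ge0.
Qed.

Lemma ReI x : x = complex.Re x +i* complex.Im x. Proof. by case: x. Qed.

Lemma eq_complexP x y : complex.Re x = complex.Re y -> complex.Im x = complex.Im y -> x = y.
Proof. by case: x y => ? ? [? ?] /= -> ->. Qed.

Lemma natrC n : (n%:R : R[i]) = (n%:R : R)%:C.
Proof. by rewrite rmorph_nat. Qed.
Lemma intrC (n : int) : (n%:~R : R[i]) = (n%:~R : R)%:C.
Proof. by rewrite rmorph_int. Qed.

Lemma realcD r s : (r + s)%:C = r%:C + s%:C :> R[i]. Proof. exact: rmorphD. Qed.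
Lemma realcN r : (- r)%:C = - r%:C :> R[i]. Proof. exact: rmorphN. Qed.
Lemma realcB r s : (r - s)%:C = r%:C - s%:C :> R[i]. Proof. exact: rmorphB. Qed.
Lemma realcM r s : (r * s)%:C = r%:C * s%:C :> R[i]. Proof. exact: rmorphM. Qed.
Lemma realcV r : (r^-1)%:C = (r%:C)^-1 :> R[i]. Proof. exact: fmorphV. Qed.
Lemma realcX r n : (r ^+ n)%:C = r%:C ^+ n :> R[i]. Proof. exact: rmorphXn. Qed.

Lemma normc_nat n : normc (n%:R : R[i]) = n%:R.
Proof. by rewrite natrC normc_real_ge0. Qed.

Lemma ler_addeps (a b : R) : (forall e, 0 < e -> a <= b + e) -> a <= b.
Proof. by move=> H; apply/ler_addgt0Pr. Qed.

Lemma normc_small0 x : (forall e : R, 0 < e -> normc x <= e) -> x = 0.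
Proof.
move=> H; apply: eq0_normc; apply/eqP; rewrite eq_le normc_ge0 andbT.
by apply: ler_addeps => e e0; rewrite add0r H.
Qed.

End Modulus.

Ltac pos := repeat first [ assumption | solve [apply: ltW; assumption]
  | exact: expR_ge0 | exact: normr_ge0 | exact: normc_ge0 | exact: pi_ge0 | exact: sqr_ge0
  | exact: ler0n | exact: ler01 | apply: mulr_ge0 | apply: addr_ge0
  | apply: exprn_ge0 | rewrite invr_ge0 ].

(** * Unconditional sums *)

Section Sums.
Variable R : realType.

(** Finite subsets are represented by duplicate-free lists, on which the big-operator lemmas act
    directly. *)
Definition bsum (I : choiceType) (g : I -> R) (B : R) :=
  forall s : seq I, uniq s -> \sum_(i <- s) g i <= B.

(** Absolute convergence is built in beside convergence along the net of finite subsets, so that a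
    value always brings a bound with it. [hsum_csum] and [hsum_abs_summable] translate this into the
    notions of the theorem. *)
Definition hsum (I : choiceType) (f : I -> R[i]) (l : R[i]) :=
  (exists B, bsum (fun i => normc (f i)) B) /\
  forall e : R, 0 < e -> exists A : seq I, forall B : seq I, uniq B ->
    {subset A <= B} -> normc (l - \sum_(i <- B) f i) <= e.

Section Basic.
Variable I : choiceType.
Implicit Types (f g : I -> R[i]) (s t : seq I) (b c : I -> R).

Lemma big_subseq (V : nmodType) (f : I -> V) s t : uniq s -> uniq t -> {subset s <= t} ->
  \sum_(i <- t) f i = \sum_(i <- s) f i + \sum_(i <- t | i \notin s) f i.
Proof.
move=> us ut st; rewrite (bigID (mem s)) /=; congr (_ + _).
rewrite -big_filter; apply: perm_big; apply: uniq_perm => //; first exact: filter_uniq.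
move=> i; rewrite mem_filter /=; case si: (i \in s) => //=.
exact: st.
Qed.

Lemma bsum_ge0 b B : bsum b B -> 0 <= B.
Proof. by move=> /(_ [::] isT); rewrite big_nil. Qed.

Lemma bsum_le b c B : (forall i, b i <= c i) -> bsum c B -> bsum b B.
Proof. by move=> bc H s us; apply: le_trans (H s us); apply: ler_sum. Qed.

Lemma bsum_leB b B B' : B <= B' -> bsum b B -> bsum b B'.
Proof. by move=> BB H s us; exact: le_trans (H s us) BB. Qed.

Lemma bsumZ b B (a : R) : 0 <= a -> bsum b B -> bsum (fun i => a * b i) (a * B).
Proof. by move=> a0 H s us; rewrite -mulr_sumr; apply: ler_wpM2l => //; exact: H. Qed.

Lemma bsumD b c B C : bsum b B -> bsum c C -> bsum (fun i => b i + c i) (B + C).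
Proof. by move=> H K s us; rewrite big_split /=; apply: lerD; [exact: H|exact: K]. Qed.

Lemma hsum_bsum f l : hsum f l -> exists B, bsum (fun i => normc (f i)) B.
Proof. by case. Qed.

Lemma hsum_near f l e (A0 : seq I) : hsum f l -> 0 < e ->
  exists A, [/\ uniq A, {subset A0 <= A} & normc (l - \sum_(i <- A) f i) <= e].
Proof.
move=> [_ /[apply]] [A HA]; exists (undup (A0 ++ A)); split.
- exact: undup_uniq.
- by move=> i; rewrite mem_undup mem_cat => ->.
- by apply: HA; [exact: undup_uniq|move=> i; rewrite mem_undup mem_cat orbC => ->].
Qed.

Lemma hsum_unique f l l' : hsum f l -> hsum f l' -> l = l'.
Proof.
move=> [_ H] [_ H']; apply/eqP; rewrite -subr_eq0; apply/eqP/normc_small0 => e e0.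
have e2 : 0 < e / 2 by rewrite divr_gt0.
have [A HA] := H _ e2; have [A' HA'] := H' _ e2.
pose B := undup (A ++ A').
have uB : uniq B by exact: undup_uniq.
have h1 : normc (l - \sum_(i <- B) f i) <= e / 2.
  by apply: HA => // i; rewrite mem_undup mem_cat => ->.
have h2 : normc (l' - \sum_(i <- B) f i) <= e / 2.
  by apply: HA' => // i; rewrite mem_undup mem_cat orbC => ->.
apply: (le_trans (normc_tri (\sum_(i <- B) f i) _ _)).
by rewrite [normc (_ - l')]normcBC [e]splitr lerD.
Qed.

Lemma hsumD f g l m : hsum f l -> hsum g m -> hsum (fun i => f i + g i) (l + m).
Proof.
move=> [[B bB] H] [[C bC] K]; split.
  exists (B + C); apply: bsum_le (bsumD bB bC) => i; exact: normcD.
move=> e e0; have e2 : 0 < e / 2 by rewrite divr_gt0.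
have [A HA] := H _ e2; have [A' HA'] := K _ e2.
exists (A ++ A') => D uD sD; rewrite big_split /= opprD addrACA [e]splitr.
apply: (le_trans (normcD _ _)); apply: lerD.
  by apply: HA => // i iA; apply: sD; rewrite mem_cat iA.
by apply: HA' => // i iA; apply: sD; rewrite mem_cat iA orbT.
Qed.

Lemma hsumZ f l a : hsum f l -> hsum (fun i => a * f i) (a * l).
Proof.
move=> [[B bB] H]; split.
  exists (normc a * B); apply: bsum_le (bsumZ (normc_ge0 a) bB) => i.
  by rewrite normcM.
move=> e e0; have n0 : 0 < normc a + 1 by rewrite ltr_wpDl ?normc_ge0.
have [A HA] := H _ (divr_gt0 e0 n0); exists A => D uD sD.
rewrite -mulr_sumr -mulrBr normcM.
apply: (le_trans (ler_wpM2l (normc_ge0 _) (HA D uD sD))).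
rewrite mulrA ler_pdivrMr // mulrC ler_wpM2l ?(ltW e0) //.
by rewrite lerDl.
Qed.

Lemma hsumN f l : hsum f l -> hsum (fun i => - f i) (- l).
Proof.
move=> /(hsumZ (-1)); rewrite mulN1r; congr (hsum _ _).
by apply: funext => i; rewrite mulN1r.
Qed.

Lemma hsumB f g l m : hsum f l -> hsum g m -> hsum (fun i => f i - g i) (l - m).
Proof. by move=> H /hsumN; apply: hsumD. Qed.

Lemma eq_hsum f g l : (forall i, f i = g i) -> hsum f l -> hsum g l.
Proof. by move=> /funext ->. Qed.

Lemma hsum0 : hsum (fun _ : I => 0) 0.
Proof.
split; first by exists 0 => s _; rewrite big1 // => i _; rewrite normc0.
by move=> e e0; exists [::] => B _ _; rewrite big1 // subr0 normc0 ltW.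
Qed.

Lemma hsum_sum (J : Type) (r : seq J) (f : J -> I -> R[i]) (l : J -> R[i]) :
  (forall j, hsum (f j) (l j)) ->
  hsum (fun i => \sum_(j <- r) f j i) (\sum_(j <- r) l j).
Proof.
move=> H; elim: r => [|j r IH].
  rewrite big_nil; apply: eq_hsum hsum0 => i; by rewrite big_nil.
rewrite big_cons; apply: eq_hsum (hsumD (H j) IH) => i; by rewrite big_cons.
Qed.

Lemma hsum_norm_le f l B : hsum f l -> bsum (fun i => normc (f i)) B -> normc l <= B.
Proof.
move=> hf bB; apply: ler_addeps => e e0.
have [A [uA _ hA]] := hsum_near [::] hf e0.
rewrite -[l](subrK (\sum_(i <- A) f i)) addrC.
apply: (le_trans (normcD _ _)); apply: lerD => //.
exact: le_trans (normc_sum _ _ _) (bB A uA).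
Qed.

Lemma hsum_real_ge b l s : (forall i, 0 <= b i) -> hsum (fun i => (b i)%:C) l -> uniq s ->
  \sum_(i <- s) b i <= complex.Re l.
Proof.
move=> b0 hb us; apply: ler_addeps => e e0.
have [A [uA sA hA]] := hsum_near s hb e0.
apply: (@le_trans _ _ (\sum_(i <- A) b i)).
  by rewrite (big_subseq _ us uA sA) lerDl sumr_ge0.
have := le_trans (Re_le_normc _) hA.
rewrite -raddf_sum cReD cReN /= ler_norml => /andP[+ _].
by move=> h; lra.
Qed.

Lemma hsum_real b l B : (forall i, 0 <= b i) -> hsum (fun i => (b i)%:C) l ->
  bsum b B -> complex.Re l <= B /\ complex.Im l = 0.
Proof.
move=> b0 hb bB; split.
  apply: le_trans (ler_norm _) _; apply: le_trans (Re_le_normc _) _.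
  apply: hsum_norm_le hb _; apply: bsum_le bB => i; by rewrite normc_real_ge0.
apply/eqP; rewrite -normr_eq0 eq_le normr_ge0 andbT.
apply: ler_addeps => e e0; have [A [uA sA hA]] := hsum_near [::] hb e0.
have := le_trans (Im_le_normc _) hA.
by rewrite -raddf_sum cImD cImN /= oppr0 addr0 add0r.
Qed.

Lemma hsum_ex_ge0 b B : (forall i, 0 <= b i) -> bsum b B ->
  exists l : R, hsum (fun i => (b i)%:C) l%:C.
Proof.
move=> b0 bB; pose E := [set x : R | exists2 s : seq I, uniq s & x = \sum_(i <- s) b i].
have supE : has_sup E.
  split; first by exists 0; exists [::]; rewrite ?big_nil.
  by exists B => x [s us ->]; exact: bB.
exists (sup E); split.
  by exists B; apply: bsum_le bB => i; rewrite normc_real_ge0.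
move=> e e0; have [x [s us ->] hx] := sup_adherent e0 supE.
exists s => D uD sD; rewrite -raddf_sum -rmorphB normc_real /=.
have le1 : \sum_(i <- D) b i <= sup E.
  by apply: ub_le_sup; [exact: supE.2|exists D].
rewrite ger0_norm ?subr_ge0 // lerBlDr addrC -lerBlDr; apply: le_trans (ltW hx) _.
by rewrite (big_subseq _ us uD sD) lerDl sumr_ge0.
Qed.

(** Nonnegative families converge to the supremum of their partial sums. A real family g dominated
    by |f| is the difference of |f| + g and |f|, and real and imaginary parts are treated
    separately. *)
Lemma hsum_ex f B : bsum (fun i => normc (f i)) B -> exists l, hsum f l.
Proof.
move=> bB.
have pos (g : I -> R) : (forall i, `|g i| <= normc (f i)) ->
    exists l, hsum (fun i => (g i)%:C) l.
  move=> hg; have [l1 h1] : exists l : R, hsum (fun i => (normc (f i) + g i)%:C) l%:C.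
    apply: (@hsum_ex_ge0 _ (B + B)).
      by move=> i; have := hg i; rewrite ler_norml -subr_ge0 opprK addrC => /andP[].
    apply: bsum_le (bsumD bB bB) => i; rewrite lerD2l.
    exact: le_trans (ler_norm _) (hg i).
  have [l2 h2] := hsum_ex_ge0 (fun i => normc_ge0 (f i)) bB.
  exists (l1%:C - l2%:C); apply: eq_hsum (hsumB h1 h2) => i.
  by rewrite -rmorphB /= [_ + g i]addrC addrK.
have [l1 h1] := pos _ (fun i => Re_le_normc (f i)).
have [l2 h2] := pos _ (fun i => Im_le_normc (f i)).
exists (l1 + 'i * l2); apply: eq_hsum (hsumD h1 (hsumZ 'i h2)) => i.
by rewrite [RHS]complexE.
Qed.

(** Cauchy criterion: the sums over A and over A together with D both lie within e/2 of the total,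
    hence D contributes at most e. *)
Lemma bsum_tail b B : (forall i, 0 <= b i) -> bsum b B -> forall e, 0 < e ->
  exists2 A : seq I, uniq A & forall D, uniq D -> (forall i, i \in D -> i \notin A) ->
    \sum_(i <- D) b i <= e.
Proof.
move=> b0 bB e e0; have [l hl] := hsum_ex_ge0 b0 bB.
have e2 : 0 < e / 2 by rewrite divr_gt0.
have [_ /(_ _ e2) [A0 HA]] := hl; pose A := undup A0.
have uA : uniq A by exact: undup_uniq.
have sA : {subset A0 <= A} by move=> i; rewrite mem_undup.
exists A => // D uD dD.
have uAD : uniq (A ++ D).
  by rewrite cat_uniq uA uD /= andbT; apply/hasPn.
have h1 := HA A uA sA.
have h2 : normc (l%:C - \sum_(i <- A ++ D) (b i)%:C) <= e / 2.
  by apply: HA => // i iA; rewrite mem_cat sA.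
have -> : \sum_(i <- D) b i = normc (\sum_(i <- D) (b i)%:C).
  by rewrite -raddf_sum normc_real_ge0 // sumr_ge0.
have -> : \sum_(i <- D) (b i)%:C =
   (l%:C - \sum_(i <- A) (b i)%:C) - (l%:C - \sum_(i <- A ++ D) (b i)%:C) :> R[i].
  by rewrite big_cat /=; ring.
by rewrite [e]splitr; apply: (le_trans (normcB _ _)); apply: lerD.
Qed.

Lemma hsum_tail f l b A e : hsum f l -> (forall i, normc (f i) <= b i) -> uniq A ->
  (forall D, uniq D -> (forall i, i \in D -> i \notin A) -> \sum_(i <- D) b i <= e) ->
  normc (l - \sum_(i <- A) f i) <= e.
Proof.
move=> hf fb uA tail; apply: ler_addeps => d d0.
have [D [uD sD hD]] := hsum_near A hf d0.
apply: (le_trans (normc_tri (\sum_(i <- D) f i) _ _)); rewrite addrC lerD //.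
rewrite (big_subseq _ uA uD sD) addrC addKr -big_filter.
apply: (le_trans (normc_sum _ _ _)); apply: (@le_trans _ _ (\sum_(i <- [seq i <- D | i \notin A]) b i)).
  exact: ler_sum.
apply: tail; first exact: filter_uniq.
by move=> i; rewrite mem_filter => /andP[].
Qed.

End Basic.

Definition tends (u : nat -> R[i]) (l : R[i]) :=
  forall e : R, 0 < e -> exists n0, forall n, (n0 <= n)%N -> normc (u n - l) <= e.

(** Tannery's theorem, that is, dominated convergence for sums: outside a finite set A both tails
    are at most e/3 by the majorant, and on A the convergence is termwise. *)
Lemma tannery (I : choiceType) (F : nat -> I -> R[i]) (f : I -> R[i]) (b : I -> R) B
    (lF : nat -> R[i]) l :
  bsum b B -> (forall n i, normc (F n i) <= b i) -> (forall n, hsum (F n) (lF n)) ->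
  (forall i, tends (F^~ i) (f i)) -> hsum f l -> tends lF l.
Proof.
move=> bB Fb hF tF hf.
have b0 i : 0 <= b i by apply: le_trans (Fb 0%N i); exact: normc_ge0.
have fb i : normc (f i) <= b i.
  apply: ler_addeps => e e0; have [n0 /(_ n0 (leqnn _)) h] := tF i e e0.
  rewrite -[f i](subKr (F n0 i)); apply: (le_trans (normcB _ _)).
  by apply: lerD.
move=> e e0; have e3 : 0 < e / 3 by rewrite divr_gt0.
have [A uA tA] := bsum_tail b0 bB e3.
have [n0 hn0] : exists n0, forall n, (n0 <= n)%N ->
    normc (\sum_(i <- A) F n i - \sum_(i <- A) f i) <= e / 3.
  have : forall d, 0 < d -> exists n0, forall n, (n0 <= n)%N ->
      normc (\sum_(i <- A) F n i - \sum_(i <- A) f i) <= d; last by apply.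
  move=> {tA uA e e0 e3} d; elim: A d => [|i A IH] d d0.
    by exists 0%N => n _; rewrite !big_nil subr0 normc0 ltW.
  have d2 : 0 < d / 2 by rewrite divr_gt0.
  have [n1 h1] := IH _ d2; have [n2 h2] := tF i _ d2.
  exists (maxn n1 n2) => n; rewrite geq_max => /andP[n1n n2n].
  rewrite !big_cons opprD addrACA [d]splitr; apply: (le_trans (normcD _ _)).
  by apply: lerD; [exact: h2|exact: h1].
exists n0 => n nn.
have h1 := hsum_tail (hF n) (Fb n) uA tA; have h2 := hsum_tail hf fb uA tA.
have -> : lF n - l = (lF n - \sum_(i <- A) F n i) +
   (\sum_(i <- A) F n i - \sum_(i <- A) f i) - (l - \sum_(i <- A) f i) by ring.
have -> : e = e / 3 + e / 3 + e / 3 by field.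
apply: (le_trans (normcB _ _)); apply: lerD => //.
by apply: (le_trans (normcD _ _)); apply: lerD => //; exact: hn0.
Qed.

Section Reindex.
Variables (I J : choiceType).

Lemma seq_preimage (h : J -> I) (s : seq I) : (forall i, i \in s -> exists j, h j = i) ->
  exists t, s = map h t.
Proof.
elim: s => [|i s IH] H; first by exists [::].
have [j hj] := H i (mem_head _ _).
have [t ->] : exists t, s = map h t.
  by apply: IH => k ks; apply: H; rewrite in_cons ks orbT.
by exists (j :: t); rewrite /= hj.
Qed.

Lemma bsum_inj (h : J -> I) (b : I -> R) B : injective h -> bsum b B -> bsum (fun j => b (h j)) B.
Proof. by move=> hi bB s us; rewrite -(big_map h predT b); apply: bB; rewrite map_inj_uniq. Qed.

Lemma big_preimage (V : nmodType) (h : J -> I) (f : I -> V) s : injective h -> uniq s ->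
    (forall i, (forall j, h j <> i) -> f i = 0) ->
  exists t, [/\ uniq t, \sum_(i <- s) f i = \sum_(j <- t) f (h j) &
    forall j, h j \in s -> j \in t].
Proof.
move=> hi us f0; pose P i := `[< exists j, h j = i >].
have [t ht] : exists t, [seq i <- s | P i] = map h t.
  by apply: seq_preimage => i; rewrite mem_filter => /andP[/asboolP].
exists t; split.
- by rewrite -(map_inj_uniq hi) -ht filter_uniq.
- rewrite (bigID P) /= [X in _ + X]big1 ?addr0; last first.
    by move=> i /asboolPn nP; apply: f0 => j hj; apply: nP; exists j.
  by rewrite -big_filter ht big_map.
- move=> j hj; rewrite -(mem_map hi) -ht mem_filter hj andbT.
  by apply/asboolP; exists j.
Qed.

Lemma bsum_inj_ext (h : J -> I) (b : I -> R) B : injective h ->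
  (forall i, (forall j, h j <> i) -> b i = 0) -> bsum (fun j => b (h j)) B -> bsum b B.
Proof.
move=> hi b0 bB s us; have [t [ut -> _]] := big_preimage hi us b0; exact: bB.
Qed.

Lemma hsum_reindex (h : J -> I) (f : I -> R[i]) l : injective h ->
  (forall i, (forall j, h j <> i) -> f i = 0) ->
  hsum f l <-> hsum (fun j => f (h j)) l.
Proof.
move=> hi f0; split=> -[[B bB] H].
  split; first by exists B; exact: bsum_inj bB.
  move=> e e0; have [A HA] := H e e0.
  have [A' [uA' _ hA']] := big_preimage hi (undup_uniq A) f0.
  exists A' => D uD sD.
  (* The image of D need not contain the part of A outside the range of h. Adding that part changes
     nothing in the sum, because f vanishes there. *)
  pose D1 := undup (map h D ++ [seq i <- A | ~~ `[< exists j, h j = i >]]).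
  have uD1 : uniq D1 by exact: undup_uniq.
  have -> : \sum_(j <- D) f (h j) = \sum_(i <- D1) f i.
    rewrite -(big_map h predT f) (@big_subseq _ _ _ (map h D) D1) ?map_inj_uniq //; last first.
      by move=> i; rewrite mem_undup mem_cat => ->.
    rewrite [X in _ + X]big_seq_cond [X in _ + X]big1 ?addr0 // => i.
    rewrite mem_undup mem_cat => /andP[/orP[->//|]].
    rewrite mem_filter => /andP[/asboolPn ni _] _.
    by apply: f0 => j hj; apply: ni; exists j.
  apply: HA => // i iA; rewrite mem_undup mem_cat.
  have [/asboolP [j hj]|ni] := boolP `[< exists j, h j = i >].
    apply/orP; left; apply/mapP; exists j => //; apply: sD; apply: hA'.
    by rewrite mem_undup hj.
  by apply/orP; right; rewrite mem_filter ni.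
split.
  exists B; apply: bsum_inj_ext hi _ bB => i hji; by rewrite f0 // normc0.
move=> e e0; have [A HA] := H e e0; exists (map h A) => D uD sD.
have [t [ut -> ht]] := big_preimage hi uD f0; apply: HA => // j jA.
by apply: ht; apply: sD; exact: map_f.
Qed.

Lemma hsum_bij (h : J -> I) (f : I -> R[i]) l : bijective h ->
  hsum f l <-> hsum (fun j => f (h j)) l.
Proof.
move=> bh; apply: hsum_reindex; first exact: bij_inj.
by case: bh => k hk kh i /(_ (k i)); rewrite kh.
Qed.

End Reindex.

Section Pairs.
Variables (I J : choiceType).

Lemma big_pair_sub (V : Type) (s : seq (I * J)) : uniq s ->
  let si := undup (map fst s) in let sj := undup (map snd s) in
  {subset s <= [seq (i, j) | i <- si, j <- sj]} /\ uniq [seq (i, j) | i <- si, j <- sj].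
Proof.
move=> us si sj; split; last by apply: allpairs_uniq; rewrite ?undup_uniq // => -[? ?] [].
move=> [i j] ij; apply/allpairsP; exists (i, j) => /=; rewrite !mem_undup.
by split => //; apply/mapP; exists (i, j).
Qed.

(** The Tonelli half of the interchange: a finite set of pairs sits inside the product of its two
    projections. *)
Lemma bsum_pair (b : I -> J -> R) (c : I -> R) C :
  (forall i j, 0 <= b i j) -> (forall i, bsum (b i) (c i)) -> bsum c C ->
  bsum (fun p : I * J => b p.1 p.2) C.
Proof.
move=> b0 bc cC s us; have [sub uu] := big_pair_sub R us.
apply: (@le_trans _ _ (\sum_(i <- undup (map fst s)) \sum_(j <- undup (map snd s)) b i j)).
  rewrite -(big_allpairs (F := fun p : I * J => b p.1 p.2)) /=.
  by rewrite (big_subseq _ us uu sub) lerDl sumr_ge0.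
apply: (@le_trans _ _ (\sum_(i <- undup (map fst s)) c i)).
  by apply: ler_sum => i _; apply: bc; exact: undup_uniq.
by apply: cC; exact: undup_uniq.
Qed.

Lemma bsum_prod (b : I -> R) (c : J -> R) B C : (forall i, 0 <= b i) -> (forall j, 0 <= c j) ->
  bsum b B -> bsum c C -> bsum (fun p : I * J => b p.1 * c p.2) (B * C).
Proof.
move=> b0 c0 bB cC; apply: (@bsum_pair (fun i j => b i * c j) (fun i => b i * C)).
- by move=> i j; rewrite mulr_ge0.
- by move=> i; apply: bsumZ.
- rewrite mulrC; apply: bsum_le (bsumZ (bsum_ge0 cC) bB) => i; by rewrite mulrC.
Qed.

Lemma bsum_row (b : I * J -> R) B i : bsum b B -> bsum (fun j => b (i, j)) B.
Proof. by apply: bsum_inj => ? ? []. Qed.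

Lemma hsum_row_ex (f : I * J -> R[i]) l i : hsum f l -> exists r, hsum (fun j => f (i, j)) r.
Proof. by move=> [[B bB] _]; apply: hsum_ex (bsum_row i bB). Qed.

(** The Fubini half: an absolutely convergent double sum may be summed by rows. With [hsum_swap] and
    [hsum_from_rows] it provides every interchange of sums below. *)
Lemma hsum_rows (f : I * J -> R[i]) (g : I -> R[i]) l :
  hsum f l -> (forall i, hsum (fun j => f (i, j)) (g i)) -> hsum g l.
Proof.
move=> [[B bB] H] hg; split.
  exists B => s us.
  (* The sums c i of moduli along rows dominate |g i|. Finitely many of them are summed column by
     column, where the bound B applies. *)
  have hb i : exists c : R, hsum (fun j => (normc (f (i, j)))%:C) c%:C.
    by apply: (@hsum_ex_ge0 _ _ B) => [j|]; [exact: normc_ge0|exact: (bsum_row i bB)].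
  have [c hc] := choice hb.
  apply: (@le_trans _ _ (\sum_(i <- s) c i)).
    apply: ler_sum => i _; apply: (hsum_norm_le (hg i)) => t ut.
    exact: (hsum_real_ge (fun j => normc_ge0 _) (hc i) ut).
  have hs := hsum_sum s hc; rewrite -raddf_sum in hs.
  have hs' : hsum (fun j => (\sum_(i <- s) normc (f (i, j)))%:C) (\sum_(i <- s) c i)%:C.
    by apply: eq_hsum hs => j; rewrite raddf_sum.
  have /= := (@hsum_real _ _ _ B _ hs' _).1; apply.
    by move=> j; apply: sumr_ge0 => i _; exact: normc_ge0.
  move=> t ut; rewrite exchange_big /=.
  rewrite -(big_allpairs (F := fun p : I * J => normc (f p))) /=.
  by apply: bB; apply: allpairs_uniq => // -[? ?] [].
move=> e e0; have e2 : 0 < e / 2 by rewrite divr_gt0.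
have [A HA] := H _ e2; exists (map fst A) => D uD sD.
have [_ /(_ _ e2) [T HT]] := hsum_sum D hg.
(* These columns serve both purposes: they approximate the chosen row sums, and with D they span a
   rectangle containing A. *)
pose T' := undup (T ++ map snd A).
have uT' : uniq T' by exact: undup_uniq.
have h1 : normc (\sum_(i <- D) g i - \sum_(j <- T') \sum_(i <- D) f (i, j)) <= e / 2.
  by apply: HT => // j; rewrite mem_undup mem_cat => ->.
have h2 : normc (l - \sum_(j <- T') \sum_(i <- D) f (i, j)) <= e / 2.
  rewrite exchange_big /= -(big_allpairs (F := f)) /=.
  apply: HA; first by apply: allpairs_uniq => // -[? ?] [].
  move=> [i j] ij; apply/allpairsP; exists (i, j); split => //=.
    by apply: sD; apply/mapP; exists (i, j).
  by rewrite mem_undup mem_cat; apply/orP; right; apply/mapP; exists (i, j).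
apply: (le_trans (normc_tri (\sum_(j <- T') \sum_(i <- D) f (i, j)) _ _)).
by rewrite [normc (_ - \sum_(i <- D) g i)]normcBC [e]splitr lerD.
Qed.

(** Convergence of the row sums alone would not suffice; the bound B on the whole double family
    makes some total exist, and [hsum_rows] then identifies it. *)
Lemma hsum_from_rows (f : I * J -> R[i]) (g : I -> R[i]) l B :
  bsum (fun p => normc (f p)) B -> (forall i, hsum (fun j => f (i, j)) (g i)) ->
  hsum g l -> hsum f l.
Proof.
move=> bB hr hg; have [l' hl'] := hsum_ex bB.
by rewrite (hsum_unique hg (hsum_rows hl' hr)).
Qed.

Lemma swap_bij (A B : Type) : bijective (fun p : A * B => (p.2, p.1)).
Proof. by exists (fun p => (p.2, p.1)) => -[]. Qed.

End Pairs.

Lemma hsum_swap (I J : choiceType) (f : I * J -> R[i]) l :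
  hsum f l <-> hsum (fun p : J * I => f (p.2, p.1)) l.
Proof. exact: (hsum_bij _ _ (swap_bij J I)). Qed.

Lemma hsum_mul (I J : choiceType) (f : I -> R[i]) (g : J -> R[i]) l m :
  hsum f l -> hsum g m -> hsum (fun p : I * J => f p.1 * g p.2) (l * m).
Proof.
move=> hf hg; have [B bB] := hsum_bsum hf; have [C cC] := hsum_bsum hg.
apply: (@hsum_from_rows _ _ _ (fun i => f i * m) _ (B * C)).
- apply: bsum_le (bsum_prod (fun i => normc_ge0 _) (fun i => normc_ge0 _) bB cC) => p /=.
  by rewrite normcM.
- by move=> i /=; apply: hsumZ.
- rewrite mulrC; apply: eq_hsum (hsumZ m hf) => i; by rewrite mulrC.
Qed.

Lemma hsum_fin (I : finType) (f : I -> R[i]) : hsum f (\sum_i f i).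
Proof.
have E (V : nmodType) (g : I -> V) s : uniq s -> \sum_i g i = \sum_(i <- s) g i + \sum_(i | i \notin s) g i.
  move=> us; rewrite (bigID (mem s)) /=; congr (_ + _).
  by rewrite big_uniq.
split.
  exists (\sum_i normc (f i)) => s us.
  by rewrite (E _ _ s us) lerDl sumr_ge0 // => i _; exact: normc_ge0.
move=> e e0; exists (enum I) => D uD sD; rewrite (E _ _ D uD) addrAC subrr add0r big1.
  by rewrite normc0 ltW.
by move=> i; rewrite sD // mem_enum.
Qed.

Lemma hsum_fin_rows (I : finType) (J : choiceType) (f : I * J -> R[i]) (g : I -> R[i]) :
  (forall i, hsum (fun j => f (i, j)) (g i)) -> hsum f (\sum_i g i).
Proof.
move=> hr.
have hB i : exists B, bsum (fun j => normc (f (i, j))) B by case: (hr i).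
have [c hc] := choice hB.
apply: (@hsum_from_rows _ _ _ g _ (\sum_i c i)) => //; last exact: hsum_fin.
suff H : bsum (fun p : I * J => normc (f (p.1, p.2))) (\sum_i c i).
  by apply: bsum_le H => -[i j].
apply: (@bsum_pair _ _ (fun i j => normc (f (i, j))) c) => [i j|//|].
  exact: normc_ge0.
move=> s us; rewrite [leRHS](bigID (mem s)) /= big_uniq //= lerDl.
  by apply: sumr_ge0 => i _; apply: bsum_ge0 (hc i).
Qed.

Lemma hsum_csum (I : choiceType) (D : set I) (f : I -> R[i]) l :
  hsum (f \_ D) l -> csum D f = l.
Proof.
move=> [_ H]; rewrite /csum /summability.sum; apply: cvg_lim; [exact: norm_hausdorff|exact: totally_filter|].
have FF : ProperFilter (@totally I) by exact: totally_filter.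
apply/cvgrPdist_le => /= e e0.
(* In the order of R[i] a positive number has imaginary part 0, so the tolerance is real. *)
have eR : e = (complex.Re e)%:C.
  by move: e0; rewrite ltcE /= => /andP[/eqP h _]; rewrite [LHS]ReI h.
have e0' : 0 < complex.Re e by move: e0; rewrite ltcE => /andP[].
have [A HA] := H _ e0'; exists [fset x in A]%fset => //= B AB.
rewrite normr_normc eR lecR /partial_sum.
rewrite -(big_seq_fsetE _ B predT (f \_ D)) /=; apply: HA; first exact: fset_uniq.
by move=> i iA; apply: (fsubsetP AB); rewrite inE.
Qed.

Lemma bsum_abs_summable (I : choiceType) (D : set I) (f : I -> R[i]) B :
  bsum (fun i => normc ((f \_ D) i)) B -> abs_summable D f.
Proof.
move=> bB; rewrite /abs_summable /esum.summable.
apply: (@le_lt_trans _ _ B%:E); last exact: ltry.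
apply: ge_ereal_sup => _ [F [finF FD]] <-.
rewrite fsbig_finite //= big_seq_cond.
have E i : i \in fset_set F -> `|(normc (f i))%:E|%E = (normc ((f \_ D) i))%:E.
  rewrite in_fset_set // inE => Fi.
  by rewrite abse_EFin ger0_norm ?normc_ge0 // patchE mem_set //; exact: FD.
rewrite (eq_bigr (fun i => (normc ((f \_ D) i))%:E)); last by move=> i /andP[/E].
rewrite -big_seq_cond sumEFin lee_fin; apply: bB; exact: fset_uniq.
Qed.

Lemma hsum_abs_summable (I : choiceType) (D : set I) (f : I -> R[i]) l :
  hsum (f \_ D) l -> abs_summable D f.
Proof. by move=> [[B bB] _]; apply: bsum_abs_summable bB. Qed.

End Sums.

(** * The complex exponential *)

Section Exponential.
Variable R : realType.
Implicit Types (w u v : R[i]) (x y : R).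

Lemma cexpD u v : cexp (u + v) = cexp u * cexp v.
Proof.
rewrite /cexp cReD cImD expRD cosD sinD rmorphM -!mulrA; congr (_ * _).
rewrite mulrCA; congr (_ * _).
by apply: eq_complexP; rewrite ?cReM ?cImM /=; ring.
Qed.

Lemma cexp0 : cexp (0 : R[i]) = 1.
Proof. by rewrite /cexp /= expR0 cos0 sin0 mul1r. Qed.

Lemma cexp_neq0 w : cexp w != 0.
Proof.
apply/eqP => h; have := cexpD w (- w); rewrite subrr cexp0 h mul0r => /eqP.
by rewrite oner_eq0.
Qed.

Lemma cexpN w : cexp (- w) = (cexp w)^-1.
Proof.
apply: (mulfI (cexp_neq0 w)); rewrite divff ?cexp_neq0 //.
by rewrite -cexpD subrr cexp0.
Qed.

Lemma cexpMn w n : cexp (n%:R * w) = cexp w ^+ n.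
Proof.
elim: n => [|n IH]; first by rewrite mul0r cexp0.
by rewrite -natr1 mulrDl mul1r cexpD IH exprSr.
Qed.

Lemma cexp_real x : cexp x%:C = (expR x)%:C.
Proof. by rewrite /cexp /= cos0 sin0 mulr1. Qed.

Lemma normc_cexp w : normc (cexp w) = expR (complex.Re w).
Proof.
rewrite /cexp normcM normc_real_ge0 ?expR_ge0 //= cos2Dsin2 sqrtr1 mulr1 //.
Qed.

Definition ipi : R[i] := pi%:C * 'i.
Definition ee w : R[i] := cexp (2 * ipi * w).

Lemma eeD u v : ee (u + v) = ee u * ee v.
Proof. by rewrite /ee mulrDr cexpD. Qed.
Lemma ee0 : ee 0 = 1. Proof. by rewrite /ee mulr0 cexp0. Qed.
Lemma eeN u : ee (- u) = (ee u)^-1. Proof. by rewrite /ee mulrN cexpN. Qed.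
Lemma ee_neq0 w : ee w != 0. Proof. exact: cexp_neq0. Qed.
Lemma eeMn w n : ee (n%:R * w) = ee w ^+ n.
Proof. by rewrite /ee -cexpMn mulrCA. Qed.

Lemma ee_real x : ee x%:C = cos (pi * x *+ 2) +i* sin (pi * x *+ 2).
Proof.
rewrite /ee (_ : 2 * ipi * x%:C = 0 +i* (pi * x *+ 2)).
  by rewrite /cexp /= expR0 mul1r.
by apply: eq_complexP; rewrite /ipi !(cReM, cImM) natrC /= ?[pi * x *+ 2]mulr2n; ring.
Qed.

Lemma ee_nat n : ee n%:R = 1.
Proof.
rewrite -[n%:R]mulr1 eeMn; suff -> : ee 1 = 1 by rewrite expr1n.
by rewrite -[1]/(1%:C) ee_real mulr1 cos2pi sin2pi.
Qed.

Lemma ee_int (n : int) : ee n%:~R = 1.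
Proof.
case: n => n; first by rewrite -pmulrn ee_nat.
by rewrite NegzE mulrNz eeN -pmulrn ee_nat invr1.
Qed.

Lemma eeDint w (n : int) : ee (w + n%:~R) = ee w.
Proof. by rewrite eeD ee_int mulr1. Qed.

Lemma normc_ee w : normc (ee w) = expR (- (2 * pi * complex.Im w)).
Proof.
rewrite /ee normc_cexp /ipi; congr expR.
by rewrite !(cReM, cImM) natrC /=; ring.
Qed.

Lemma normc_ee_real x : normc (ee x%:C) = 1.
Proof. by rewrite normc_ee /= mulr0 oppr0 expR0. Qed.

Lemma expR_sub1 x : `|expR x - 1| <= `|x| * expR `|x|.
Proof.
have h1 := expR_ge1Dx x; have h2 := expR_ge1Dx (- x).
have p0 := expR_gt0 x; have ee1 : expR x * expR (- x) = 1 by rewrite expRN divff // gt_eqF.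
have [x0|x0] := leP 0 x.
  by rewrite !ger0_norm ?subr_ge0 ?(le_trans _ h1) ?lerDl //; nra.
have h3 : 1 <= expR `|x| by rewrite -expR0 ler_expR.
rewrite ltr0_norm ?subr_lt0 ?expR_lt1 // ltr0_norm // in h3 *; nra.
Qed.

Lemma expR_sub1sub x : `|expR x - 1 - x| <= x ^+ 2 * expR `|x|.
Proof.
have h1 := expR_ge1Dx x; have h2 := expR_ge1Dx (- x).
have ee1 : expR x * expR (- x) = 1 by rewrite expRN divff // gt_eqF // expR_gt0.
rewrite ger0_norm; last by rewrite subr_ge0; lra.
have h := expR_sub1 x.
have p0 := expR_gt0 x.
have h4 : expR x - 1 - x <= x * (expR x - 1) by nra.
apply: (le_trans h4); apply: (le_trans (ler_norm _)); rewrite normrM.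
rewrite -[x ^+ 2]real_normK ?num_real // expr2 -mulrA.
exact: ler_wpM2l.
Qed.

(** Mean value theorem from 0, for both signs of y. The bound |c| <= |y| lets an estimate for the
    derivative be fed back into it. *)
Lemma mvt0 (f df : R -> R) y : (forall x, is_derive x 1 f (df x)) ->
  exists2 c, `|c| <= `|y| & f y - f 0 = df c * y.
Proof.
move=> df_f.
have cf : continuous f.
  move=> x; apply: differentiable_continuous; apply/derivable1_diffP.
  exact: ex_derive.
have [y0|y0] := leP 0 y.
  have [c + ->] := MVT_segment y0 (fun x _ => df_f x) (continuous_subspaceT cf).
  rewrite in_itv /= => /andP[c0 cy]; exists c; last by rewrite subr0.
  by rewrite !ger0_norm.
have [c + h] := MVT_segment (ltW y0) (fun x _ => df_f x) (continuous_subspaceT cf).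
rewrite in_itv /= => /andP[c0 cy]; exists c; last by rewrite -opprB h; ring.
by rewrite !ler0_norm ?(ltW y0) // lerN2.
Qed.

Lemma sin_abs_le y : `|sin y| <= `|y|.
Proof.
have [c _] := mvt0 y (@is_derive_sin R); rewrite sin0 subr0 => ->.
by rewrite normrM ler_piMl // cos_max.
Qed.

Lemma cos_sub1_le y : `|cos y - 1| <= `|y|.
Proof.
have [c _] := mvt0 y (@is_derive_cos R); rewrite cos0 => ->.
by rewrite normrM normrN ler_piMl // sin_max.
Qed.

Lemma cos_sub1_sqr y : `|cos y - 1| <= y ^+ 2.
Proof.
have [c cy] := mvt0 y (@is_derive_cos R); rewrite cos0 => ->.
rewrite normrM normrN -[y ^+ 2]real_normK ?num_real // expr2 ler_wpM2r //.
exact: le_trans (sin_abs_le c) cy.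
Qed.

Lemma sin_subid_sqr y : `|sin y - y| <= y ^+ 2.
Proof.
have [c cy] := mvt0 y (@is_derive_sin R); rewrite sin0 subr0 => ->.
rewrite -[X in _ - X]mul1r -mulrBl normrM.
rewrite -[y ^+ 2]real_normK ?num_real // expr2 ler_wpM2r //.
exact: le_trans (cos_sub1_le c) cy.
Qed.

Lemma cexp_taylor2 w :
  normc (cexp w - 1 - w) <= 3 * normc w ^+ 2 * expR (normc w).
Proof.
case: w => x y.
have hx : `|x| <= normc (x +i* y) by exact: (Re_le_normc (x +i* y)).
have hy : `|y| <= normc (x +i* y) by exact: (Im_le_normc (x +i* y)).
set r := normc _ in hx hy *.
have r0 : 0 <= r by exact: normc_ge0.
have E0 := expR_gt0 r.
have ex : expR x <= expR r by rewrite ler_expR (le_trans (ler_norm _)).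
have eax : expR `|x| <= expR r by rewrite ler_expR.
have px := expR_gt0 x; have pax := expR_gt0 `|x|.
have x2 : x ^+ 2 <= r ^+ 2 by rewrite -[x ^+ 2]real_normK ?num_real // ler_pXn2r ?nnegrE.
have y2 : y ^+ 2 <= r ^+ 2 by rewrite -[y ^+ 2]real_normK ?num_real // ler_pXn2r ?nnegrE.
have r2 : 0 <= r ^+ 2 by exact: sqr_ge0.
apply: (le_trans (normc_le_ReIm _)).
have -> : complex.Re (cexp (x +i* y) - 1 - (x +i* y)) = expR x * (cos y - 1) + (expR x - 1 - x).
  by rewrite !(cReD, cReN) /cexp cReM /=; ring.
have -> : complex.Im (cexp (x +i* y) - 1 - (x +i* y)) = expR x * (sin y - y) + (expR x - 1) * y.
  by rewrite !(cImD, cImN) /cexp cImM /=; ring.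
have -> : 3 * r ^+ 2 * expR r = (expR r * r ^+ 2) + (r ^+ 2 * expR r * 2) by ring.
have h1 : `|expR x * (cos y - 1)| <= expR x * y ^+ 2.
  by rewrite normrM gtr0_norm // ler_pM2l // cos_sub1_sqr.
have h2 : `|expR x * (sin y - y)| <= expR x * y ^+ 2.
  by rewrite normrM gtr0_norm // ler_pM2l // sin_subid_sqr.
have h3 := expR_sub1sub x.
have h4 : `|(expR x - 1) * y| <= `|x| * expR `|x| * `|y|.
  by rewrite normrM ler_wpM2r // expR_sub1.
(* [x^2 + |x||y| + 2 y^2 e^x] against [3 r^2 e^r], using [x^2 + y^2 = r^2] *)
have rE : r ^+ 2 = x ^+ 2 + y ^+ 2 by rewrite /r normc_sqr.
have h5 : `|x| * expR `|x| * `|y| <= r ^+ 2 * expR r.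
  rewrite mulrAC; apply: ler_pM => //; rewrite ?mulr_ge0 ?(ltW pax) //.
  by rewrite expr2; apply: ler_pM.
have h6 : expR x * y ^+ 2 <= expR r * y ^+ 2 by rewrite ler_wpM2r ?sqr_ge0.
have h7 : x ^+ 2 * expR `|x| <= x ^+ 2 * expR r by rewrite ler_wpM2l ?sqr_ge0.
have h8 : x ^+ 2 * expR r + expR r * y ^+ 2 = r ^+ 2 * expR r by rewrite rE; ring.
have h9 : expR r * y ^+ 2 <= expR r * r ^+ 2 by rewrite ler_pM2l.
have hA := ler_normD (expR x * (cos y - 1)) (expR x - 1 - x).
have hB := ler_normD (expR x * (sin y - y)) ((expR x - 1) * y).
lra.
Qed.

Lemma le_expR x : x <= expR x.
Proof. by apply: le_trans (expR_ge1Dx x); rewrite lerDr. Qed.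

Lemma cexp_taylor1 w : normc (cexp w - 1) <= 4 * normc w * expR (2 * normc w).
Proof.
have r0 := normc_ge0 w; set r := normc w in r0 *.
have -> : cexp w - 1 = (cexp w - 1 - w) + w by ring.
apply: (le_trans (normcD _ _)); have h := cexp_taylor2 w.
apply: (le_trans (lerD h (lexx _))); rewrite -/r.
have e1 : 1 <= expR r by rewrite -expR0 ler_expR.
have e2 := le_expR r.
have -> : expR (2 * r) = expR r * expR r by rewrite mulr_natl mulr2n expRD.
have h1 : r * (r * expR r) <= r * (expR r * expR r) by rewrite ler_wpM2l // ler_wpM2r // expR_ge0.
have h2 : r * 1 <= r * (expR r * expR r) by rewrite ler_wpM2l //; nra.
rewrite expr2; nra.
Qed.

(** One half of A t^2 absorbs C|t| by completing the square, at the price C^2/(2A). The other half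
    absorbs the polynomial, because 1 + t^2 <= (1 + 4/A)(1 + A t^2/4) <= (1 + 4/A) e^(A t^2/4). *)
Lemma gauss_bound (A C : R) : 0 < A ->
  exists2 K, 0 < K & forall t : R, (1 + t ^+ 2) ^+ 2 * expR (- (A * t ^+ 2) + C * `|t|) <= K.
Proof.
move=> A0; exists ((1 + 4 / A) ^+ 2 * expR (C ^+ 2 / (2 * A))).
  by rewrite mulr_gt0 ?expR_gt0 // exprn_gt0 // addr_gt0 // divr_gt0.
move=> t.
have h1 : - (A * t ^+ 2) + C * `|t| <= - (A / 2 * t ^+ 2) + C ^+ 2 / (2 * A).
  rewrite -subr_ge0 -[t ^+ 2]real_normK ?num_real //.
  have -> : - (A / 2 * `|t| ^+ 2) + C ^+ 2 / (2 * A) - (- (A * `|t| ^+ 2) + C * `|t|)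
     = A / 2 * (`|t| - C / A) ^+ 2 by field; rewrite gt_eqF.
  by rewrite mulr_ge0 ?sqr_ge0 // ltW // divr_gt0.
have h2 : (1 + t ^+ 2) ^+ 2 <= (1 + 4 / A) ^+ 2 * expR (A / 2 * t ^+ 2).
  have -> : expR (A / 2 * t ^+ 2) = expR (A / 4 * t ^+ 2) ^+ 2.
    by rewrite -[RHS]expRM_natl; congr expR; field.
  rewrite -exprMn ler_pXn2r ?nnegrE ?addr_ge0 ?sqr_ge0 // ?mulr_ge0 ?expR_ge0 //; last first.
    by rewrite addr_ge0 // ltW // divr_gt0.
  apply: (@le_trans _ _ ((1 + 4 / A) * (1 + A / 4 * t ^+ 2))); last first.
    by rewrite ler_wpM2l ?expR_ge1Dx // addr_ge0 // ltW // divr_gt0.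
  have -> : (1 + 4 / A) * (1 + A / 4 * t ^+ 2) = 1 + t ^+ 2 + (4 / A + A / 4 * t ^+ 2).
    by field; rewrite gt_eqF.
  have q1 : 0 <= 4 / A by rewrite divr_ge0 // ltW.
  have q2 : 0 <= A / 4 * t ^+ 2 by rewrite mulr_ge0 ?sqr_ge0 // divr_ge0 // ltW.
  by rewrite lerDl addr_ge0.
apply: (@le_trans _ _ ((1 + 4 / A) ^+ 2 * expR (A / 2 * t ^+ 2) *
    expR (- (A / 2 * t ^+ 2) + C ^+ 2 / (2 * A)))); last first.
  by rewrite -mulrA -expRD addrA subrr add0r.
by apply: ler_pM; rewrite ?ler_expR ?expR_ge0 ?sqr_ge0.
Qed.

Lemma gauss_bound1 (A C : R) : 0 < A ->
  exists2 K, 0 < K & forall t : R, expR (- (A * t ^+ 2) + C * `|t|) <= K / (1 + t ^+ 2).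
Proof.
move=> A0; have [K K0 HK] := gauss_bound C A0; exists K => // t.
have t0 : 1 <= 1 + t ^+ 2 by rewrite lerDl sqr_ge0.
rewrite ler_pdivlMr ?(lt_le_trans _ t0) //; apply: le_trans (HK t).
rewrite mulrC ler_wpM2r ?expR_ge0 // expr2 ler_peMr //; exact: le_trans t0.
Qed.

Lemma half_angle_cos x : 0 <= x <= pi / 4 -> 0 <= cos x /\ 1 / 2 <= cos x ^+ 2.
Proof.
move=> /andP[x0 x1]; have p0 := pi_gt0 R; split.
  by apply: cos_ge0_pihalf; apply/andP; split; lra.
have : 0 <= cos (x *+ 2).
  by apply: cos_ge0_pihalf; rewrite -mulr_natl; apply/andP; split; lra.
by rewrite cos_mulr2n => h; lra.
Qed.

(** By the doubling formula and the mean value theorem sin y = cos c * cos (y/2) * y, where both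
    angles lie in an interval on which the squared cosine is at least 1/2. *)
Lemma sin_ge_half y : 0 <= y <= pi / 2 -> y / 2 <= sin y.
Proof.
move=> /andP[y0 y1]; have p0 := pi_gt0 R.
have [c] := mvt0 (y / 2) (@is_derive_sin R); rewrite sin0 subr0.
rewrite (ger0_norm (x := y / 2)) ?divr_ge0 // => cy hs.
have [a0 a1] : 0 <= cos c /\ 1 / 2 <= cos c ^+ 2.
  rewrite -cos_norm; apply: half_angle_cos; rewrite normr_ge0 /=; lra.
have [b0 b1] : 0 <= cos (y / 2) /\ 1 / 2 <= cos (y / 2) ^+ 2.
  by apply: half_angle_cos; apply/andP; split; lra.
have -> : sin y = cos c * cos (y / 2) * y.
  by rewrite [in LHS](splitr y) sinD hs; field.
rewrite [leLHS]mulrC ler_wpM2r //.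
have h : (1 / 2) ^+ 2 <= (cos c * cos (y / 2)) ^+ 2.
  by rewrite !exprMn; nra.
by move: h; rewrite ler_pXn2r ?nnegrE ?mulr_ge0 // mul1r.
Qed.

Lemma normc_1subee x : normc (1 - ee x%:C) = 2 * `|sin (pi * x)|.
Proof.
apply/eqP; rewrite -(eqrXn2 (n := 2)) ?normc_ge0 ?mulr_ge0 //; apply/eqP.
rewrite normc_sqr exprMn real_normK ?num_real //.
have -> : 1 - ee x%:C = (1 - cos (pi * x *+ 2)) +i* (- sin (pi * x *+ 2)).
  rewrite ee_real; by apply: eq_complexP; rewrite ?cReD ?cImD ?cReN ?cImN /=; ring.
have h := cos2Dsin2 (pi * x *+ 2).
rewrite /= sqrrN; have h2 := cos_mulr2n (pi * x).
have h3 := cos2Dsin2 (pi * x); rewrite !expr2 in h h2 h3 *; nra.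
Qed.

(** The chord |1 - e(m/M)| is 2|sin (pi m/M)|, at least pi |m|/M by [sin_ge_half], and pi >= 2.
    Being uniform in M, this bound yields the majorants for both inversion formulas. *)
Lemma normc_1subee_ge (m : int) (M : nat) : (0 < M)%N -> (2 * `|m| <= M)%N ->
  2 * `|m|%:R / M%:R <= normc (1 - ee ((m%:~R / M%:R : R)%:C)).
Proof.
move=> M0 mM; rewrite normc_1subee.
have MR : (0 < M%:R :> R) by rewrite ltr0n.
have aE : `|m%:~R : R| = `|m|%:R by rewrite -intr_norm natr_absz.
have sE (x : R) : `|sin x| = `|sin `|x| |.
  have [x0|x0] := leP 0 x; first by rewrite (ger0_norm x0).
  by rewrite (ltr0_norm x0) sinN normrN.
have yE : `|pi * (m%:~R / M%:R) : R| = pi * (`|m|%:R / M%:R).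
  rewrite normrM normf_div aE !ger0_norm ?pi_ge0 //.
rewrite sE yE.
have y1 : (`|m|%:R / M%:R : R) <= 1 / 2.
  by rewrite ler_pdivrMr // mul1r mulrC ler_pdivlMr // -natrM ler_nat mulnC.
have y0 : 0 <= (`|m|%:R / M%:R : R) by rewrite divr_ge0.
have p2 := pi_ge2 R; have p0 := pi_gt0 R.
have h : pi * (`|m|%:R / M%:R) / 2 <= sin (pi * (`|m|%:R / M%:R) : R).
  by apply: sin_ge_half; apply/andP; split; nra.
apply: (@le_trans _ _ (2 * sin (pi * (`|m|%:R / M%:R)))); last by rewrite ler_pM2l // ler_norm.
rewrite -mulrA; nra.
Qed.

(** The principal logarithm on the right half plane: the angle is the arctangent of b/a, and a sqrt
    (1 + (b/a)^2) is the modulus. *)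
Lemma cexp_onto (a : R[i]) : 0 < complex.Re a ->
  exists2 w, cexp w = a & `|complex.Im w| < pi / 2.
Proof.
case: a => a b /= a0; pose x := b / a.
have s0 : 0 < Num.sqrt (1 + x ^+ 2).
  by rewrite sqrtr_gt0 ltr_pwDl // sqr_ge0.
exists (ln (a * Num.sqrt (1 + x ^+ 2)) +i* atan x); last first.
  by rewrite /= ltr_norml atan_ltpi2 atan_gtNpi2.
rewrite /cexp /= lnK ?posrE ?mulr_gt0 //.
have ca : cos (atan x) = (Num.sqrt (1 + x ^+ 2))^-1 by exact: cos_atan.
have sa : sin (atan x) = x * (Num.sqrt (1 + x ^+ 2))^-1.
  have h := atanK x; rewrite /tan in h.
  by rewrite -ca -[X in X * _]h divfK // ca invr_eq0 gt_eqF.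
rewrite ca sa; apply: eq_complexP; rewrite ?cReM ?cImM /= mul0r ?subr0 ?addr0.
  by rewrite mulfK // gt_eqF.
by rewrite mulrACA divff ?gt_eqF // mulr1 /x mulrC divfK // gt_eqF.
Qed.

End Exponential.

(** * Limits of complex sequences *)

Section Tends.
Variable R : realType.
Implicit Types (u v : nat -> R[i]) (l m : R[i]).

Lemma tends_unique u l m : tends u l -> tends u m -> l = m.
Proof.
move=> hl hm; apply/eqP; rewrite -subr_eq0; apply/eqP/normc_small0 => e e0.
have e2 : 0 < e / 2 by rewrite divr_gt0.
have [n1 h1] := hl _ e2; have [n2 h2] := hm _ e2.
pose n := maxn n1 n2; rewrite [e]splitr.
apply: (le_trans (normc_tri (u n) _ _)); rewrite normcBC.
by apply: lerD; [apply: h1|apply: h2]; rewrite ?leq_maxl ?leq_maxr.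
Qed.

Lemma tends_cst l : tends (fun _ => l) l.
Proof. by move=> e e0; exists 0%N => n _; rewrite subrr normc0 ltW. Qed.

Lemma tendsD u v l m : tends u l -> tends v m -> tends (fun n => u n + v n) (l + m).
Proof.
move=> hl hm e e0; have e2 : 0 < e / 2 by rewrite divr_gt0.
have [n1 h1] := hl _ e2; have [n2 h2] := hm _ e2; exists (maxn n1 n2) => n.
rewrite geq_max => /andP[/h1 k1 /h2 k2].
by rewrite opprD addrACA [e]splitr (le_trans (normcD _ _)) ?lerD.
Qed.

Lemma tends_inv_nat : tends (fun n => (n.+1%:R)^-1) (0 : R[i]).
Proof.
move=> e e0; exists (Num.bound e^-1) => n hn; rewrite subr0 normcV normc_nat.
rewrite invf_ple ?posrE //; apply: (le_trans (ltW (archi_boundP _))); first by rewrite invr_ge0 ltW.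
by rewrite ler_nat; apply: leq_trans hn _.
Qed.

Lemma tends_bound u l C (v : nat -> nat) : (forall n, n <= v n)%N ->
  (exists n0, forall n, (n0 <= n)%N -> normc (u n - l) <= C / (v n).+1%:R) -> tends u l.
Proof.
move=> vn [n0 hu] e e0; have C0 : 0 < `|C| + 1 by rewrite ltr_wpDl.
have [n1 h1] := tends_inv_nat (divr_gt0 e0 C0).
exists (maxn n0 n1) => n; rewrite geq_max => /andP[/hu k1 k2].
apply: (le_trans k1); have /h1 : (n1 <= v n)%N by exact: leq_trans k2 (vn n).
rewrite subr0 normcV normc_nat => k3.
apply: (@le_trans _ _ ((`|C| + 1) / (v n).+1%:R)).
  by rewrite ler_wpM2r ?invr_ge0 // (le_trans (ler_norm _)) // lerDl.
by rewrite mulrC -ler_pdivlMr.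
Qed.

Lemma tends_sub u l (v : nat -> nat) : (forall n, n <= v n)%N -> tends u l ->
  tends (fun n => u (v n)) l.
Proof.
move=> vn hu e e0; have [n0 h] := hu e e0; exists n0 => n nn.
by apply: h; exact: leq_trans nn (vn n).
Qed.

Lemma eq_tends u v l : (forall n, u n = v n) -> tends u l -> tends v l.
Proof. by move=> /funext ->. Qed.

Lemma tendsM u v l m : tends u l -> tends v m -> tends (fun n => u n * v n) (l * m).
Proof.
move=> hl hm e e0.
pose K := normc l + normc m + 2; have K0 : 0 < K.
  by rewrite ltr_wpDl // addr_ge0 ?normc_ge0.
pose d := Num.min 1 (e / K).
have d0 : 0 < d by rewrite lt_min ltr01 divr_gt0.
have [n1 h1] := hl _ d0; have [n2 h2] := hm _ d0; exists (maxn n1 n2) => n.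
rewrite geq_max => /andP[/h1 k1 /h2 k2].
have -> : u n * v n - l * m = (u n - l) * (v n - m) + (u n - l) * m + l * (v n - m) by ring.
have d1 : d <= 1 by rewrite ge_min lexx.
have d2 : d * K <= e by rewrite -ler_pdivlMr // ge_min lexx orbT.
have a0 := normc_ge0 (u n - l); have b0 := normc_ge0 (v n - m).
have l0 := normc_ge0 l; have m0 := normc_ge0 m.
apply: (le_trans (normcD _ _)); apply: (le_trans (lerD (normcD _ _) (lexx _))).
rewrite !normcM; apply: le_trans d2; rewrite /K.
have p1 : normc (u n - l) * normc (v n - m) <= d * d by exact: ler_pM.
have p2 : normc (u n - l) * normc m <= d * normc m by exact: ler_wpM2r.
have p3 : normc l * normc (v n - m) <= normc l * d by exact: ler_wpM2l.
nra.
Qed.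

Lemma tendsV u l : l != 0 -> tends u l -> tends (fun n => (u n)^-1) l^-1.
Proof.
move=> l0 hl e e0; have nl : 0 < normc l by rewrite normc_gt0.
pose d := Num.min (normc l / 2) (e * (normc l ^+ 2 / 2)).
have d0 : 0 < d by rewrite lt_min !(divr_gt0, mulr_gt0, exprn_gt0).
have [n1 h1] := hl _ d0; exists n1 => n /h1 k1.
have d1 : normc (u n - l) <= normc l / 2 by apply: (le_trans k1); rewrite ge_min lexx.
have d2 : normc (u n - l) <= e * (normc l ^+ 2 / 2).
  by apply: (le_trans k1); rewrite ge_min lexx orbT.
have un : normc l / 2 <= normc (u n).
  have := normc_tri (u n) l 0; rewrite !subr0 normcBC => h; lra.
have un0 : u n != 0 by rewrite -normc_gt0; apply: lt_le_trans un; rewrite divr_gt0.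
have -> : (u n)^-1 - l^-1 = - (u n - l) / (u n * l) by field; rewrite un0 l0.
rewrite normcM normcN normcV normcM.
have p : normc l ^+ 2 / 2 <= normc (u n) * normc l.
  by rewrite expr2 mulrAC ler_pM2r.
rewrite ler_pdivrMr ?mulr_gt0 ?normc_gt0 //; apply: (le_trans d2).
by rewrite ler_pM2l.
Qed.

Lemma tendsX u l k : tends u l -> tends (fun n => u n ^+ k) (l ^+ k).
Proof.
move=> hl; elim: k => [|k IH]; first exact: tends_cst.
by rewrite exprS; apply: (eq_tends _ (tendsM hl IH)) => n; rewrite exprS.
Qed.

Lemma tendsN u l : tends u l -> tends (fun n => - u n) (- l).
Proof.
move=> h; rewrite -mulN1r; apply: (eq_tends _ (tendsM (tends_cst (-1)) h)) => n.
by rewrite mulN1r.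
Qed.

Lemma tends_norm_le u l B : tends u l -> (forall n, normc (u n) <= B) -> normc l <= B.
Proof.
move=> hu hB; apply: ler_addeps => e e0; have [n0 /(_ _ (leqnn _)) h] := hu e e0.
rewrite -[l](subKr (u n0)); apply: (le_trans (normcB _ _)).
exact: lerD.
Qed.

End Tends.

(** * Lattice sums *)

Section LatticeBounds.
Variable R : realType.

Lemma bsum_nat (g : nat -> R) B : (forall i, 0 <= g i) ->
  (forall n, \sum_(0 <= i < n) g i <= B) -> bsum g B.
Proof.
move=> g0 H s us; pose n := (\max_(i <- s) i).+1.
apply: le_trans (H n); rewrite (@big_subseq _ _ _ s (index_iota 0 n)) ?iota_uniq //.
  by rewrite lerDl sumr_ge0.
by move=> i si; rewrite mem_index_iota /= ltnS; apply: leq_bigmax_seq.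
Qed.

Lemma bsum_int (g : int -> R) B B' :
  bsum (fun n : nat => g n%:Z) B -> bsum (fun n : nat => g (- n.+1%:Z)) B' ->
  bsum g (B + B').
Proof.
move=> h1 h2.
pose g1 (x : int) := if x is Posz n then g x else 0.
pose g2 (x : int) := if x is Negz n then g x else 0.
have H1 : bsum g1 B.
  apply: (@bsum_inj_ext _ _ _ Posz) h1; first by move=> ? ? [].
  by case=> n // /(_ n).
have H2 : bsum g2 B'.
  apply: (@bsum_inj_ext _ _ _ Negz); first by move=> ? ? [].
    by case=> n // /(_ n).
  by apply: bsum_le h2 => n; rewrite /g2 NegzE.
by apply: bsum_le (bsumD H1 H2) => -[n|n]; rewrite /g1 /g2 ?addr0 ?add0r.
Qed.

Lemma bsum_inv_sqr (M : R) : 1 <= M -> bsum (fun n : nat => (M + n%:R) ^- 2) (2 / M).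
Proof.
move=> M1; have M0 : 0 < M by exact: lt_le_trans M1.
have Mn n : 1 <= M + n%:R by rewrite (le_trans M1) // lerDl.
have Mn0 n : 0 < M + n%:R by exact: lt_le_trans (Mn n).
apply: bsum_nat => [n|n]; first by rewrite invr_ge0 exprn_ge0 // ltW.
(* Telescoping: 1/a^2 <= 2/a - 2/(a + 1) as soon as a >= 1. *)
suff : \sum_(0 <= i < n) (M + i%:R) ^- 2 <= 2 / M - 2 / (M + n%:R).
  move=> /le_trans; apply; rewrite gerBl divr_ge0 // ltW //.
elim: n => [|n IH]; first by rewrite big_nil addr0 subrr.
rewrite big_nat_recr //=; apply: (le_trans (lerD IH (lexx _))).
rewrite -addrA lerD2l; set a := M + n%:R.
have -> : M + n.+1%:R = a + 1 by rewrite -natr1 addrA.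
have a0 : 0 < a by exact: Mn0.
have a1 : 0 < a + 1 by rewrite addr_gt0.
rewrite -subr_ge0.
have -> : - (2 / (a + 1)) - (- (2 / a) + a ^- 2) = (a - 1) / (a ^+ 2 * (a + 1)).
  by field; rewrite !gt_eqF.
by rewrite divr_ge0 ?subr_ge0 ?Mn // mulr_ge0 ?sqr_ge0 // ltW.
Qed.

Lemma bsum_int_inv_sqr (M : R) : 1 <= M ->
  bsum (fun x : int => (M + `|x|%:R) ^- 2) (4 / M).
Proof.
move=> M1; have M0 : 0 < M by exact: lt_le_trans M1.
have -> : 4 / M = 2 / M + 2 / M by field; rewrite gt_eqF.
apply: bsum_int; first exact: bsum_inv_sqr.
apply: bsum_le (bsum_inv_sqr M1) => n; rewrite abszN absz_nat.
rewrite lef_pV2 ?posrE ?exprn_gt0 ?ltr_wpDr // ler_pXn2r ?nnegrE ?addr_ge0 ?(ltW M0) //.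
by rewrite lerD2l ler_nat.
Qed.

Lemma abs_intr (x : int) : `|x%:~R : R| = `|x|%:R.
Proof. by rewrite -intr_norm natr_absz. Qed.

(** The bound must be linear in M: the sum is M times a Riemann sum of 1/(1 + t^2) with mesh 1/M. It
    follows from (M + n)^2 <= 2 (M^2 + n^2) and [bsum_int_inv_sqr]. *)
Lemma bsum_cauchy (M : R) : 1 <= M ->
  bsum (fun x : int => (1 + (x%:~R / M) ^+ 2)^-1) (8 * M).
Proof.
move=> M1; have M0 : 0 < M by exact: lt_le_trans M1.
have -> : 8 * M = 2 * M ^+ 2 * (4 / M) by field; rewrite gt_eqF.
have c0 : 0 <= 2 * M ^+ 2 by rewrite mulr_ge0 ?sqr_ge0.
apply: bsum_le (bsumZ c0 (bsum_int_inv_sqr M1)) => x.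
rewrite expr_div_n -[(x%:~R) ^+ 2]real_normK ?num_real // abs_intr.
set n := (`|x|%:R : R); have n0 : 0 <= n by exact: ler0n.
have p1 : 0 < M + n by rewrite ltr_wpDr.
have p2 : 0 < M ^+ 2 + n ^+ 2 by rewrite ltr_wpDr ?sqr_ge0 // exprn_gt0.
have -> : (1 + n ^+ 2 / M ^+ 2)^-1 = M ^+ 2 / (M ^+ 2 + n ^+ 2).
  by field; rewrite !gt_eqF //=; apply/andP; split; rewrite // gt_eqF // addr_gt0.
rewrite -mulrA mulrCA ler_pM2l ?exprn_gt0 // -subr_ge0.
have -> : 2 * (M + n) ^- 2 - (M ^+ 2 + n ^+ 2)^-1 =
   (M - n) ^+ 2 / ((M + n) ^+ 2 * (M ^+ 2 + n ^+ 2)) by field; rewrite !gt_eqF.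
by rewrite divr_ge0 ?sqr_ge0 // mulr_ge0 ?sqr_ge0 // ltW.
Qed.

(** Summing over the second index lowers the exponent by one, to the summable 2. The exponent 3 is
    the lower bound for k - N. *)
Lemma bsum_int2_inv_cube :
  bsum (fun p : int * int => (1 + `|p.1|%:R + `|p.2|%:R) ^- 3) (16 : R).
Proof.
have p0 (n : nat) : 0 < 1 + n%:R :> R by rewrite ltr_wpDr.
apply: (@bsum_pair _ _ _ (fun c d : int => (1 + `|c|%:R + `|d|%:R) ^- 3)
   (fun c : int => 4 * (1 + `|c|%:R) ^- 2)).
- by move=> c d; rewrite invr_ge0 exprn_ge0 // !addr_ge0.
- move=> c; set M := 1 + `|c|%:R : R.
  have M1 : 1 <= M by rewrite /M lerDl.
  have M0 : 0 < M by exact: lt_le_trans M1.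
  have -> : 4 * M ^- 2 = M^-1 * (4 / M) by field; rewrite gt_eqF.
  have Mi : 0 <= M^-1 by rewrite invr_ge0 ltW.
  apply: bsum_le (bsumZ Mi (bsum_int_inv_sqr M1)) => d.
  have q : 0 < M + `|d|%:R by rewrite ltr_wpDr.
  rewrite exprS invfM ler_wpM2r ?invr_ge0 ?exprn_ge0 ?(ltW q) // lef_pV2 ?posrE //.
  by rewrite lerDl.
- have -> : (16 : R) = 4 * (4 / 1) by field.
  exact: bsumZ (bsum_int_inv_sqr (lexx 1)).
Qed.

(** From y^(n+2) <= (n+2)! e^y with y = d (x + A); two powers beyond n are spent on the denominator
    (1 + x)^2, which makes the bound summable. *)
Lemma poly_exp_bound (d A : R) (n : nat) : 0 < d -> 1 <= A ->
  exists2 K, 0 < K & forall x : R, 0 <= x ->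
    (x + A) ^+ n * expR (- (d * x)) <= K / (1 + x) ^+ 2.
Proof.
move=> d0 A1; exists ((n.+2)`!%:R / d ^+ n.+2 * expR (d * A)).
  by rewrite mulr_gt0 ?expR_gt0 // divr_gt0 ?exprn_gt0 // ltr0n fact_gt0.
move=> x x0; have A0 : 0 < A by exact: lt_le_trans A1.
have xA : 0 < x + A by rewrite ltr_wpDl.
have y0 : 0 <= d * (x + A) by rewrite mulr_ge0 // ltW.
have f0 : 0 < (n.+2)`!%:R :> R by rewrite ltr0n fact_gt0.
have h : (d * (x + A)) ^+ n.+2 <= (n.+2)`!%:R * expR (d * (x + A)).
  have := expR_ge1Dxn n.+1 y0; rewrite -ler_pdivrMl // mulrC => /(le_trans _); apply.
  by rewrite lerDr.
have x1 : 0 < 1 + x by rewrite ltr_pwDl.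
rewrite ler_pdivlMr ?exprn_gt0 //.
apply: (@le_trans _ _ ((x + A) ^+ n.+2 * expR (- (d * x)))).
  rewrite mulrAC ler_wpM2r ?expR_ge0 // -[n.+2]addn2 exprD ler_pM2l ?exprn_gt0 //.
  rewrite ler_pXn2r ?nnegrE ?(ltW x1) ?(ltW xA) // addrC lerD2l //.
rewrite exprMn in h.
have h2 : (x + A) ^+ n.+2 <= (n.+2)`!%:R / d ^+ n.+2 * expR (d * (x + A)).
  by rewrite mulrAC ler_pdivlMr ?exprn_gt0 // mulrC.
apply: (le_trans (ler_wpM2r (expR_ge0 _) h2)).
rewrite -(mulrA (_ / _)) -expRD ler_pM2l ?divr_gt0 ?exprn_gt0 // ler_expR.
by rewrite mulrDr addrAC subrr add0r.
Qed.

End LatticeBounds.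

(** * The binomial series of (1 - x)^-(a+1) *)

Section Generating.
Variable R : realType.
Implicit Types (x : R[i]).

Lemma bsum_geom (r : R) : 0 <= r < 1 -> bsum (fun j : nat => r ^+ j) (1 - r)^-1.
Proof.
move=> /andP[r0 r1]; have q : 0 < 1 - r by rewrite subr_gt0.
apply: bsum_nat => [j|n]; first exact: exprn_ge0.
rewrite -[leRHS]mul1r ler_pdivlMr //.
suff -> : (\sum_(0 <= i < n) r ^+ i) * (1 - r) = 1 - r ^+ n by rewrite gerBl exprn_ge0.
elim: n => [|n IH]; first by rewrite big_nil mul0r expr0 subrr.
by rewrite big_nat_recr //= mulrDl IH exprS; ring.
Qed.

Lemma bsum_bin (r : R) a : 0 <= r < 1 ->
  bsum (fun j : nat => 'C(j + a, a)%:R * r ^+ j) ((1 - r) ^- a.+1).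
Proof.
move=> /andP[r0 r1]; have q : 0 < 1 - r by rewrite subr_gt0.
have t0 b j : 0 <= 'C(j + b, b)%:R * r ^+ j by rewrite mulr_ge0 ?exprn_ge0.
elim: a => [|a IH].
  rewrite expr1; apply: bsum_le (@bsum_geom r _); last by rewrite r0 r1.
  by move=> j; rewrite bin0 mul1r.
apply: bsum_nat => [j|n]; first exact: t0.
have E : (\sum_(0 <= j < n) 'C(j + a.+1, a.+1)%:R * r ^+ j) * (1 - r) =
    \sum_(0 <= j < n) 'C(j + a, a)%:R * r ^+ j - 'C(n + a, a.+1)%:R * r ^+ n.
  elim: n => [|n IHn]; first by rewrite !big_nil mul0r add0n bin_small // mul0r subr0.
  rewrite !big_nat_recr //= mulrDl IHn addnS addSn binS natrD exprS; ring.
rewrite exprSr invfM ler_pdivlMr // E.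
apply: le_trans (IH (index_iota 0 n) (iota_uniq _ _)); rewrite gerBl.
by rewrite mulr_ge0 ?exprn_ge0.
Qed.

Lemma hsum_shift (f : nat -> R[i]) l : f 0%N = 0 ->
  hsum f l <-> hsum (fun j => f j.+1) l.
Proof.
move=> f0; apply: hsum_reindex; first exact: succn_inj.
by case=> [|n] // /(_ n).
Qed.

Lemma hsum_bin x a : normc x < 1 ->
  hsum (fun j : nat => 'C(j + a, a)%:R * x ^+ j) ((1 - x) ^- a.+1).
Proof.
move=> x1; have r1 : 0 <= normc x < 1 by rewrite normc_ge0.
have q : 1 - x != 0.
  by rewrite subr_eq0; apply: contraTneq x1 => <-; rewrite normc1 ltxx.
have ex b : exists l, hsum (fun j : nat => 'C(j + b, b)%:R * x ^+ j) l.
  apply: (@hsum_ex _ _ _ ((1 - normc x) ^- b.+1)).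
  apply: bsum_le (bsum_bin b r1) => j; by rewrite normcM normc_nat normcX.
elim: a => [|a IH].
  have [l hl] := ex 0%N; rewrite expr1.
  have hl1 : hsum (fun j : nat => if j is _.+1 then x ^+ j else 0) (x * l).
    apply/hsum_shift => //; apply: eq_hsum (hsumZ x hl) => j.
    by rewrite bin0 mul1r exprS.
  have := hsumB hl hl1; rewrite -{1}[l]mul1r -mulrBl => h.
  have h1 : hsum (fun j : nat => if j is 0%N then 1 else 0) (1 : R[i]).
    have := hsum_fin (fun _ : 'I_1 => 1 : R[i]).
    rewrite big_ord1 => h1; apply/(@hsum_reindex _ _ _ (fun i : 'I_1 => i : nat)).
    - exact: ord_inj.
    - by case=> [|//] /(_ ord0).
    - by apply: eq_hsum h1 => i; rewrite ord1.
  have e : (1 - x) * l = 1.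
    apply: hsum_unique h _; apply: eq_hsum h1 => -[|j].
      by rewrite bin0 expr0 mul1r subr0.
    by rewrite bin0 mul1r subrr.
  by rewrite (_ : (1 - x)^-1 = l) // -[RHS](mulKf q) e mulr1.
have [l hl] := ex a.+1.
have hl1 : hsum (fun j : nat => 'C(j + a, a.+1)%:R * x ^+ j) (x * l).
  apply/hsum_shift; first by rewrite add0n bin_small // mul0r.
  (* Multiplying the series for a + 1 by x shifts its index, so that Pascal's rule turns
     multiplication by 1 - x into the series for a. *)
  by apply: eq_hsum (hsumZ x hl) => j; rewrite addSnnS exprS mulrCA.
have := hsumB hl hl1; rewrite -{1}[l]mul1r -mulrBl => h.
have e : (1 - x) * l = (1 - x) ^- a.+1.
  apply: hsum_unique h _; apply: eq_hsum IH => j.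
  by rewrite addnS binS natrD; ring.
have -> : (1 - x) ^- a.+2 = l; last by [].
by rewrite exprS invfM -e mulKf.
Qed.

End Generating.

(** * The Lipschitz formula *)

Section Window.
Variable R : realType.

(* Residues modulo M are taken centred at 0, where |1 - e(m/M)| >= 2|m|/M. *)
Definition win (M : nat) (i : 'I_M) : int := (i : nat)%:Z - (M./2)%:Z.
Definition inwin (M : nat) (m : int) : bool :=
  (- (M./2)%:Z <= m) && (m < M%:Z - (M./2)%:Z).

Lemma win_inj M : injective (@win M).
Proof. by move=> i j /eqP; rewrite /win => /eqP h; apply: ord_inj; lia. Qed.

Lemma inwin_win M (i : 'I_M) : inwin M (win i).
Proof. by rewrite /inwin /win; have := ltn_ord i; lia. Qed.

Lemma inwin_ex M m : inwin M m -> exists i : 'I_M, win i = m.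
Proof.
rewrite /inwin => /andP[h1 h2].
have lt : (`|(m + (M./2)%:Z)%R|%N < M)%N by lia.
by exists (Ordinal lt); rewrite /win /=; lia.
Qed.

Lemma inwin_abs M m : inwin M m -> (2 * `|m| <= M)%N.
Proof. by rewrite /inwin => /andP[h1 h2]; have := odd_double_half M; case: (odd M) => /=; lia. Qed.

Lemma abs_inwin M m : (2 * `|m| < M)%N -> inwin M m.
Proof. by rewrite /inwin => h; have := odd_double_half M; case: (odd M) => /=; lia. Qed.

Lemma hsum_win M (f : int -> R[i]) :
  hsum (fun m => if inwin M m then f m else 0) (\sum_(i < M) f (win i)).
Proof.
apply/(hsum_reindex _ (@win_inj M)).
  by move=> m hm; case: ifP => // wm; have [i /hm] := inwin_ex wm.
have := hsum_fin (fun i : 'I_M => f (win i)); apply: eq_hsum => i.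
by rewrite inwin_win.
Qed.

(** Replacing b by its centred residue m, the chord bound leaves m = 0 as the only solution of
    e(m/M) = 1. *)
Lemma ee_ratio_eq1 (b : int) M : (0 < M)%N ->
  (ee (b%:~R / M%:R : R[i]) == 1) = (M%:Z %| b)%Z.
Proof.
move=> M0; have Mn : (M%:R : R[i]) != 0 by rewrite pnatr_eq0 -lt0n.
apply/eqP/idP => [h|/dvdzP[c ->]]; last first.
  by rewrite intrM -pmulrn mulfK // ee_int.
have [i hi] : exists i : 'I_M, (M%:Z %| b - win i)%Z.
  have lt : (`|((b + (M./2)%:Z) %% M%:Z)%Z|%N < M)%N by lia.
  exists (Ordinal lt); rewrite /win /=; apply/dvdzP.
  exists ((b + (M./2)%:Z) %/ M%:Z)%Z.
  have := divz_eq (b + (M./2)%:Z) M%:Z; lia.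
have /dvdzP[c hc] := hi.
have bE : b = win i + c * M%:Z by lia.
have h1 : ee ((win i)%:~R / M%:R : R[i]) = 1.
  move: h; rewrite bE intrD intrM -pmulrn mulrDl mulfK // eeDint //.
have := normc_1subee_ge R M0 (inwin_abs (inwin_win i)).
have -> : (((win i)%:~R / M%:R : R)%:C) = (win i)%:~R / M%:R :> R[i].
  by rewrite rmorphM /= intrC natrC fmorphV.
rewrite h1 subrr normc0 pmulr_lle0 ?invr_gt0 ?ltr0n // pmulr_rle0 // lern0 => /eqP h0.
by rewrite bE (_ : win i = 0) ?add0r ?dvdz_mull //; lia.
Qed.

(** Orthogonality of the characters of Z/M, through the geometric sum of e(b/M). *)
Lemma sum_win_ee (b : int) M : (0 < M)%N ->
  \sum_(i < M) ee ((win i)%:~R * b%:~R / M%:R : R[i]) =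
  if (M%:Z %| b)%Z then M%:R else 0.
Proof.
move=> M0; have Mn : (M%:R : R[i]) != 0 by rewrite pnatr_eq0 -lt0n.
have E (i : 'I_M) : ee ((win i)%:~R * b%:~R / M%:R : R[i]) =
    ee (- ((M./2)%:R * b%:~R / M%:R)) * ee (b%:~R / M%:R) ^+ i.
  rewrite -eeMn -eeD; congr ee; rewrite /win intrB -!pmulrn; field; exact: Mn.
rewrite (eq_bigr _ (fun i _ => E i)) -mulr_sumr -(ee_ratio_eq1 b M0).
case: eqP => [h|/eqP h].
  rewrite h (eq_bigr (fun _ => 1)) => [|i _]; last by rewrite expr1n.
  rewrite sumr_const card_ord eeN -mulrA eeMn h expr1n invr1 mul1r //.
have : (ee (b%:~R / M%:R : R[i]) - 1) * \sum_(i < M) ee (b%:~R / M%:R) ^+ i = 0.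
  by rewrite -subrX1 -eeMn mulrCA mulfV // mulr1 ee_int subrr.
by move/eqP; rewrite mulf_eq0 subr_eq0 (negPf h) /= => /eqP ->; rewrite mulr0.
Qed.

End Window.

Section Lipschitz.
Variable R : realType.
Variables (t : R[i]) (s D a : nat).
Hypotheses (t_im : 0 < complex.Im t) (s_lt : (s < D)%N) (a_gt : (0 < a)%N).
Let rho : R[i] := s%:R / D%:R.
Let rhoR : R := s%:R / D%:R.

Let D0 : (0 < D)%N. Proof. exact: leq_ltn_trans s_lt. Qed.
Let Dn : (D%:R : R[i]) != 0. Proof. by rewrite pnatr_eq0 -lt0n. Qed.
Let M n := (D * n.+1)%N.
Let M0 n : (0 < M n)%N. Proof. by rewrite muln_gt0 D0. Qed.
Let Mn n : ((M n)%:R : R[i]) != 0. Proof. by rewrite pnatr_eq0 -lt0n. Qed.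
Let rhoC : rho = rhoR%:C.
Proof. by rewrite /rho /rhoR rmorphM fmorphV !rmorph_nat. Qed.

Let im_div (m : int) n : complex.Im ((t + m%:~R) / (M n)%:R) = complex.Im t / (M n)%:R.
Proof.
rewrite intrC natrC -fmorphV /= cImM cImD cReD /=; ring.
Qed.

Let norm_lt1 (m : int) n : normc (ee ((t + m%:~R) / (M n)%:R)) < 1.
Proof.
rewrite normc_ee im_div -[ltRHS]expR0 ltr_expR oppr_lt0 !mulr_gt0 ?pi_gt0 ?invr_gt0 ?ltr0n //.
Qed.

Let y n (i : nat) : R := 'C(n.+1 * (s + i * D) + a, a)%:R / (M n)%:R ^+ a.

(** The binomial series is taken at x = e((t + m)/M) and averaged over m with weight e(-rho m).
    Orthogonality keeps the indices j = s (n+1) modulo M, that is j = (n+1)(s + i D), for which j/M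
    = i + rho exactly because D divides M. *)
Let finite_identity n :
  hsum (fun i : nat => (y n i)%:C * ee ((i%:R + rho) * t))
   (\sum_(i < M n) ((M n)%:R * (1 - ee ((t + (win i)%:~R) / (M n)%:R))) ^- a.+1
      * ee (- (rho * (win i)%:~R))).
Proof.
pose C j : R[i] := 'C(j + a, a)%:R.
have h1 : hsum (fun j : nat => \sum_(i < M n)
     ee (- (rho * (win i)%:~R)) * (C j * ee ((t + (win i)%:~R) / (M n)%:R) ^+ j))
   (\sum_(i < M n) ee (- (rho * (win i)%:~R)) * (1 - ee ((t + (win i)%:~R) / (M n)%:R)) ^- a.+1).
  apply: hsum_sum => i; apply: hsumZ; apply: hsum_bin; exact: norm_lt1.
have h2 := hsumZ ((M n)%:R ^- a.+1) h1; move: h2.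
have -> : (M n)%:R ^- a.+1 * (\sum_(i < M n) ee (- (rho * (win i)%:~R)) *
    (1 - ee ((t + (win i)%:~R) / (M n)%:R)) ^- a.+1) =
   \sum_(i < M n) ((M n)%:R * (1 - ee ((t + (win i)%:~R) / (M n)%:R))) ^- a.+1
      * ee (- (rho * (win i)%:~R)).
  rewrite mulr_sumr; apply: eq_bigr => i _; rewrite exprMn invfM.
  by rewrite mulrCA mulrC.
set L := \sum_(i < M n) _.
have E j : (M n)%:R ^- a.+1 * (\sum_(i < M n)
     ee (- (rho * (win i)%:~R)) * (C j * ee ((t + (win i)%:~R) / (M n)%:R) ^+ j)) =
   (M n)%:R ^- a.+1 * (C j * ee (j%:R * t / (M n)%:R) *
     if ((M n)%:Z %| j%:Z - (s * n.+1)%N%:Z)%Z then (M n)%:R else 0).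
  congr (_ * _); rewrite -sum_win_ee // mulr_sumr; apply: eq_bigr => i _.
  rewrite mulrCA -mulrA; congr (_ * _); rewrite -eeMn -!eeD; congr ee.
  rewrite /rho intrB -!pmulrn /M !natrM; field.
  by rewrite ?nat1r Dn pnatr_eq0.
move/(eq_hsum E) => {E h1}; set f := fun j => _.
pose h i := (n.+1 * (s + i * D))%N.
have hi : injective h.
  move=> i j /eqP; rewrite eqn_pmul2l // eqn_add2l eqn_pmul2r // => /eqP //.
move/(hsum_reindex (h := h) (f := f) _ hi) => H.
apply: eq_hsum (H _) => [i|j hj]; last first.
  rewrite /f; case: ifP; last by rewrite !mulr0.
  move=> /dvdzP [c hc].
  have c0 : 0 <= c.
    rewrite leNgt; apply/negP => c1.
    have : (s * n.+1 < M n)%N by rewrite /M ltn_pmul2r.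
    move: hc; rewrite -[c]opprK; have : 1 <= - c by lia.
    case: (- c) => // u; nia.
  have /hj[] : h `|c|%N = j by rewrite /h; move: hc; rewrite /M; lia.
rewrite /f /h /y.
have -> : ((M n)%:Z %| (n.+1 * (s + i * D))%N%:Z - (s * n.+1)%N%:Z)%Z.
  by apply/dvdzP; exists i%:Z; rewrite /M; lia.
rewrite realcM realcV realcX -!natrC /C exprS invfM.
have -> : (n.+1 * (s + i * D))%:R * t / (M n)%:R = (i%:R + rho) * t.
  rewrite /M /rho !natrM natrD natrM; field.
  by rewrite ?nat1r Dn pnatr_eq0.
by field; rewrite (expf_neq0 a (Mn n)) Mn.
Qed.

Let tends_M (u : nat -> R[i]) l C : (exists n0, forall n, (n0 <= n)%N ->
  normc (u n - l) <= C / (M n)%:R) -> tends u l.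
Proof.
move=> [n0 H].
apply: (@tends_bound _ _ _ C (fun n => (M n).-1)) => [n|].
  by rewrite /M -ltnS prednK ?M0 // leq_pmull.
by exists n0 => n nn; rewrite prednK ?M0 //; exact: H.
Qed.

Let tends_ee (w : R[i]) :
  tends (fun n => (M n)%:R * (1 - ee (w / (M n)%:R))) (- (2 * ipi R * w)).
Proof.
pose b := normc (2 * ipi R * w).
apply: (tends_M (C := 3 * b ^+ 2 * expR b)); exists 0%N => n _.
have m0 : 0 < (M n)%:R :> R by rewrite ltr0n.
have m1 : 1 <= (M n)%:R :> R by rewrite ler1n.
have -> : (M n)%:R * (1 - ee (w / (M n)%:R)) - - (2 * ipi R * w) =
   - ((M n)%:R * (cexp (2 * ipi R * (w / (M n)%:R)) - 1 - 2 * ipi R * (w / (M n)%:R))).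
  by rewrite /ee; field; exact: Mn.
rewrite normcN normcM normc_nat.
have h := cexp_taylor2 (2 * ipi R * (w / (M n)%:R)).
have nE : normc (2 * ipi R * (w / (M n)%:R)) = b / (M n)%:R.
  by rewrite mulrA normcM normcV normc_nat.
rewrite nE in h; apply: (le_trans (ler_wpM2l (ltW m0) h)).
have b0 : 0 <= b by exact: normc_ge0.
have -> : (M n)%:R * (3 * (b / (M n)%:R) ^+ 2 * expR (b / (M n)%:R)) =
   3 * b ^+ 2 * expR (b / (M n)%:R) / (M n)%:R by field; rewrite gt_eqF.
rewrite ler_pM2r ?invr_gt0 // ler_wpM2l ?mulr_ge0 ?sqr_ge0 // ler_expR.
by rewrite ler_pdivrMr // ler_peMr.
Qed.

(** Two lower bounds complement each other. As |e((t + m)/M)| = e^(-2 pi Im t/M) stays away from 1,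
    the quantity is at least a constant A; by the chord bound it is also at least 2|m| - B. *)
Let lower : exists2 c : R, 0 < c & forall n (m : int), inwin (M n) m ->
  c * (1 + `|m|%:R) <= normc ((M n)%:R * (1 - ee ((t + m%:~R) / (M n)%:R))).
Proof.
have v0 := t_im; set v := complex.Im t in v0 *.
pose d : R := 2 * pi * v.
have d0 : 0 < d by rewrite !mulr_gt0 ?pi_gt0.
pose A := d / (1 + d); have A0 : 0 < A by rewrite divr_gt0 // addr_gt0.
pose b := normc (2 * ipi R * t); have b0 : 0 <= b by exact: normc_ge0.
pose B := 4 * b * expR (2 * b); have B0 : 0 <= B by rewrite !mulr_ge0 ?expR_ge0.
(* The factor 1/2 serves |m| >= B + 1, where 2|m| - B >= 1 + |m|; the other entry serves |m| < B +
   1, where 1 + |m| <= 2 + B. *)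
pose c := Num.min (1 / 2) (A / (2 + B)).
have c0 : 0 < c.
  by rewrite lt_min divr_gt0 //= divr_gt0 // ltr_pwDl.
exists c => // n m wm.
have m0 : 0 < (M n)%:R :> R by rewrite ltr0n.
have m1 : 1 <= (M n)%:R :> R by rewrite ler1n.
rewrite normcM normc_nat; set X := normc (1 - _).
have LA : A <= (M n)%:R * X.
  have h1 : 1 - expR (- (d / (M n)%:R)) <= X.
    rewrite /X; have := normc_tri (ee ((t + m%:~R) / (M n)%:R)) 1 0.
    rewrite !subr0 normc1 normc_ee im_div -/v.
    have -> : 2 * pi * (v / (M n)%:R) = d / (M n)%:R by rewrite /d; ring.
    by move=> h; rewrite lerBlDr.
  apply: le_trans (ler_wpM2l (ltW m0) h1).
  set x := d / (M n)%:R.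
  have x0 : 0 < x by rewrite divr_gt0.
  have h2 : expR (- x) <= (1 + x)^-1.
    by rewrite expRN lef_pV2 ?posrE ?expR_gt0 ?addr_gt0 // expR_ge1Dx.
  have h3 : x / (1 + x) <= 1 - expR (- x).
    have -> : x / (1 + x) = 1 - (1 + x)^-1 by field; rewrite gt_eqF // addr_gt0.
    by rewrite lerD2l lerN2.
  apply: le_trans (ler_wpM2l (ltW m0) h3).
  have -> : (M n)%:R * (x / (1 + x)) = d / (1 + x).
    by rewrite /x; field; rewrite !gt_eqF // addr_gt0.
  rewrite /A ler_pM2l // lef_pV2 ?posrE ?addr_gt0 // lerD2l /x.
  by rewrite ler_pdivrMr // ler_peMr // ltW.
have LB : 2 * `|m|%:R - B <= (M n)%:R * X.
  have h1 := normc_1subee_ge R (M0 n) (inwin_abs wm).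
  set z := ee ((m%:~R / (M n)%:R : R)%:C) in h1.
  have zn : normc z = 1 by rewrite /z normc_ee_real.
  have zE : ee ((t + m%:~R) / (M n)%:R) = z * ee (t / (M n)%:R).
    rewrite /z -eeD; congr ee; rewrite realcM realcV -natrC -intrC.
    by field; exact: Mn.
  have h2 : normc (1 - z) <= X + normc (1 - ee (t / (M n)%:R)).
    have -> : 1 - z = (1 - ee ((t + m%:~R) / (M n)%:R)) - z * (1 - ee (t / (M n)%:R)).
      by rewrite zE; ring.
    by apply: (le_trans (normcB _ _)); rewrite normcM zn mul1r.
  have h3 : (M n)%:R * normc (1 - ee (t / (M n)%:R)) <= B.
    have := cexp_taylor1 (2 * ipi R * (t / (M n)%:R)).
    have -> : normc (2 * ipi R * (t / (M n)%:R)) = b / (M n)%:R.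
      by rewrite mulrA normcM normcV normc_nat.
    rewrite -/(ee _) normcBC => h3; apply: (le_trans (ler_wpM2l (ltW m0) h3)).
    have -> : (M n)%:R * (4 * (b / (M n)%:R) * expR (2 * (b / (M n)%:R))) =
      4 * b * expR (2 * (b / (M n)%:R)) by field; rewrite gt_eqF.
    rewrite /B ler_wpM2l ?mulr_ge0 // ler_expR ler_wpM2l //.
    by rewrite ler_pdivrMr // ler_peMr.
  have h4 : (M n)%:R * (2 * `|m|%:R / (M n)%:R) = 2 * `|m|%:R :> R.
    by field; rewrite gt_eqF.
  have h5 := le_trans h1 h2.
  have := ler_wpM2l (ltW m0) h5; rewrite h4 mulrDr => h6; lra.
have n0 : 0 <= `|m|%:R :> R by [].
have [hm|hm] := leP (B + 1) `|m|%:R.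
  apply: le_trans LB; have : c <= 1 / 2 by rewrite ge_min lexx.
  by move=> ch; nra.
apply: le_trans LA; have : c <= A / (2 + B) by rewrite ge_min lexx orbT.
rewrite ler_pdivlMr ?ltr_pwDl // => ch; apply: le_trans ch.
rewrite ler_pM2l //; lra.
Qed.

(** Raising the binomial order by one multiplies by (J + b + 1)/(M (b + 1)) with J/M = i + rho. Both
    the limit (i + rho)^a/a! and a bound uniform in n follow by induction on this factor. *)
Let y_rec b n i : ('C(n.+1 * (s + i * D) + b.+1, b.+1)%:R / (M n)%:R ^+ b.+1 : R) =
  'C(n.+1 * (s + i * D) + b, b)%:R / (M n)%:R ^+ b *
  ((i%:R + rhoR + b.+1%:R / (M n)%:R) / b.+1%:R).
Proof.
set J := (n.+1 * _)%N.
have h : (J + b.+1)%:R * 'C(J + b, b)%:R = b.+1%:R * 'C(J + b.+1, b.+1)%:R :> R.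
  by rewrite -!natrM; congr _%:R; have := mul_bin_diag (J + b.+1) b; rewrite addnS.
have m0 : (M n)%:R != 0 :> R by rewrite pnatr_eq0 -lt0n.
have b0 : b.+1%:R != 0 :> R by rewrite pnatr_eq0.
have d0 : D%:R != 0 :> R by rewrite pnatr_eq0 -lt0n.
have n0 : n.+1%:R != 0 :> R by rewrite pnatr_eq0.
have -> : i%:R + rhoR + b.+1%:R / (M n)%:R = (J + b.+1)%:R / (M n)%:R :> R.
  rewrite /J natrD /rhoR /M !natrM natrD natrM; field.
  by rewrite ?nat1r d0 n0.
apply: (mulfI b0); rewrite mulrA -h exprSr; field.
by rewrite nat1r b0 m0 expf_neq0.
Qed.

Let tends_y i : tends (fun n => (y n i)%:C) ((i%:R + rho) ^+ a / a`!%:R).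
Proof.
rewrite /y; elim: a => [|b IH].
  rewrite expr0 fact0 divr1; apply: eq_tends (tends_cst _) => n.
  by rewrite bin0 expr0 divr1.
have -> : (i%:R + rho) ^+ b.+1 / b.+1`!%:R =
   (i%:R + rho) ^+ b / b`!%:R * ((i%:R + rho) / b.+1%:R).
  rewrite factS natrM exprSr; field.
  by rewrite nat1r pnatr_eq0 /= pnatr_eq0 -lt0n fact_gt0.
apply: eq_tends (tendsM IH _) => [n|]; last first.
  instantiate (1 := fun n => ((i%:R + rhoR + b.+1%:R / (M n)%:R) / b.+1%:R)%:C).
  apply: (tends_M (C := 1)); exists 0%N => n _.
  have -> : (i%:R + rho) / b.+1%:R = ((i%:R + rhoR) / b.+1%:R)%:C.
    by rewrite realcM realcV realcD -!natrC rhoC.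
  rewrite -realcB normc_real.
  rewrite -mulrBl (addrC (i%:R + rhoR)) addrK mulrAC divff ?pnatr_eq0 // mul1r.
  by rewrite ger0_norm // invr_ge0.
by rewrite -rmorphM /= -y_rec.
Qed.

Let y_bound n i : normc (y n i)%:C <= (i%:R + a.+1%:R) ^+ a.
Proof.
rewrite normc_real_ge0 ?divr_ge0 ?exprn_ge0 // /y.
elim: a => [|b IH]; first by rewrite bin0 !expr0 divr1.
rewrite y_rec exprSr; apply: ler_pM.
- by rewrite divr_ge0 ?exprn_ge0.
- by rewrite !(divr_ge0, addr_ge0).
- apply: (le_trans IH); apply: lerXn2r; rewrite ?nnegrE -?natrD ?ler0n //.
  by rewrite ler_nat leq_add2l.
have r1 : rhoR <= 1 by rewrite ler_pdivrMr ?ltr0n // mul1r ler_nat ltnW.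
have b1 : b.+1%:R / (M n)%:R <= b.+1%:R :> R.
  by rewrite ler_pdivrMr ?ltr0n // ler_peMr // ler1n.
apply: (@le_trans _ _ (i%:R + rhoR + b.+1%:R / (M n)%:R)).
  rewrite ler_pdivrMr ?ltr0n // ler_peMr ?ler1n // !addr_ge0 // divr_ge0 //.
by rewrite -[b.+2%:R]natr1; lra.
Qed.

Let f (m : int) : R[i] := (t + m%:~R) ^- a.+1 * ee (- (rho * m%:~R)).
Let g (i : nat) : R[i] := (i%:R + rho) ^+ a / a`!%:R * ee ((i%:R + rho) * t).

(* Both sides are limits, along M -> oo, of the Fourier inversion formula on
   Z/M for the sequence of Taylor coefficients of (1 - x)^-(a+1). *)
Lemma lipschitz_formula : exists l,
  hsum f l /\ hsum (fun i => (- (2 * ipi R)) ^+ a.+1 * g i) l.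
Proof.
have [c c0 hc] := lower.
pose F n m : R[i] := if inwin (M n) m then
  ((M n)%:R * (1 - ee ((t + m%:~R) / (M n)%:R))) ^- a.+1 * ee (- (rho * m%:~R)) else 0.
pose G n i : R[i] := (y n i)%:C * ee ((i%:R + rho) * t).
pose l n := \sum_(i < M n) ((M n)%:R * (1 - ee ((t + (win i)%:~R) / (M n)%:R))) ^- a.+1
      * ee (- (rho * (win i)%:~R)).
have tm m : t + m%:~R != 0.
  apply/eqP => h; have := congr1 (@complex.Im R) h.
  by rewrite cImD intrC /= addr0 => h0; move: t_im; rewrite h0 ltxx.
have i2 : 2 * ipi R != 0.
  rewrite /ipi !mulf_eq0 pnatr_eq0 /= negb_or; apply/andP; split.
    by apply/eqP => -[] /eqP; rewrite gt_eqF // pi_gt0.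
  by apply/eqP => -[] /eqP; rewrite oner_eq0.
have rm (m : int) : rho * m%:~R = (rhoR * m%:~R)%:C by rewrite rhoC intrC -rmorphM.
pose b1 (m : int) : R := c ^- a.+1 * (1 + `|m|%:R) ^- 2.
have B1 : bsum b1 (c ^- a.+1 * (4 / 1)).
  by apply: bsumZ; [rewrite invr_ge0 exprn_ge0 // ltW|exact: bsum_int_inv_sqr].
have Fb n m : normc (F n m) <= b1 m.
  rewrite /F /b1; case: ifP => hm; last first.
    by rewrite normc0 mulr_ge0 // invr_ge0 exprn_ge0 // ?addr_ge0 // ltW.
  rewrite normcM rm -rmorphN normc_ee_real mulr1 normcV normcX -invfM.
  have p1 : 1 <= 1 + `|m|%:R :> R by rewrite lerDl.
  have p0 : 0 < 1 + `|m|%:R :> R by exact: lt_le_trans p1.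
  rewrite lef_pV2 ?posrE ?mulr_gt0 ?exprn_gt0 //; last first.
    by apply: lt_le_trans (hc _ _ hm); rewrite mulr_gt0.
  (* Since a > 0, the exponent a + 1 is at least 2, and two factors 1 + |m| already give a summable
     majorant. *)
  apply: (@le_trans _ _ ((c * (1 + `|m|%:R)) ^+ a.+1)); last first.
    by rewrite ler_pXn2r ?nnegrE ?mulr_ge0 ?normc_ge0 ?(ltW c0) ?(ltW p0) //; exact: hc.
  by rewrite exprMn ler_pM2l ?exprn_gt0 // ler_weXn2l.
have hF n : hsum (F n) (l n) by exact: hsum_win.
pose K := (- (2 * ipi R)) ^- a.+1.
have tF m : tends (F^~ m) (K * f m).
  have -> : K * f m = (- (2 * ipi R * (t + m%:~R))) ^- a.+1 * ee (- (rho * m%:~R)).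
    have -> : - (2 * ipi R * (t + m%:~R)) = - (2 * ipi R) * (t + m%:~R) by rewrite mulNr.
    by rewrite /K /f exprMn invfM mulrA.
  have h : tends (fun n => ((M n)%:R * (1 - ee ((t + m%:~R) / (M n)%:R))) ^- a.+1 *
      ee (- (rho * m%:~R)))
     ((- (2 * ipi R * (t + m%:~R))) ^- a.+1 * ee (- (rho * m%:~R))).
    apply: tendsM (tends_cst _); apply: tendsV; last exact: tendsX (tends_ee _).
    by rewrite expf_neq0 // oppr_eq0 mulf_neq0.
  (* A fixed m belongs to all windows from n = 2|m| on, after which the truncation in F is
     invisible. *)
  move=> e e0; have [n0 hn0] := h e e0; exists (maxn n0 (2 * `|m|)%N) => n.
  rewrite geq_max => /andP[k1 k2]; rewrite /F abs_inwin; first exact: hn0.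
  rewrite /M; apply: leq_ltn_trans k2 _; exact: (leq_trans (ltnSn n) (leq_pmull _ D0)).
pose v := complex.Im t; pose d := 2 * pi * v.
have d0 : 0 < d by rewrite !mulr_gt0 ?pi_gt0.
have A1 : 1 <= a.+1%:R :> R by rewrite ler1n.
have [K2 K20 HK2] := poly_exp_bound a d0 A1.
have r0 : 0 <= rhoR by rewrite divr_ge0.
have nee (i : nat) : normc (ee ((i%:R + rho) * t)) <= expR (- (d * i%:R)).
  rewrite normc_ee ler_expR lerN2 rhoC natrC -rmorphD cImM /= mul0r addr0 -/v.
  have -> : 2 * pi * ((i%:R + rhoR) * v) = d * i%:R + d * rhoR by rewrite /d; ring.
  by rewrite lerDl mulr_ge0 // ltW.
have B2 : bsum (fun i : nat => K2 / (1 + i%:R) ^+ 2) (K2 * (2 / 1)).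
  exact: bsumZ (ltW K20) (bsum_inv_sqr (lexx 1)).
have Gb n i : normc (G n i) <= K2 / (1 + i%:R) ^+ 2.
  rewrite /G normcM; apply: le_trans (HK2 _ (ler0n R i)).
  by apply: ler_pM; rewrite ?normc_ge0.
have tG i : tends (G^~ i) (g i) by apply: tendsM (tends_cst _); exact: tends_y.
have gb i : normc (g i) <= K2 / (1 + i%:R) ^+ 2 by apply: tends_norm_le (tG i) _ => n; exact: Gb.
have fb i : normc (K * f i) <= b1 i by apply: tends_norm_le (tF i) _ => n; exact: Fb.
have [l1 hl1] := hsum_ex (bsum_le fb B1).
have [l2 hl2] := hsum_ex (bsum_le gb B2).
have T1 := tannery B1 Fb hF tF hl1.
have T2 := tannery B2 Gb finite_identity tG hl2.
have e12 := tends_unique T1 T2.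
exists ((- (2 * ipi R)) ^+ a.+1 * l2); split; last exact: hsumZ.
rewrite -e12; apply: eq_hsum (hsumZ _ hl1) => m.
by rewrite /K mulrA mulfV ?mul1r // expf_neq0 // oppr_eq0.
Qed.

End Lipschitz.

(** * Gaussian sums and one-dimensional theta inversion *)

Section TotalSum.
Variable R : realType.

Definition tsum (I : choiceType) (f : I -> R[i]) : R[i] := xget 0 [set l | hsum f l].

Lemma tsumP (I : choiceType) (f : I -> R[i]) B :
  bsum (fun i => normc (f i)) B -> hsum f (tsum f).
Proof. by move=> /hsum_ex [l hl]; rewrite /tsum; apply: (xgetPex 0); exists l. Qed.

Lemma hsum_tsum (I : choiceType) (f : I -> R[i]) l : hsum f l -> tsum f = l.
Proof.
move=> hl; have h : hsum f (tsum f) by rewrite /tsum; apply: (xgetPex 0); exists l.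
exact: hsum_unique h hl.
Qed.

(** With the explicit rate C/(n+1), the limit of a real sequence is the supremum of its lower bounds
    v n - C/(n+1). *)
Lemma tends_cauchy (u : nat -> R[i]) C :
  (forall n m, normc (u n - u m) <= C / n.+1%:R + C / m.+1%:R) -> exists l, tends u l.
Proof.
move=> H.
have real (v : nat -> R) : (forall n m, `|v n - v m| <= C / n.+1%:R + C / m.+1%:R) ->
    exists l : R, forall n, `|v n - l| <= C / n.+1%:R.
  move=> hv; pose E := range (fun n => v n - C / n.+1%:R).
  have ubE n : ubound E (v n + C / n.+1%:R).
    move=> _ [m _ <-]; have := hv m n; rewrite ler_norml => /andP[_] /=.
    by move: (C / n.+1%:R) (C / m.+1%:R) => a b h; lra.
  have supE : has_sup E.
    by split; [exists (v 0%N - C / 1%:R); exists 0%N|exists (v 0%N + C / 1%:R); exact: ubE].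
  exists (sup E) => n.
  have h1 : v n - C / n.+1%:R <= sup E by apply: ub_le_sup; [exact: supE.2|exists n].
  have h2 : sup E <= v n + C / n.+1%:R by apply: ge_sup; [exact: supE.1|exact: ubE].
  by move: h1 h2; move: (C / n.+1%:R) => d h1 h2; rewrite ler_norml; apply/andP; split; lra.
have [a ha] : exists l : R, forall n, `|complex.Re (u n) - l| <= C / n.+1%:R.
  apply: real => n m; apply: le_trans (H n m).
  by have := Re_le_normc (u n - u m); rewrite cReD cReN.
have [b hb] : exists l : R, forall n, `|complex.Im (u n) - l| <= C / n.+1%:R.
  apply: real => n m; apply: le_trans (H n m).
  by have := Im_le_normc (u n - u m); rewrite cImD cImN.
exists (a +i* b); apply: (@tends_bound _ _ _ (C + C) id) => //; exists 0%N => n _.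
apply: (le_trans (normc_le_ReIm _)); rewrite cReD cImD cReN cImN /= mulrDl.
exact: lerD.
Qed.

End TotalSum.

Section Gaussian.
Variable R : realType.
Implicit Types (al z : R[i]) (t : R).

Definition gauss al z : R[i] := cexp (- (pi%:C * al * z ^+ 2)).

Lemma normc_gauss al t z B : normc z <= B ->
  normc (gauss al (t%:C + z)) <=
  expR (- (pi * complex.Re al * t ^+ 2) + 2 * pi * normc al * B * `|t|)
   * expR (pi * normc al * B ^+ 2).
Proof.
move=> zB; have B0 := le_trans (normc_ge0 z) zB.
rewrite /gauss normc_cexp -expRD ler_expR.
have -> : - (pi%:C * al * (t%:C + z) ^+ 2) =
   - (pi%:C * (t ^+ 2)%:C * al) - (pi%:C * ((2 * t)%:C * (al * z) + al * z ^+ 2)).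
  rewrite realcM realcX -natrC; ring.
have -> : complex.Re (- (pi%:C * (t ^+ 2)%:C * al) -
     (pi%:C * ((2 * t)%:C * (al * z) + al * z ^+ 2))) =
   - (pi * complex.Re al * t ^+ 2) -
   pi * (2 * t * complex.Re (al * z) + complex.Re (al * z ^+ 2)).
  rewrite cReD !cReN -realcM [complex.Re (_%:C * al)]cReM [complex.Re (pi%:C * _)]cReM cReD.
  rewrite [complex.Re ((2 * t)%:C * _)]cReM /=; ring.
have n0 := normc_ge0 al.
have h1 : `|complex.Re (al * z)| <= normc al * B.
  by apply: (le_trans (Re_le_normc _)); rewrite normcM ler_wpM2l.
have h2 : `|complex.Re (al * z ^+ 2)| <= normc al * B ^+ 2.
  apply: (le_trans (Re_le_normc _)); rewrite normcM normcX ler_wpM2l //.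
  by rewrite ler_pXn2r ?nnegrE ?normc_ge0.
have p0 := pi_gt0 R.
have h3 : `|2 * t * complex.Re (al * z)| <= 2 * `|t| * (normc al * B).
  by rewrite normrM normrM ger0_norm // ler_wpM2l // mulr_ge0.
have h4 : - (2 * `|t| * (normc al * B) + normc al * B ^+ 2) <=
    2 * t * complex.Re (al * z) + complex.Re (al * z ^+ 2).
  rewrite opprD; apply: lerD; first by move: h3; rewrite ler_norml => /andP[].
  by move: h2; rewrite ler_norml => /andP[].
have := ler_wpM2l (ltW p0) h4; nra.
Qed.

Lemma gauss_decay al B : 0 < complex.Re al -> exists2 K, 0 < K &
  forall t z, normc z <= B -> normc (gauss al (t%:C + z)) <= K / (1 + t ^+ 2).
Proof.
move=> a0; have A0 : 0 < pi * complex.Re al by rewrite mulr_gt0 ?pi_gt0.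
have [K K0 HK] := gauss_bound1 (2 * pi * normc al * B) A0.
exists (K * expR (pi * normc al * B ^+ 2)); first by rewrite mulr_gt0 ?expR_gt0.
move=> t z zB; apply: (le_trans (normc_gauss al t zB)).
by rewrite [leRHS]mulrAC ler_wpM2r ?expR_ge0.
Qed.

(** Translating by h multiplies the Gaussian by [cexp w], with w affine in t of size O(|h|). The
    exponential remainder then grows at most like e^(c1 |t|), which the Gaussian absorbs. *)
Lemma gauss_taylor al B : 0 < complex.Re al -> 0 <= B -> exists2 K, 0 < K &
  forall t z h, normc z <= B -> normc h <= 1 ->
  normc (gauss al (t%:C + z + h) - gauss al (t%:C + z)
    + h * (2 * pi%:C * al * (t%:C + z) * gauss al (t%:C + z))) <= K * normc h ^+ 2 / (1 + t ^+ 2).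
Proof.
move=> a0 B0; have p0 := pi_gt0 R.
have A0 : 0 < pi * complex.Re al by rewrite mulr_gt0.
have n0 : 0 <= pi * normc al by rewrite mulr_ge0 ?normc_ge0 // ltW.
pose c1 := pi * normc al * (2 * B + 3).
have c10 : 0 <= c1 by rewrite mulr_ge0 // addr_ge0 // mulr_ge0.
have [K K0 HK] := gauss_bound (2 * pi * normc al * B + c1) A0.
pose C' := expR (pi * normc al * B ^+ 2 + c1) * (6 * c1 ^+ 2 + pi * normc al + 1).
have C'0 : 0 < C'.
  by rewrite mulr_gt0 ?expR_gt0 // ltr_wpDl // addr_ge0 // mulr_ge0 ?sqr_ge0.
exists (K * C'); first exact: mulr_gt0.
move=> t z h zB h1; set u := t%:C + z.
pose w := - (pi%:C * al * (2 * u * h + h ^+ 2)).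
have -> : gauss al (u + h) - gauss al u + h * (2 * pi%:C * al * u * gauss al u) =
    gauss al u * ((cexp w - 1 - w) - pi%:C * al * h ^+ 2).
  have -> : gauss al (u + h) = gauss al u * cexp w.
    by rewrite /gauss -cexpD; congr cexp; rewrite /w; ring.
  by rewrite /w; ring.
have h0 := normc_ge0 h; set r := normc h in h0 h1 *.
have nu : normc u <= `|t| + B.
  by apply: (le_trans (normcD _ _)); rewrite normc_real lerD2l.
have t1 : 0 <= `|t| by [].
have nw : normc w <= c1 * (`|t| + 1) * r.
  rewrite /w normcN normcM normcM normc_real gtr0_norm // /c1.
  have : normc (2 * u * h + h ^+ 2) <= (2 * (`|t| + B) + 1) * r.
    apply: (le_trans (normcD _ _)); rewrite normcX 2!normcM normc_nat -/r expr2.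
    rewrite [leRHS]mulrDl mul1r; apply: lerD; last by rewrite ler_piMr.
    by rewrite ler_wpM2r // ler_wpM2l.
  move=> hh; apply: (le_trans (ler_wpM2l n0 hh)).
  rewrite -[leRHS]mulrA -[leRHS]mulrA ler_wpM2l // [leRHS]mulrA ler_wpM2r //; nra.
have nw1 : normc w <= c1 * (`|t| + 1).
  apply: (le_trans nw); rewrite ler_piMr // mulr_ge0 // addr_ge0 //.
rewrite normcM.
have hG := normc_gauss al t zB; rewrite -/u in hG.
have hT : normc (cexp w - 1 - w - pi%:C * al * h ^+ 2) <=
   r ^+ 2 * ((6 * c1 ^+ 2 + pi * normc al + 1) * (1 + t ^+ 2) * expR (c1 * `|t| + c1)).
  have e1 : 1 <= expR (c1 * `|t| + c1) by rewrite -[leLHS]expR0 ler_expR addr_ge0 // mulr_ge0.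
  apply: (le_trans (normcB _ _)).
  have T := cexp_taylor2 w.
  have nw0 := normc_ge0 w.
  have T1 : normc w ^+ 2 <= (c1 * (`|t| + 1) * r) ^+ 2.
    by rewrite ler_pXn2r ?nnegrE //; pos.
  have T2 : expR (normc w) <= expR (c1 * `|t| + c1).
    by rewrite ler_expR; apply: (le_trans nw1); rewrite mulrDr mulr1.
  have T3 : (`|t| + 1) ^+ 2 <= 2 * (1 + t ^+ 2).
    rewrite -[t ^+ 2]real_normK ?num_real //; have := sqr_ge0 (`|t| - 1); nra.
  have T4 : 3 * normc w ^+ 2 * expR (normc w) <=
      r ^+ 2 * (6 * c1 ^+ 2 * (1 + t ^+ 2) * expR (c1 * `|t| + c1)).
    apply: (@le_trans _ _ (3 * (c1 * (`|t| + 1) * r) ^+ 2 * expR (c1 * `|t| + c1))).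
      by apply: ler_pM; rewrite ?expR_ge0 ?mulr_ge0 ?sqr_ge0 // ler_wpM2l.
    set e := expR (c1 * `|t| + c1) in e1 *; have e0 : 0 <= e := expR_ge0 _.
    have -> : 3 * (c1 * (`|t| + 1) * r) ^+ 2 * e = r ^+ 2 * 3 * c1 ^+ 2 * e * (`|t| + 1) ^+ 2 by ring.
    have -> : r ^+ 2 * (6 * c1 ^+ 2 * (1 + t ^+ 2) * e) =
      r ^+ 2 * 3 * c1 ^+ 2 * e * (2 * (1 + t ^+ 2)) by ring.
    by apply: ler_wpM2l => //; pos.
  have T5 : normc (pi%:C * al * h ^+ 2) <=
      r ^+ 2 * ((pi * normc al + 1) * (1 + t ^+ 2) * expR (c1 * `|t| + c1)).
    rewrite normcM normcX normcM normc_real gtr0_norm // -/r mulrC ler_wpM2l ?sqr_ge0 //.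
    have s0 := sqr_ge0 t; have g0 := expR_gt0 (c1 * `|t| + c1).
    apply: (@le_trans _ _ ((pi * normc al + 1) * 1 * 1)); first by rewrite !mulr1 lerDl.
    apply: ler_pM => //; rewrite ?mulr1 ?addr_ge0 // ler_peMr ?addr_ge0 // lerDl //.
  apply: (le_trans (lerD (le_trans T T4) T5)); rewrite -mulrDr -mulrDl -mulrDl.
  by rewrite addrA.
apply: (le_trans (ler_pM (normc_ge0 _) (normc_ge0 _) hG hT)).
have q0 : 0 < 1 + t ^+ 2 by rewrite ltr_wpDr ?sqr_ge0.
have HKt : expR (- (pi * complex.Re al * t ^+ 2) + (2 * pi * normc al * B + c1) * `|t|) * (1 + t ^+ 2)
   <= K / (1 + t ^+ 2).
  by rewrite ler_pdivlMr //; have := HK t; congr (_ <= _); ring.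
have E : expR (- (pi * complex.Re al * t ^+ 2) + 2 * pi * normc al * B * `|t|) *
    expR (pi * normc al * B ^+ 2) * (r ^+ 2 * ((6 * c1 ^+ 2 + pi * normc al + 1) * (1 + t ^+ 2)
    * expR (c1 * `|t| + c1))) =
   r ^+ 2 * C' * (expR (- (pi * complex.Re al * t ^+ 2) + (2 * pi * normc al * B + c1) * `|t|)
     * (1 + t ^+ 2)).
  have f1 : expR (- (pi * complex.Re al * t ^+ 2) + (2 * pi * normc al * B + c1) * `|t|) =
      expR (- (pi * complex.Re al * t ^+ 2) + 2 * pi * normc al * B * `|t|) * expR (c1 * `|t|).
    by rewrite -expRD; congr expR; ring.
  by rewrite /C' f1 (expRD (pi * normc al * B ^+ 2)) (expRD (c1 * `|t|)); ring.
rewrite E; apply: (le_trans (ler_wpM2l _ HKt)).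
  by rewrite mulr_ge0 ?sqr_ge0 // ltW.
by rewrite [leLHS](_ : _ = K * C' * r ^+ 2 / (1 + t ^+ 2)) //; ring.
Qed.

Lemma bsum_gauss al M z : 0 < complex.Re al -> (0 < M)%N ->
  exists B, bsum (fun x : int => normc (gauss al ((x%:~R / M%:R : R)%:C + z))) B.
Proof.
move=> a0 M0; have [K K0 HK] := gauss_decay (normc z) a0.
have M1 : 1 <= M%:R :> R by rewrite ler1n.
exists (K * (8 * M%:R)); apply: bsum_le (bsumZ (ltW K0) (bsum_cauchy M1)) => x.
exact: HK.
Qed.

(** The Riemann sum with mesh 1/M of exp(-pi al (x + z)^2) over the real line. *)
Definition rsum al M z : R[i] :=
  M%:R^-1 * tsum (fun x : int => gauss al ((x%:~R / M%:R : R)%:C + z)).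

Lemma rsumP al M z : 0 < complex.Re al -> (0 < M)%N ->
  hsum (fun x : int => gauss al ((x%:~R / M%:R : R)%:C + z)) (M%:R * rsum al M z).
Proof.
move=> a0 M0; have [B hB] := bsum_gauss z a0 M0.
by rewrite mulVKf ?pnatr_eq0 -?lt0n //; exact: tsumP hB.
Qed.

Lemma rsum_bounded al B : 0 < complex.Re al ->
  exists2 K, 0 < K & forall M z, (0 < M)%N -> normc z <= B -> normc (rsum al M z) <= K.
Proof.
move=> a0; have [K K0 HK] := gauss_decay B a0.
exists (K * 8) => [|M z M0 zB]; first by rewrite mulr_gt0.
have M1 : 1 <= M%:R :> R by rewrite ler1n.
have Mp : 0 < M%:R :> R by rewrite ltr0n.
have := @hsum_norm_le _ _ _ _ (K * (8 * M%:R)) (rsumP z a0 M0).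
rewrite normcM normc_nat => h; rewrite -(ler_pM2l Mp).
rewrite [leRHS](_ : _ = K * (8 * M%:R)); last by ring.
by apply: h; apply: bsum_le (bsumZ (ltW K0) (bsum_cauchy M1)) => x; exact: HK.
Qed.

Lemma succ_bij : bijective (fun x : int => x + 1).
Proof. by exists (fun x => x - 1) => x; rewrite ?addrK ?subrK. Qed.

Lemma gauss_step al M z (x : int) : (0 < M)%N ->
  gauss al (((x + 1)%:~R / M%:R : R)%:C + z) =
  gauss al ((x%:~R / M%:R : R)%:C + z + (M%:R^-1 : R)%:C).
Proof.
move=> M0; congr gauss; rewrite intrD mulrDl realcD mul1r; ring.
Qed.

Lemma rsum_step al M z : 0 < complex.Re al -> (0 < M)%N ->
  hsum (fun x : int => gauss al ((x%:~R / M%:R : R)%:C + z + (M%:R^-1 : R)%:C)) (M%:R * rsum al M z).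
Proof.
move=> a0 M0; have /(hsum_bij _ _ succ_bij) := rsumP z a0 M0.
by apply: eq_hsum => x; rewrite gauss_step.
Qed.

(* Comparing the increment h with the increment 1/M, whose contribution telescopes. *)
Lemma rsum_diff al B : 0 < complex.Re al -> 0 <= B -> exists2 K, 0 < K &
  forall M z h, (0 < M)%N -> normc z <= B -> normc h <= 1 ->
  normc (rsum al M (z + h) - rsum al M z) <= K * (normc h ^+ 2 + normc h / M%:R).
Proof.
move=> a0 B0; have [K K0 HK] := gauss_taylor a0 B0.
exists (8 * K) => [|M z h M0 zB h1]; first by rewrite mulr_gt0.
have M1 : 1 <= M%:R :> R by rewrite ler1n.
have Mp : 0 < M%:R :> R by rewrite ltr0n.
have Mn : M%:R != 0 :> R[i] by rewrite pnatr_eq0 -lt0n.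
have h0 := normc_ge0 h.
have Mi : normc (M%:R^-1 : R)%:C = M%:R^-1 by rewrite normc_real_ge0 // invr_ge0 ltW.
have Mi1 : normc (M%:R^-1 : R)%:C <= 1 by rewrite Mi invf_le1.
have H : hsum (fun x : int =>
     (gauss al ((x%:~R / M%:R : R)%:C + (z + h)) - gauss al ((x%:~R / M%:R : R)%:C + z))
     - h * M%:R * (gauss al ((x%:~R / M%:R : R)%:C + z + (M%:R^-1 : R)%:C) -
                    gauss al ((x%:~R / M%:R : R)%:C + z)))
   (M%:R * (rsum al M (z + h) - rsum al M z)).
  have := hsumB (hsumB (rsumP (z + h) a0 M0) (rsumP z a0 M0))
     (hsumZ (h * M%:R) (hsumB (rsum_step z a0 M0) (rsumP z a0 M0))).
  by rewrite subrr mulr0 subr0 -mulrBr.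
have := @hsum_norm_le _ _ _ _ (K * (normc h ^+ 2 + normc h / M%:R) * (8 * M%:R)) H.
rewrite normcM normc_nat => hh; rewrite -(ler_pM2l Mp).
rewrite [leRHS](_ : _ = K * (normc h ^+ 2 + normc h / M%:R) * (8 * M%:R)); last by ring.
have c0 : 0 <= K * (normc h ^+ 2 + normc h / M%:R).
  by rewrite mulr_ge0 ?addr_ge0 ?sqr_ge0 ?divr_ge0 // ltW.
apply: hh; apply: bsum_le (bsumZ c0 (bsum_cauchy M1)) => x.
set t : R := x%:~R / M%:R; set u := gauss al (t%:C + z).
have T1 := HK t z h zB h1; have T2 := HK t z _ zB Mi1.
rewrite -/u in T1 T2; set v := 2 * pi%:C * al * (t%:C + z) * u in T1 T2.
have -> : gauss al (t%:C + (z + h)) - u - h * M%:R * (gauss al (t%:C + z + (M%:R^-1 : R)%:C) - u)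
  = (gauss al (t%:C + z + h) - u + h * v) -
    h * M%:R * (gauss al (t%:C + z + (M%:R^-1 : R)%:C) - u + (M%:R^-1 : R)%:C * v).
  have -> : (M%:R^-1 : R)%:C = M%:R^-1 :> R[i] by rewrite realcV -natrC.
  by rewrite addrA; field.
apply: (le_trans (normcB _ _)).
rewrite normcM [normc (h * _)]normcM normc_nat.
have hM : 0 <= normc h * M%:R by rewrite mulr_ge0 // ltW.
apply: (le_trans (lerD T1 (ler_wpM2l hM T2))); rewrite Mi.
have q : 1 + t ^+ 2 != 0 by rewrite gt_eqF // ltr_wpDr ?sqr_ge0.
by rewrite [leLHS](_ : _ = K * (normc h ^+ 2 + normc h / M%:R) * (1 + t ^+ 2)^-1) //;
  field; rewrite q gt_eqF.
Qed.

(** Stands in for moving the contour: the segment from 0 to z is cut into M steps of length |z|/M,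
    each changing the Riemann sum by O(1/M^2). *)
Lemma rsum_shift al z : 0 < complex.Re al ->
  tends (fun n => rsum al n.+1 z - rsum al n.+1 0) 0.
Proof.
move=> a0; have z0 := normc_ge0 z; have [K K0 HK] := rsum_diff a0 z0.
apply: (@tends_bound _ _ _ (K * (normc z ^+ 2 + normc z)) id) => //.
exists (Num.bound (normc z)) => n nn; rewrite subr0; set M := n.+1.
have Mp : 0 < M%:R :> R by rewrite ltr0n.
have zM : normc z <= M%:R.
  apply: (le_trans (ltW (archi_boundP z0))); rewrite ler_nat; exact: leqW.
pose w (j : nat) := (j%:R / M%:R : R)%:C * z.
have E : rsum al M z - rsum al M 0 = \sum_(0 <= j < M) (rsum al M (w j.+1) - rsum al M (w j)).
  rewrite telescope_sumr // /w mul0r mul0r divff ?gt_eqF // mul1r //.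
have wn j : normc (w j) = j%:R / M%:R * normc z.
  by rewrite /w normcM normc_real_ge0 // divr_ge0.
rewrite E; apply: (le_trans (normc_sum _ _ _)).
apply: (@le_trans _ _ (\sum_(0 <= j < M) K * (normc z ^+ 2 + normc z) / M%:R ^+ 2)).
  rewrite big_nat_cond [leRHS]big_nat_cond; apply: ler_sum => j /andP[/andP[_ jM] _].
  have ws : w j.+1 = w j + (M%:R^-1 : R)%:C * z.
    by rewrite /w -mulrDl -realcD -natr1 mulrDl mul1r.
  have hn : normc ((M%:R^-1 : R)%:C * z) = normc z / M%:R.
    by rewrite normcM normc_real_ge0 ?invr_ge0 ?(ltW Mp) // mulrC.
  have wj : normc (w j) <= normc z.
    by rewrite wn ler_piMl // ler_pdivrMr // mul1r ler_nat ltnW.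
  have zM1 : normc ((M%:R^-1 : R)%:C * z) <= 1 by rewrite hn ler_pdivrMr // mul1r.
  have := HK M (w j) _ (ltn0Sn n) wj zM1; rewrite -ws hn => /le_trans; apply.
  by rewrite le_eqVlt; apply/orP; left; apply/eqP; field; rewrite gt_eqF.
rewrite sumr_const_nat subn0 -mulr_natr le_eqVlt; apply/orP; left; apply/eqP.
by rewrite -/M; field; rewrite gt_eqF.
Qed.

Lemma divmod_bij K : (0 < K)%N ->
  bijective (fun p : 'I_K * int => p.2 * K%:Z + (p.1 : nat)%:Z).
Proof.
move=> K0.
have lt (x : int) : (`|(x %% K%:Z)%Z|%N < K)%N by lia.
exists (fun x => (Ordinal (lt x), (x %/ K%:Z)%Z)) => [[j x]|x] /=; last first.
  by have := divz_eq x K%:Z; lia.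
have jK := ltn_ord j.
congr pair; first by apply: ord_inj => /=; rewrite modzMDl modz_small; lia.
by rewrite divzMDl; [rewrite divz_small ?addr0 //; lia|lia].
Qed.

(** The sum with mesh 1/(MK) is the average of K sums with mesh 1/M, shifted by less than 1/M. *)
Lemma rsum_refine al : 0 < complex.Re al -> exists2 C, 0 < C & forall M K,
  (0 < M)%N -> (0 < K)%N -> normc (rsum al (M * K) 0 - rsum al M 0) <= C / M%:R.
Proof.
move=> a0; have [C C0 HC] := rsum_diff a0 ler01.
exists (C * 2) => [|M K M0 K0]; first by rewrite mulr_gt0.
have Mp : 0 < M%:R :> R by rewrite ltr0n.
have M1 : 1 <= M%:R :> R by rewrite ler1n.
have Kp : 0 < K%:R :> R by rewrite ltr0n.
pose w (j : 'I_K) := ((j : nat)%:R / (M * K)%:R : R)%:C.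
have MK0 : (0 < M * K)%N by rewrite muln_gt0 M0.
have h1 : (M * K)%:R * rsum al (M * K) 0 = \sum_(j < K) M%:R * rsum al M (w j).
  have /(hsum_bij _ _ (divmod_bij K0)) h := rsumP 0 a0 MK0.
  apply: (hsum_unique h); apply: hsum_fin_rows => j /=.
  apply: eq_hsum (rsumP (w j) a0 M0) => x; congr gauss; rewrite addr0 /w -realcD.
  congr (_%:C); rewrite intrD intrM -!pmulrn natrM; field.
  by rewrite !gt_eqF.
have hj (j : 'I_K) : normc (rsum al M (w j) - rsum al M 0) <= C * 2 / M%:R.
  have jK : (j : nat)%:R < K%:R :> R by rewrite ltr_nat.
  have nw : normc (w j) <= M%:R^-1.
    rewrite /w normc_real_ge0 ?divr_ge0 // natrM invfM mulrCA.
    by rewrite ler_piMr ?invr_ge0 ?(ltW Mp) // ler_pdivrMr // mul1r ltW.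
  have nw1 : normc (w j) <= 1 by apply: (le_trans nw); rewrite invf_le1.
  have := HC M 0 (w j) M0; rewrite add0r normc0 => /(_ ler01 nw1) h; apply: (le_trans h).
  rewrite -[_ * 2 / _]mulrA ler_pM2l // mulr_natl mulr2n.
  have w0 := normc_ge0 (w j).
  apply: lerD; first by rewrite expr2; apply: (le_trans (ler_wpM2l w0 nw1)); rewrite mulr1.
  by rewrite ler_pdivrMr //; apply: (le_trans nw); rewrite ler_peMr // invr_ge0 ltW.
have -> : rsum al (M * K) 0 - rsum al M 0 = K%:R^-1 * \sum_(j < K) (rsum al M (w j) - rsum al M 0).
  have Kn : K%:R != 0 :> R[i] by rewrite pnatr_eq0 -lt0n.
  have Mn : M%:R != 0 :> R[i] by rewrite pnatr_eq0 -lt0n.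
  rewrite sumrB sumr_const card_ord -(mulr_natl (rsum al M 0)) mulrBr mulKf //; congr (_ - _).
  rewrite -mulr_sumr natrM in h1.
  by apply: (mulfI (mulf_neq0 Mn Kn)); rewrite h1; field.
rewrite normcM normcV normc_nat mulrC ler_pdivrMr //.
apply: (le_trans (normc_sum _ _ _)); apply: (@le_trans _ _ (\sum_(j < K) C * 2 / M%:R)).
  exact: ler_sum.
by rewrite sumr_const card_ord -[leLHS]mulr_natr.
Qed.

(** This is the integral of exp(-pi al x^2); existence of the limit comes from comparing two meshes
    with their common refinement. *)
Definition gconst al : R[i] := xget 0 [set c | tends (fun n => rsum al n.+1 0) c].

Lemma gconstP al : 0 < complex.Re al -> tends (fun n => rsum al n.+1 0) (gconst al).
Proof.
move=> a0; rewrite /gconst; apply: (xgetPex 0).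
have [C C0 HC] := rsum_refine a0; apply: (@tends_cauchy _ _ C) => n m.
apply: (le_trans (normc_tri (rsum al (n.+1 * m.+1) 0) _ _)).
rewrite normcBC; apply: lerD; first exact: HC.
by rewrite mulnC; exact: HC.
Qed.

Lemma tends_rsum al z : 0 < complex.Re al -> tends (fun n => rsum al n.+1 z) (gconst al).
Proof.
move=> a0; rewrite -[gconst al]add0r.
apply: eq_tends (tendsD (rsum_shift z a0) (gconstP a0)) => n.
by rewrite subrK.
Qed.

End Gaussian.

Section ThetaInversion1.
Variable R : realType.
Implicit Types (al z : R[i]).

Lemma Re_inv_gt0 al : 0 < complex.Re al -> 0 < complex.Re al^-1.
Proof.
case: al => a b /= a0; rewrite divr_gt0 // ltr_wpDr ?sqr_ge0 // exprn_gt0 //.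
Qed.

Lemma Re_gt0_neq0 al : 0 < complex.Re al -> al != 0.
Proof. by apply: contraTneq => ->; rewrite /= ltxx. Qed.

(** Completing the square: a character times a Gaussian is a Gaussian with complex shift, up to the
    factors that will form the dual series. *)
Lemma gauss_char al z (t : R) (m : int) : al != 0 ->
  gauss al (t%:C - z) * ee (m%:~R * t%:C) =
  gauss al^-1 m%:~R * ee (m%:~R * z) * gauss al (t%:C + (- z - 'i * m%:~R / al)).
Proof.
move=> a0; rewrite /gauss /ee -!cexpD; congr cexp.
have i2 : 'i * 'i = -1 :> R[i] by rewrite -expr2 sqr_i.
rewrite /ipi; set I := 'i in i2 *; set p := pi%:C; set mm := m%:~R.
have -> : - (p * al * (t%:C + (- z - I * mm / al)) ^+ 2) =
   - (p * al * (t%:C - z) ^+ 2) + 2 * p * I * mm * (t%:C - z) - (I * I) * (p * mm ^+ 2 / al).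
  by field.
rewrite i2; ring.
Qed.

Variables (al z : R[i]).
Hypothesis a0 : 0 < complex.Re al.
Let an : al != 0. Proof. exact: Re_gt0_neq0. Qed.

Let F n (m : int) : R[i] := gauss al^-1 m%:~R * ee (m%:~R * z) *
  rsum al n.+1 (- z - 'i * m%:~R / al).

Let hsumF n m : hsum (fun y : int => gauss al ((y%:~R / n.+1%:R : R)%:C - z) *
    ee (m%:~R * (y%:~R / n.+1%:R : R)%:C)) (n.+1%:R * F n m).
Proof.
rewrite /F mulrCA.
apply: eq_hsum (hsumZ _ (rsumP (- z - 'i * m%:~R / al) a0 (ltn0Sn n))) => y.
by rewrite gauss_char.
Qed.

(** Summation by parts twice. With w = e(m/M), the factor (1 - w)^2/w = w + 1/w - 2 turns the
    Gaussian into its second difference with step 1/M, where the linear Taylor terms cancel and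
    O(1/M^2) remains. *)
Let second_difference : exists2 K, 0 < K & forall n m,
  normc (F n m) * normc (1 - ee ((m%:~R / n.+1%:R : R)%:C)) ^+ 2 <= K / n.+1%:R ^+ 2.
Proof.
have [K K0 HK] := gauss_taylor a0 (normc_ge0 (- z)).
exists (16 * K) => [|n m]; first by rewrite mulr_gt0.
set M := n.+1; have Mp : 0 < M%:R :> R by rewrite ltr0n.
have M1 : 1 <= M%:R :> R by rewrite ler1n.
pose d : R[i] := (M%:R^-1 : R)%:C; pose w := ee ((m%:~R / M%:R : R)%:C).
have wn : normc w = 1 by rewrite normc_ee_real.
have w0 : w != 0 by exact: ee_neq0.
pose t (y : int) : R := y%:~R / M%:R.
pose E (y : int) := ee (m%:~R * (t y)%:C).
have tS y : (t (y + 1))%:C = (t y)%:C + d.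
  by rewrite /t /d intrD mulrDl realcD mul1r.
have tP y : (t (y - 1))%:C = (t y)%:C - d.
  by rewrite /t /d intrB mulrBl realcB mul1r.
have wE : w = ee (m%:~R * d).
  by rewrite /w /d realcM -intrC.
have ES y : E (y + 1) = E y * w by rewrite /E tS mulrDr eeD wE.
have EP y : E (y - 1) = E y / w by rewrite /E tP mulrBr eeD eeN wE.
have H0 := hsumF n m; rewrite -/M in H0.
have Hp : hsum (fun y => gauss al ((t y)%:C + - z + d) * E y) (M%:R * F n m / w).
  have /(hsum_bij _ _ succ_bij) h := H0.
  rewrite mulrC; apply: eq_hsum (hsumZ w^-1 h) => y.
  have := ES y; rewrite /E /t => ->; have := tS y; rewrite /t => ->.
  by rewrite -[X in gauss al X]addrAC; field.
have Hm : hsum (fun y => gauss al ((t y)%:C + - z - d) * E y) (M%:R * F n m * w).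
  have bij : bijective (fun x : int => x - 1).
    by exists (fun x => x + 1) => x; rewrite ?addrK ?subrK.
  have /(hsum_bij _ _ bij) h := H0.
  rewrite mulrC; apply: eq_hsum (hsumZ w h) => y.
  have := EP y; rewrite /E /t => ->; have := tP y; rewrite /t => ->.
  by rewrite -[X in gauss al X]addrAC; field.
have H := hsumB (hsumD Hp Hm) (hsumZ 2 H0).
have Hb := @hsum_norm_le _ _ _ _ (2 * K / M%:R ^+ 2 * (8 * M%:R)) H.
have e1 : M%:R * F n m / w + M%:R * F n m * w - 2 * (M%:R * F n m) =
   - (M%:R * F n m * ((1 - w) * (1 - w) / w)) * -1 by field.
rewrite e1 mulrN1 opprK in Hb.
have nb : normc (M%:R * F n m * ((1 - w) * (1 - w) / w)) =
    M%:R * (normc (F n m) * normc (1 - w) ^+ 2).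
  rewrite [normc (_ * (_ / w))]normcM [normc (M%:R * _)]normcM [normc (_ / w)]normcM.
  by rewrite [normc ((1 - w) * _)]normcM normcV wn invr1 mulr1 normc_nat; ring.
rewrite nb in Hb; rewrite -(ler_pM2l Mp).
rewrite [leRHS](_ : _ = 2 * K / M%:R ^+ 2 * (8 * M%:R)); last by field; rewrite gt_eqF.
have c0 : 0 <= 2 * K / M%:R ^+ 2 by rewrite !mulr_ge0 ?invr_ge0 ?exprn_ge0 // ltW.
apply: Hb; apply: bsum_le (bsumZ c0 (bsum_cauchy M1)) => y.
have dn : normc d = M%:R^-1 by rewrite normc_real_ge0 // invr_ge0 ltW.
have d1 : normc d <= 1 by rewrite dn invf_le1.
have d2 : normc (- d) <= 1 by rewrite normcN.
have T1 := HK (t y) (- z) d (lexx _) d1; have T2 := HK (t y) (- z) (- d) (lexx _) d2.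
set u := gauss al ((t y)%:C + - z) in T1 T2.
have En : normc (E y) = 1.
  by rewrite /E intrC -realcM normc_ee_real.
rewrite -/(t y) -/(E y) -/u.
have -> : gauss al ((t y)%:C + - z + d) * E y + gauss al ((t y)%:C + - z - d) * E y - 2 * (u * E y)
   = E y * ((gauss al ((t y)%:C + - z + d) - u + d * (2 * pi%:C * al * ((t y)%:C + - z) * u)) +
    (gauss al ((t y)%:C + - z - d) - u + - d * (2 * pi%:C * al * ((t y)%:C + - z) * u))) by ring.
rewrite normcM En mul1r; apply: (le_trans (normcD _ _)); apply: (le_trans (lerD T1 T2)).
have q : 1 + t y ^+ 2 != 0 by rewrite gt_eqF // ltr_wpDr ?sqr_ge0.
rewrite normcN dn -/(t y) le_eqVlt; apply/orP; left; apply/eqP; field.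
by rewrite q gt_eqF.
Qed.

(** For each n the terms F n m, summed over a window, already give the left side exactly. As n
    grows, F n m tends to the dual term because [rsum] tends to [gconst], and [second_difference]
    with the chord bound dominates. *)
Lemma theta_inversion1 : exists s,
  hsum (fun x : int => gauss al (x%:~R - z)) s /\
  hsum (fun m : int => gconst al * (gauss al^-1 m%:~R * ee (m%:~R * z))) s.
Proof.
have [hz Hz] : exists s, hsum (fun x : int => gauss al (x%:~R - z)) s.
  exists (1%:R * rsum al 1 (- z)); apply: eq_hsum (rsumP (- z) a0 (ltn0Sn 0)) => x.
  by rewrite divr1 -intrC.
exists hz; split => //.
have [K K0 HK] := second_difference.
have [K' K'0 HK'] := rsum_bounded (normc (- z)) a0.
pose C := 16 * K + K'.
pose G n m := if inwin n.+1 m then F n m else 0.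
pose b (m : int) : R := C * (1 + `|m|%:R) ^- 2.
have C0 : 0 < C by rewrite addr_gt0 // mulr_gt0.
have B : bsum b (C * (4 / 1)) by apply: bsumZ (ltW C0) (bsum_int_inv_sqr (lexx 1)).
have Gb n m : normc (G n m) <= b m.
  have q0 : 0 < 1 + `|m|%:R :> R by rewrite ltr_wpDr.
  rewrite /G /b; case: ifP => wm; last by rewrite normc0 mulr_ge0 ?(ltW C0) // invr_ge0 exprn_ge0 // ltW.
  (* At m = 0 the factor |1 - w| vanishes and the second difference says nothing; the uniform bound
     on Riemann sums is used instead. *)
  have [m0|m0] := eqVneq m 0.
    rewrite m0 absz0 addr0 expr1n invr1 mulr1 /F mulr0z mul0r ee0 mulr1 mulr0 mul0r subr0.
    rewrite /gauss expr0n mulr0 oppr0 cexp0 mul1r.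
    by apply: le_trans (HK' _ _ _ (lexx _)) _ => //; rewrite lerDr mulr_ge0 // ltW.
  have Mp : 0 < n.+1%:R :> R by rewrite ltr0n.
  have h1 := normc_1subee_ge R (ltn0Sn n) (inwin_abs wm).
  have mm : 1 <= `|m|%:R :> R by rewrite ler1n absz_gt0.
  set X := `|m|%:R in h1 mm q0 *; have F0 := normc_ge0 (F n m).
  have h2 : normc (F n m) * (2 * X / n.+1%:R) ^+ 2 <= K / n.+1%:R ^+ 2.
    apply: le_trans (HK n m); rewrite ler_wpM2l // ler_pXn2r ?nnegrE ?normc_ge0 //.
    by rewrite divr_ge0 // mulr_ge0 // (le_trans _ mm).
  have h3 : normc (F n m) * (4 * X ^+ 2) <= K.
    move: h2; rewrite ler_pdivlMr ?exprn_gt0 //; congr (_ <= _).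
    by move: Mp; move: (n.+1%:R) => M Mp; field; rewrite gt_eqF.
  rewrite ler_pdivlMr ?exprn_gt0 //.
  apply: (@le_trans _ _ (normc (F n m) * (4 * X ^+ 2))).
    rewrite ler_wpM2l //; nra.
  by apply: (le_trans h3); rewrite /C; lra.
(* Summing the characters over the window keeps exactly the points y/(n+1) that are integers, hence
   the same total for every n. *)
have hG n : hsum (G n) hz.
  rewrite (_ : hz = \sum_(i < n.+1) F n (win i)); first exact: hsum_win.
  have Mn : n.+1%:R != 0 :> R[i] by rewrite pnatr_eq0.
  apply: (mulfI Mn); rewrite mulr_sumr.
  have h1 := hsum_sum (index_enum 'I_n.+1) (fun i => hsumF n (win i)).
  apply: hsum_unique _ h1.
  have h2 : hsum (fun x : int => n.+1%:R * gauss al (x%:~R - z)) (n.+1%:R * hz) by exact: hsumZ.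
  pose f (y : int) := gauss al ((y%:~R / n.+1%:R : R)%:C - z) *
     (if (n.+1%:Z %| y)%Z then n.+1%:R else 0).
  have h3 : hsum f (n.+1%:R * hz).
    apply/(@hsum_reindex _ _ _ (fun x : int => x * n.+1%:Z)).
    - by move=> x y /(mulIf _) ->.
    - move=> y hy; rewrite /f; case: ifP; last by rewrite mulr0.
      by move=> /dvdzP [x xy]; case: (hy x).
    - apply: eq_hsum h2 => x; rewrite /f dvdz_mull // mulrC; congr (gauss al (_ - z) * _).
      by rewrite intrM -pmulrn mulfK ?pnatr_eq0 // -intrC.
  apply: eq_hsum h3 => y; rewrite /f -sum_win_ee // mulr_sumr; apply: eq_bigr => i _.
  by congr (_ * ee _); rewrite realcM realcV -intrC -natrC mulrA.
have tG m : tends (G^~ m) (gconst al * (gauss al^-1 m%:~R * ee (m%:~R * z))).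
  have h : tends (F^~ m) (gconst al * (gauss al^-1 m%:~R * ee (m%:~R * z))).
    rewrite mulrC; apply: tendsM (tends_cst _) _; exact: tends_rsum.
  move=> e e0; have [n0 hn0] := h e e0; exists (maxn n0 (2 * `|m|)%N) => n.
  rewrite geq_max => /andP[k1 k2]; rewrite /G abs_inwin ?ltnS //; exact: hn0.
have gb m : normc (gconst al * (gauss al^-1 m%:~R * ee (m%:~R * z))) <= b m.
  by apply: tends_norm_le (tG m) _ => n; exact: Gb.
have [l hl] := hsum_ex (bsum_le gb B).
have T := tannery B Gb hG tG hl.
by rewrite (tends_unique (tends_cst hz) T).
Qed.

End ThetaInversion1.

(** * Evaluation of the Gaussian constant *)

Section GaussConstant.
Variable R : realType.
Implicit Types (al : R[i]).

(** At al = 1 and z = 0 the inversion formula reads s = gconst 1 * s, and s is nonzero since its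
    term at 0 is 1 and all terms are positive. *)
Lemma gconst1 : gconst (1 : R[i]) = 1.
Proof.
have r1 : 0 < complex.Re (1 : R[i]) by exact: ltr01.
have [s [h1 h2]] := theta_inversion1 0 r1.
have h3 : hsum (fun m : int => gconst 1 * gauss 1 m%:~R) s.
  by apply: eq_hsum h2 => m; rewrite invr1 mulr0 ee0 mulr1.
have h4 : hsum (fun x : int => gauss 1 x%:~R) s by apply: eq_hsum h1 => x; rewrite subr0.
have e := hsum_unique h3 (hsumZ (gconst 1) h4).
have h5 : hsum (fun x : int => (expR (- (pi * x%:~R ^+ 2)) : R)%:C) s.
  apply: eq_hsum h4 => x; rewrite /gauss mulr1 intrC -realcX -realcM -realcN cexp_real //.
have s1 : 1 <= complex.Re s.
  have := hsum_real_ge (fun x : int => expR_ge0 _) h5 (s := [:: 0%Z]) isT.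
  by rewrite big_seq1 expr0n mulr0 oppr0 expR0.
have s0 : s != 0 by apply: contraTneq s1 => ->; rewrite -ltNge ltr01.
by apply: (mulIf s0); rewrite mul1r -e.
Qed.

(** With mesh 1/(rM) for r^2 al, the sampled values are those of al with mesh 1/M. *)
Lemma gconst_scale al r : 0 < complex.Re al -> (0 < r)%N ->
  gconst ((r%:R) ^+ 2 * al) = (r%:R)^-1 * gconst al.
Proof.
move=> a0 r0; have rn : (r%:R : R[i]) != 0 by rewrite pnatr_eq0 -lt0n.
have a1 : 0 < complex.Re (r%:R ^+ 2 * al).
  by rewrite natrC -realcX cReM /= mul0r subr0 mulr_gt0 // exprn_gt0 // ltr0n.
have t1 := tends_sub (v := fun n => (r * n.+1).-1) _ (gconstP a1).
have t2 := tendsM (tends_cst (r%:R)^-1) (gconstP a0).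
apply: tends_unique (t1 _) _ => [n|]; first by rewrite -ltnS prednK ?muln_gt0 ?r0 // leq_pmull.
apply: eq_tends t2 => n; rewrite prednK ?muln_gt0 ?r0 // /rsum natrM invfM -mulrA.
congr (_ * (_ * _)); congr tsum; apply: funext => x; rewrite /gauss !addr0; congr cexp.
have nn : n.+1%:R != 0 :> R by rewrite pnatr_eq0.
have rr : r%:R != 0 :> R by rewrite pnatr_eq0 -lt0n.
have -> : x%:~R / n.+1%:R = r%:R * (x%:~R / (r * n.+1)%:R) :> R.
  by rewrite natrM; move: nn; move: (n.+1%:R) => M nn; field; rewrite rr nn.
rewrite realcM -natrC; ring.
Qed.

Lemma gauss_param_decay (a : R) : 0 < a -> exists2 K, 0 < K & forall al (t : R),
  a <= complex.Re al -> normc (gauss al t%:C) <= K / (1 + t ^+ 2).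
Proof.
move=> a0; have A0 : 0 < pi * a by rewrite mulr_gt0 ?pi_gt0.
have [K K0 HK] := gauss_bound1 0 A0; exists K => // al t ha.
apply: le_trans (HK t); rewrite mul0r addr0 /gauss normc_cexp ler_expR.
rewrite cReN -realcX mulrAC -realcM cReM /= mul0r subr0 lerN2 mulrAC.
by rewrite ler_wpM2l // mulr_ge0 ?sqr_ge0 ?pi_ge0.
Qed.

Lemma gconst_bounded (a : R) : 0 < a -> exists2 K, 0 < K & forall al,
  a <= complex.Re al -> normc (gconst al) <= K.
Proof.
move=> a0; have [K K0 HK] := gauss_param_decay a0.
exists (K * 8) => [|al ha]; first by rewrite mulr_gt0.
have al0 := lt_le_trans a0 ha.
apply: tends_norm_le (gconstP al0) _ => n.
have M1 : 1 <= n.+1%:R :> R by rewrite ler1n.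
have Mp : 0 < n.+1%:R :> R by rewrite ltr0n.
have := @hsum_norm_le _ _ _ _ (K * (8 * n.+1%:R)) (rsumP 0 al0 (ltn0Sn n)).
rewrite normcM normc_nat => h; rewrite -(ler_pM2l Mp).
rewrite [leRHS](_ : _ = K * (8 * n.+1%:R)); last by ring.
by apply: h; apply: bsum_le (bsumZ (ltW K0) (bsum_cauchy M1)) => x; rewrite addr0; exact: HK.
Qed.

Lemma gauss_param_taylor (a : R) : 0 < a -> exists2 K, 0 < K & forall al h (t : R),
  a <= complex.Re al -> normc h <= a / 2 ->
  normc (gauss (al + h) t%:C - gauss al t%:C + h * (pi%:C * (t ^+ 2)%:C * gauss al t%:C))
   <= K * normc h ^+ 2 / (1 + t ^+ 2).
Proof.
move=> a0; have p0 := pi_gt0 R; have A0 : 0 < pi * (a / 4) by rewrite mulr_gt0 // divr_gt0.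
have [K K0 HK] := gauss_bound 0 A0.
exists (3 * pi ^+ 2 * K ^+ 2) => [|al h t ha hh].
  by rewrite !mulr_gt0 // exprn_gt0.
pose w := - (pi%:C * (t ^+ 2)%:C * h).
have -> : gauss (al + h) t%:C - gauss al t%:C + h * (pi%:C * (t ^+ 2)%:C * gauss al t%:C) =
   gauss al t%:C * (cexp w - 1 - w).
  have -> : gauss (al + h) t%:C = gauss al t%:C * cexp w.
    by rewrite /gauss -cexpD; congr cexp; rewrite /w realcX; ring.
  by rewrite /w; ring.
have h0 := normc_ge0 h; have t0 := sqr_ge0 t.
have wn : normc w = pi * t ^+ 2 * normc h.
  by rewrite /w normcN normcM -realcM normc_real_ge0 // mulr_ge0 // ltW.
have gn : normc (gauss al t%:C) <= expR (- (pi * a * t ^+ 2)).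
  rewrite /gauss normc_cexp ler_expR cReN -realcX mulrAC -realcM cReM /= mul0r subr0 lerN2.
  by rewrite [leLHS]mulrAC ler_wpM2l // mulr_ge0 // ltW.
have T := cexp_taylor2 w; rewrite wn in T.
have T1 : normc (cexp w - 1 - w) <= 3 * (pi * t ^+ 2 * normc h) ^+ 2 * expR (pi * t ^+ 2 * (a / 2)).
  apply: (le_trans T); apply: ler_wpM2l; first by pos.
  by rewrite ler_expR; apply: ler_wpM2l => //; pos.
rewrite normcM.
apply: (le_trans (ler_pM (normc_ge0 _) (normc_ge0 _) gn T1)).
have q1 : 1 <= 1 + t ^+ 2 by rewrite lerDl.
have q0 : 0 < 1 + t ^+ 2 by exact: lt_le_trans q1.
have HKt := HK t; rewrite mul0r addr0 in HKt.
set e := expR (- (pi * (a / 4) * t ^+ 2)) in HKt.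
have e0 : 0 <= e by exact: expR_ge0.
have E : expR (- (pi * a * t ^+ 2)) * (3 * (pi * t ^+ 2 * normc h) ^+ 2 * expR (pi * t ^+ 2 * (a / 2)))
   = 3 * pi ^+ 2 * normc h ^+ 2 * ((t ^+ 2) ^+ 2 * e ^+ 2).
  have -> : e ^+ 2 = expR (- (pi * a * t ^+ 2)) * expR (pi * t ^+ 2 * (a / 2)).
    by rewrite expr2 /e -!expRD; congr expR; field.
  by ring.
rewrite E ler_pdivlMr //.
have -> : 3 * pi ^+ 2 * K ^+ 2 * normc h ^+ 2 = 3 * pi ^+ 2 * normc h ^+ 2 * K ^+ 2 by ring.
rewrite -[leLHS]mulrA; apply: ler_wpM2l; first by pos.
apply: (@le_trans _ _ (((1 + t ^+ 2) ^+ 2 * e) ^+ 2)); last first.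
  by rewrite ler_pXn2r ?nnegrE //; pos.
rewrite [in leRHS]exprMn [leLHS]mulrAC ler_wpM2r ?sqr_ge0 //.
have -> : ((1 + t ^+ 2) ^+ 2) ^+ 2 = (1 + t ^+ 2) ^+ 2 * (1 + t ^+ 2) * (1 + t ^+ 2) by ring.
rewrite -[leLHS]mulr1; apply: ler_pM => //; first by rewrite mulr_ge0 ?sqr_ge0 // ltW.
by rewrite ler_wpM2r ?(ltW q0) // ler_pXn2r ?nnegrE ?(ltW q0) // lerDr.
Qed.

(** The derivative of [gconst] is not yet known, so it is eliminated: cross-multiplying two
    increments cancels the linear terms and leaves a third-order error. *)
Lemma gconst_taylor_sym (a : R) : 0 < a -> exists2 K, 0 < K & forall al h k,
  a <= complex.Re al -> normc h <= a / 2 -> normc k <= a / 2 ->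
  normc ((gconst (al + h) - gconst al) * k - (gconst (al + k) - gconst al) * h)
   <= K * (normc h * normc k * (normc h + normc k)).
Proof.
move=> a0; have [K K0 HK] := gauss_param_taylor a0.
exists (8 * K) => [|al h k ha hh hk]; first by rewrite mulr_gt0.
have al0 := lt_le_trans a0 ha.
have pos (x : R[i]) : normc x <= a / 2 -> 0 < complex.Re (al + x).
  move=> xx; rewrite cReD; have := le_trans (Re_le_normc x) xx.
  by rewrite ler_norml => /andP[+ _]; lra.
have th := gconstP (pos _ hh); have tk := gconstP (pos _ hk); have ta := gconstP al0.
have T := tendsD (tendsM (tendsD th (tendsN ta)) (tends_cst k))
   (tendsN (tendsM (tendsD tk (tendsN ta)) (tends_cst h))).
apply: tends_norm_le T _ => n.
have M1 : 1 <= n.+1%:R :> R by rewrite ler1n.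
have Mp : 0 < n.+1%:R :> R by rewrite ltr0n.
have H := hsumB (hsumZ k (hsumB (rsumP 0 (pos _ hh) (ltn0Sn n)) (rsumP 0 al0 (ltn0Sn n))))
   (hsumZ h (hsumB (rsumP 0 (pos _ hk) (ltn0Sn n)) (rsumP 0 al0 (ltn0Sn n)))).
have := @hsum_norm_le _ _ _ _ (K * (normc h * normc k * (normc h + normc k)) * (8 * n.+1%:R)) H.
set X := normc (_ - _) => hX; rewrite -(ler_pM2l Mp).
have -> : n.+1%:R * normc ((rsum (al + h) n.+1 0 - rsum al n.+1 0) * k -
    (rsum (al + k) n.+1 0 - rsum al n.+1 0) * h) = X.
  by rewrite -normc_nat -normcM /X; congr normc; ring.
rewrite [leRHS](_ : _ = K * (normc h * normc k * (normc h + normc k)) * (8 * n.+1%:R)); last by ring.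
have h0 := normc_ge0 h; have k0 := normc_ge0 k.
have c0 : 0 <= K * (normc h * normc k * (normc h + normc k)).
  by rewrite !mulr_ge0 ?addr_ge0 // ltW.
apply: hX; apply: bsum_le (bsumZ c0 (bsum_cauchy M1)) => x.
set t : R := x%:~R / n.+1%:R; rewrite !addr0.
have T1 := HK al h t ha hh; have T2 := HK al k t ha hk.
set u := gauss al t%:C in T1 T2 *; set v := pi%:C * (t ^+ 2)%:C * u in T1 T2.
have -> : k * (gauss (al + h) t%:C - u) - h * (gauss (al + k) t%:C - u) =
  k * (gauss (al + h) t%:C - u + h * v) - h * (gauss (al + k) t%:C - u + k * v) by ring.
apply: (le_trans (normcB _ _)); rewrite 2!normcM.
apply: (le_trans (lerD (ler_wpM2l k0 T1) (ler_wpM2l h0 T2))).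
rewrite le_eqVlt; apply/orP; left; apply/eqP; field.
by rewrite gt_eqF // ltr_wpDr ?sqr_ge0.
Qed.

(* The derivative is read off along the radial increments al * ((1 + 1/n)^2 - 1),
   where the constant is known by scaling. *)
Lemma gconst_taylor (a : R) : 0 < a -> exists2 K, 0 < K & forall al h,
  a <= complex.Re al -> normc h <= a / 2 ->
  normc (gconst (al + h) - gconst al + gconst al * h / (2 * al)) <= K * normc h ^+ 2.
Proof.
move=> a0; have [K K0 HK] := gconst_taylor_sym a0.
exists (4 * K) => [|al h ha hh]; first by rewrite mulr_gt0.
have al0 := lt_le_trans a0 ha; have aln := Re_gt0_neq0 al0.
pose k n : R[i] := al * (2 * n.+1%:R + 1) / n.+1%:R ^+ 2.
pose q n : R[i] := n.+2%:R * k n.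
have nn n : n.+1%:R != 0 :> R[i] by rewrite pnatr_eq0.
have nn2 n : n.+2%:R != 0 :> R[i] by rewrite pnatr_eq0.
(* By the choice of k n, al + k n is al times the square of (n+2)/(n+1), and [gconst_scale] applies
   to numerator and denominator. *)
have sc n : gconst (al + k n) = gconst al * n.+1%:R / n.+2%:R.
  have E : n.+1%:R ^+ 2 * (al + k n) = n.+2%:R ^+ 2 * al.
    by rewrite /k -[n.+2%:R]natr1; field; rewrite nat1r.
  have pk : 0 < complex.Re (al + k n).
    have -> : al + k n = ((n.+2%:R / n.+1%:R) ^+ 2 : R)%:C * al.
      rewrite realcX realcM realcV -!natrC; apply: (mulfI (expf_neq0 2 (nn n))).
      by rewrite E; field; rewrite nat1r.
    by rewrite cReM /= mul0r subr0 mulr_gt0 // exprn_gt0 // divr_gt0 // ltr0n.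
  have := gconst_scale pk (ltn0Sn n); rewrite E gconst_scale // => h1.
  by rewrite -[LHS](mulVKf (nn n)) -h1; ring.
have ti := @tends_inv_nat R.
have tk : tends k 0.
  have -> : 0 = al * (2 * 0 + 0 * 0) :> R[i] by ring.
  apply: eq_tends (tendsM (tends_cst al) (tendsD (tendsM (tends_cst 2) ti) (tendsM ti ti))) => n.
  by rewrite /k; field; rewrite nat1r nn.
have tq : tends q (2 * al).
  have -> : 2 * al = (1 + 0) * (al * (2 + 0)) :> R[i] by ring.
  apply: eq_tends (tendsM (tendsD (tends_cst 1) ti) (tendsM (tends_cst al) (tendsD (tends_cst 2) ti))) => n.
  by rewrite /q /k -[n.+2%:R]natr1; field; rewrite nat1r nn.
have h0 := normc_ge0 h.
(* The increment along k n is -gconst al/(n+2). Multiplied by n + 2, the symmetric estimate passes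
   to the limit, with q n tending to 2 al and k n to 0. *)
have bnd : normc ((gconst (al + h) - gconst al) * (2 * al) + gconst al * h) <=
   K * (normc h * normc (2 * al) * normc h).
  apply: ler_addeps => e e0.
  have T := tendsD (tendsM (tends_cst (gconst (al + h) - gconst al)) tq) (tends_cst (gconst al * h)).
  have Tr := tendsM (tendsM (tends_cst (K%:C * h)) tq) (tendsD (tends_cst (normc h)%:C) (tends_cst 0)).
  have e3 : 0 < e / 3 by rewrite divr_gt0.
  have [n1 h1] := T _ e3.
  have Tq := tendsM (tends_cst (K * normc h * normc h)%:C) tq.
  have Tqk := tendsM (tendsM (tends_cst (K * normc h)%:C) tq) tk.
  have [n2 h2] := Tq _ e3; have [n3 h3] := Tqk _ e3.
  have a2 : 0 < a / 2 by rewrite divr_gt0.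
  have [n4 h4] := tk _ a2.
  pose n := maxn (maxn n1 n2) (maxn n3 n4).
  have {}h1 := h1 n _; have {}h2 := h2 n _; have {}h3 := h3 n _; have {}h4 := h4 n _.
  have l1 : (n1 <= n)%N by rewrite /n !leq_max leqnn.
  have l2 : (n2 <= n)%N by rewrite /n !leq_max leqnn !orbT.
  have l3 : (n3 <= n)%N by rewrite /n !leq_max leqnn !orbT.
  have l4 : (n4 <= n)%N by rewrite /n !leq_max leqnn !orbT.
  move: (h1 l1) (h2 l2) (h3 l3) (h4 l4) => {}h1 {}h2 {}h3 {}h4.
  rewrite subr0 in h4; rewrite mulr0 subr0 in h3.
  have B := HK al h (k n) ha hh h4; rewrite sc in B.
  have eB : normc ((gconst (al + h) - gconst al) * q n + gconst al * h) =
     n.+2%:R * normc ((gconst (al + h) - gconst al) * k n -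
        (gconst al * n.+1%:R / n.+2%:R - gconst al) * h).
    rewrite -[n.+2%:R]normc_nat -normcM /q; congr normc.
    have -> : n.+1%:R = n.+2%:R - 1 :> R[i] by rewrite -[n.+2%:R]natr1 addrK.
    by move: (nn2 n); move: (n.+2%:R) => N2 hN2; field.
  have qn : normc (q n) = n.+2%:R * normc (k n) by rewrite /q normcM normc_nat.
  have B2 : normc ((gconst (al + h) - gconst al) * q n + gconst al * h) <=
     K * normc h * normc h * normc (q n) + K * normc h * normc (q n) * normc (k n).
    rewrite eB qn; apply: (le_trans (ler_wpM2l (ler0n R _) B)).
    by rewrite le_eqVlt; apply/orP; left; apply/eqP; ring.
  have c1 : 0 <= K * normc h * normc h by rewrite !mulr_ge0 // ltW.
  have c2 : 0 <= K * normc h by rewrite mulr_ge0 // ltW.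
  have {}h3 : K * normc h * normc (q n) * normc (k n) <= e / 3.
    by move: h3; rewrite 2!normcM normc_real_ge0.
  have {}h2 : K * normc h * normc h * normc (q n) <= K * normc h * normc h * normc (2 * al) + e / 3.
    have := normc_tri ((K * normc h * normc h)%:C * (2 * al)) ((K * normc h * normc h)%:C * q n) 0.
    rewrite !subr0 normcM normc_real_ge0 // [normc (_ * (2 * al))]normcM normc_real_ge0 //.
    by move=> hh2; lra.
  have h5 := normc_tri ((gconst (al + h) - gconst al) * q n + gconst al * h)
     ((gconst (al + h) - gconst al) * (2 * al) + gconst al * h) 0.
  rewrite !subr0 normcBC in h5.
  have -> : K * (normc h * normc (2 * al) * normc h) = K * normc h * normc h * normc (2 * al) by ring.
  lra.
have -> : gconst (al + h) - gconst al + gconst al * h / (2 * al) =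
   ((gconst (al + h) - gconst al) * (2 * al) + gconst al * h) / (2 * al) by field.
have n0 : 0 < normc (2 * al) by rewrite normc_gt0 mulf_neq0 // pnatr_eq0.
rewrite normcM normcV ler_pdivrMr //; apply: (le_trans bnd).
have -> : K * (normc h * normc (2 * al) * normc h) = K * normc h ^+ 2 * normc (2 * al) by ring.
by rewrite ler_pM2r // ler_wpM2r ?sqr_ge0 // ler_peMl ?(ltW K0) // ler1n.
Qed.

(** The product H(s) of [gconst] at e^(s w) with e^(s w/2) is constant on [0, 1]: over n + 1 equal
    steps each increment is O(1/n^2). The condition on Im w keeps the real part of the path above
    the fixed a > 0. *)
Lemma gconst_exp (w : R[i]) : `|complex.Im w| < pi / 2 -> gconst (cexp w) = cexp (- (w / 2)).
Proof.
case: w => x y /= yb; set w := x +i* y.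
have p0 := pi_gt0 R.
have cy : 0 < cos y by apply: cos_gt0_pihalf; rewrite -ltr_norml.
pose a := expR (- `|x|) * cos y; have a0 : 0 < a by rewrite mulr_gt0 ?expR_gt0.
pose g (s : R) := cexp (s%:C * w).
have ga s : 0 <= s <= 1 -> a <= complex.Re (g s).
  move=> /andP[s0 s1]; rewrite /g /cexp cReM /= !mul0r !subr0 addr0.
  apply: ler_pM; rewrite ?expR_ge0 ?(ltW cy) //.
    rewrite ler_expR; have : `|s * x| <= `|x| by rewrite normrM ger0_norm // ler_piMl.
    by rewrite ler_norml => /andP[].
  rewrite -[cos y]cos_norm -[cos (s * y)]cos_norm.
  have le : `|s * y| <= `|y| by rewrite normrM (ger0_norm s0) ler_piMl.
  rewrite le_eqVlt; case: (ltgtP `|s * y| `|y|) le => // [lt _|-> _]; last by rewrite eqxx.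
  by rewrite ltr_cos ?lt ?orbT // in_itv /= normr_ge0 /=; lra.
have gn s : 0 <= s <= 1 -> normc (g s) <= expR `|x|.
  move=> /andP[s0 s1]; rewrite /g normc_cexp ler_expR cReM /= mul0r subr0.
  by apply: (le_trans (ler_norm _)); rewrite normrM (ger0_norm s0) ler_piMl.
have [K K0 HK] := gconst_taylor a0; have [C C0 HC] := gconst_bounded a0.
pose H (s : R) := gconst (g s) * cexp (s%:C * w / 2).
pose r := normc w; have r0 : 0 <= r by exact: normc_ge0.
pose L := 4 * expR (2 * r) * r; have L0 : 0 <= L by rewrite !mulr_ge0 ?expR_ge0.
pose D := expR r * (K * (expR `|x| * L) ^+ 2 + C * (L ^+ 2 * (expR r + 2))).
have D0 : 0 <= D.
  by pos.
suff key n : (expR `|x| * L / n.+1%:R <= a / 2) -> forall j, (j <= n)%N ->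
    normc (H (j.+1%:R / n.+1%:R) - H (j%:R / n.+1%:R)) <= D * expR r / n.+1%:R ^+ 2.
  have H01 : H 1 = H 0.
    apply/eqP; rewrite -subr_eq0; apply/eqP/normc_small0 => e e0.
    pose B := (expR `|x| * L) / (a / 2) + D * expR r / e.
    have a2 : 0 < a / 2 by rewrite divr_gt0.
    have q1 : 0 <= expR `|x| * L / (a / 2) by pos.
    have q2 : 0 <= D * expR r / e by pos.
    have B0 : 0 <= B by rewrite addr_ge0.
    pose n := Num.bound B.
    have Bn : B <= n.+1%:R.
      by apply: (le_trans (ltW (archi_boundP B0))); rewrite ler_nat.
    have np : 0 < n.+1%:R :> R by rewrite ltr0n.
    have c1 : expR `|x| * L / n.+1%:R <= a / 2.
      rewrite ler_pdivrMr // [leRHS]mulrC -ler_pdivrMr //; apply: le_trans Bn.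
      by rewrite lerDl.
    have -> : H 1 - H 0 = \sum_(0 <= j < n.+1) (H (j.+1%:R / n.+1%:R) - H (j%:R / n.+1%:R)).
      by rewrite (telescope_sumr (fun j => H (j%:R / n.+1%:R))) // divff ?gt_eqF // mul0r.
    apply: (le_trans (normc_sum _ _ _)).
    apply: (@le_trans _ _ (\sum_(0 <= j < n.+1) D * expR r / n.+1%:R ^+ 2)).
      rewrite big_nat_cond [leRHS]big_nat_cond; apply: ler_sum => j /andP[/andP[_ jn] _].
      exact: key.
    rewrite sumr_const_nat subn0 -[leLHS]mulr_natr.
    have -> : D * expR r / n.+1%:R ^+ 2 * n.+1%:R = D * expR r / n.+1%:R.
      by field; rewrite nat1r gt_eqF.
    rewrite ler_pdivrMr // [leRHS]mulrC -ler_pdivrMr //; apply: le_trans Bn.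
    by rewrite lerDr.
  have z0 : (0 : R)%:C = 0 :> R[i] by []. have z1 : (1 : R)%:C = 1 :> R[i] by [].
  move: H01; rewrite /H /g z0 z1 !mul0r mul1r cexp0 gconst1 mulr1 => e.
  by rewrite cexpN -[LHS](mulfK (cexp_neq0 (w / 2))) e mul1r.
move=> hn j jn; set N := n.+1%:R in hn *.
have np : 0 < N by rewrite ltr0n.
have N1 : 1 <= N by rewrite ler1n.
set s := j%:R / N; have s01 : 0 <= s <= 1.
  by rewrite divr_ge0 ?(ltW np) //= ler_pdivrMr // mul1r ler_nat leqW.
have sE : j.+1%:R / N = s + N^-1 by rewrite -natr1 mulrDl mul1r.
pose d := (N^-1)%:C * w.
have dn : normc d = r / N by rewrite normcM normc_real_ge0 ?invr_ge0 ?(ltW np) // mulrC.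
have dr : normc d <= r by rewrite dn ler_pdivrMr // ler_peMr.
pose h := g s * (cexp d - 1).
have e1 : normc (cexp d - 1) <= L / N.
  apply: (le_trans (cexp_taylor1 d)); have -> : L / N = 4 * (r / N) * expR (2 * r) by rewrite /L; ring.
  apply: ler_pM; [by pos|by pos|by rewrite dn|by rewrite ler_expR ler_pM2l].
have hb : normc h <= expR `|x| * L / N.
  rewrite normcM -mulrA; apply: ler_pM; rewrite ?normc_ge0 //; exact: gn.
have gS : g (s + N^-1) = g s + h.
  by rewrite /g realcD mulrDl cexpD -/d /h /g; ring.
pose p := cexp (d / 2).
have pE : cexp d = p * p by rewrite /p -cexpD; congr cexp; field.
have p1 : normc (p - 1) <= L / N.
  have d2 : normc (d / 2) <= normc d.
    by rewrite normcM normcV normc_nat ler_piMr ?normc_ge0 // invf_le1 // ler1n.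
  apply: (le_trans (cexp_taylor1 (d / 2))).
  have -> : L / N = 4 * (r / N) * expR (2 * r) by rewrite /L; ring.
  apply: ler_pM; [by pos|by pos|by rewrite ler_pM2l // -dn|].
  by rewrite ler_expR ler_pM2l //; exact: le_trans d2 dr.
have pn : normc p <= expR r.
  rewrite /p normc_cexp ler_expR; apply: (le_trans (ler_norm _)); apply: (le_trans (Re_le_normc _)).
  rewrite normcM normcV normc_nat; apply: le_trans dr.
  by rewrite ler_piMr ?normc_ge0 // invf_le1 // ler1n.
set c0 := gconst (g s).
have hh := HK (g s) h (ga s s01) (le_trans hb hn); rewrite -/c0 -gS in hh.
have gsn : g s != 0 by exact: cexp_neq0.
pose rem := gconst (g (s + N^-1)) - c0 + c0 * h / (2 * g s).
(* With p = e^(d/2), the first-order part of [gconst] gives p (1 - (p^2 - 1)/2) - 1 = -(p - 1)^2 (p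
   + 2)/2, which is already of second order. *)
have E : H (s + N^-1) - H s = cexp (s%:C * w / 2) *
   (rem * p - c0 * ((p - 1) * (p - 1) * (p + 2) / 2)).
  have -> : H (s + N^-1) = (rem + c0 - c0 * h / (2 * g s)) * (cexp (s%:C * w / 2) * p).
    rewrite /H /rem realcD -cexpD; congr (_ * cexp _); first by ring.
    by rewrite /d; field.
  by rewrite /H -/c0 /h pE; field.
rewrite sE E normcM mulrC.
have sw : normc (cexp (s%:C * w / 2)) <= expR r.
  rewrite normc_cexp ler_expR; apply: (le_trans (ler_norm _)); apply: (le_trans (Re_le_normc _)).
  move: s01 => /andP[s0 s1].
  rewrite normcM normcV normc_nat normcM normc_real_ge0 //.
  apply: (@le_trans _ _ (s * r)).
    by rewrite ler_pdivrMr // ler_peMr ?ler1n //; pos.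
  by rewrite ler_piMl.
rewrite [leRHS]mulrAC; apply: ler_pM; rewrite ?normc_ge0 //.
apply: (le_trans (normcB _ _)).
have b1 : normc (rem * p) <= K * (expR `|x| * L / N) ^+ 2 * expR r.
  rewrite normcM; apply: ler_pM; rewrite ?normc_ge0 //; apply: (le_trans hh).
  by rewrite ler_pM2l // ler_pXn2r ?nnegrE ?normc_ge0 //; pos.
have b2 : normc (c0 * ((p - 1) * (p - 1) * (p + 2) / 2)) <= C * ((L / N) ^+ 2 * (expR r + 2)).
  rewrite normcM; apply: ler_pM; rewrite ?normc_ge0 //; first exact: HC (ga s s01).
  rewrite normcM normcV normc_nat; apply: (@le_trans _ _ (normc ((p - 1) * (p - 1) * (p + 2)))).
    by rewrite ler_piMr ?normc_ge0 // invf_le1 // ler1n.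
  rewrite 2!normcM; apply: ler_pM; rewrite ?normc_ge0 ?mulr_ge0 ?normc_ge0 //.
    by rewrite expr2; apply: ler_pM; rewrite ?normc_ge0.
  by apply: (le_trans (normcD _ _)); rewrite normc_nat lerD2r.
apply: (le_trans (lerD b1 b2)).
have e1r : 1 <= expR r by rewrite -[leLHS]expR0 ler_expR.
have -> : D / N ^+ 2 = K * (expR `|x| * L / N) ^+ 2 * expR r +
   expR r * (C * ((L / N) ^+ 2 * (expR r + 2))).
  by rewrite /D; field; rewrite gt_eqF.
by rewrite lerD2l ler_peMl //; pos.
Qed.

End GaussConstant.

(** * Theta inversion for positive definite forms *)

Section Vectors.
Variable R : realType.
Implicit Types N : nat.

Lemma Re_realM (r : R) (x : R[i]) : complex.Re (r%:C * x) = r * complex.Re x.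
Proof. by rewrite cReM mul0r subr0. Qed.
Lemma Im_realM (r : R) (x : R[i]) : complex.Im (r%:C * x) = r * complex.Im x.
Proof. by rewrite cImM mul0r addr0. Qed.

Lemma dsubmx_map (K L : Type) (f : K -> L) m1 m2 n (x : 'M[K]_(m1 + m2, n)) :
  dsubmx (map_mx f x) = map_mx f (dsubmx x).
Proof. by apply/matrixP => i j; rewrite !mxE. Qed.

Definition dot (K : comNzRingType) N (x y : 'cV[K]_N) : K := \sum_i x i 0 * y i 0.

Lemma dotDl (K : comNzRingType) N (x y z : 'cV[K]_N) : dot (x + y) z = dot x z + dot y z.
Proof. by rewrite -big_split; apply: eq_bigr => i _; rewrite mxE mulrDl. Qed.
Lemma dotC (K : comNzRingType) N (x y : 'cV[K]_N) : dot x y = dot y x.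
Proof. by apply: eq_bigr => i _; rewrite mulrC. Qed.
Lemma dotDr (K : comNzRingType) N (x y z : 'cV[K]_N) : dot z (x + y) = dot z x + dot z y.
Proof. by rewrite dotC dotDl !(dotC z). Qed.
Lemma dotZl (K : comNzRingType) N (x z : 'cV[K]_N) a : dot (a *: x) z = a * dot x z.
Proof. by rewrite mulr_sumr; apply: eq_bigr => i _; rewrite mxE mulrA. Qed.
Lemma dotZr (K : comNzRingType) N (x z : 'cV[K]_N) a : dot z (a *: x) = a * dot z x.
Proof. by rewrite dotC dotZl dotC. Qed.
Lemma dotNl (K : comNzRingType) N (x z : 'cV[K]_N) : dot (- x) z = - dot x z.
Proof. by rewrite -scaleN1r dotZl mulN1r. Qed.
Lemma dotNr (K : comNzRingType) N (x z : 'cV[K]_N) : dot z (- x) = - dot z x.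
Proof. by rewrite dotC dotNl dotC. Qed.
Lemma dot0l (K : comNzRingType) N (z : 'cV[K]_N) : dot 0 z = 0.
Proof. by rewrite -(scale0r 0) dotZl mul0r. Qed.

Lemma dot_mx (K : comNzRingType) N (x y : 'cV[K]_N) : (x^T *m y) 0 0 = dot x y.
Proof. by rewrite mxE; apply: eq_bigr => i _; rewrite mxE. Qed.

Lemma dot_mulmx (K : comNzRingType) N (A : 'M[K]_N) (x y : 'cV[K]_N) :
  dot x (A *m y) = (x^T *m A *m y) 0 0.
Proof. by rewrite -dot_mx mulmxA. Qed.

Lemma dot_recl (K : comNzRingType) N (x y : 'cV[K]_(1 + N)) :
  dot x y = x 0 0 * y 0 0 + dot (dsubmx x) (dsubmx y).
Proof.
rewrite /dot big_ord_recl; congr (_ + _); apply: eq_bigr => i _; rewrite !mxE.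
by congr (x _ _ * y _ _); apply: val_inj.
Qed.

Lemma dot_map (K L : comNzRingType) (f : {rmorphism K -> L}) N (x y : 'cV[K]_N) :
  dot (map_mx f x) (map_mx f y) = f (dot x y).
Proof. by rewrite rmorph_sum; apply: eq_bigr => i _; rewrite !mxE rmorphM. Qed.

Definition rc N (x : 'cV[R]_N) : 'cV[R[i]]_N := map_mx (real_complex R) x.
Definition zr N (x : 'cV[int]_N) : 'cV[R]_N := map_mx intr x.
Definition zc N (x : 'cV[int]_N) : 'cV[R[i]]_N := map_mx intr x.

Lemma zc_rc N (x : 'cV[int]_N) : zc x = rc (zr x).
Proof. by apply/matrixP => i j; rewrite !mxE intrC. Qed.

Lemma dot_rc N (x y : 'cV[R]_N) : dot (rc x) (rc y) = (dot x y)%:C.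
Proof. exact: (dot_map (real_complex R)). Qed.

Definition vcons (K : nzRingType) N (p : K * 'cV[K]_N) : 'cV[K]_(1 + N) :=
  col_mx ((p.1)%:M : 'M[K]_1) p.2.

Lemma vcons0 (K : nzRingType) N (p : K * 'cV[K]_N) : vcons p 0 0 = p.1.
Proof.
rewrite (_ : 0 = lshift N (0 : 'I_1)); last exact: val_inj.
by rewrite /vcons col_mxEu mxE eqxx mulr1n.
Qed.

Lemma vconsd (K : nzRingType) N (p : K * 'cV[K]_N) : dsubmx (vcons p) = p.2.
Proof. exact: col_mxKd. Qed.

Lemma vcons_bij (K : nzRingType) N : bijective (@vcons K N).
Proof.
exists (fun x : 'cV[K]_(1 + N) => (x 0 0, dsubmx x)) => [[a x]|x]; first by rewrite vcons0 vconsd.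
rewrite -[RHS](vsubmxK x) /vcons /=; congr col_mx; apply/matrixP => i j.
by rewrite !ord1 !mxE eqxx mulr1n; congr (x _ _); apply: val_inj.
Qed.

Lemma bsum_vec N (g : int -> R) B : (forall x, 0 <= g x) -> bsum g B ->
  bsum (fun x : 'cV[int]_N => \prod_i g (x i 0)) (B ^+ N).
Proof.
move=> g0 gB; elim: N => [|N IH].
  move=> [|x [|y s]].
  - by rewrite big_nil.
  - by rewrite big_seq1 big_ord0.
  - by rewrite /= inE [x]flatmx0 [y]flatmx0 eqxx.
have [f fK Kf] := vcons_bij int N.
apply: (@bsum_inj_ext _ _ _ (@vcons int N)) => [|x /(_ (f x))|]; first exact: (can_inj fK).
  by rewrite Kf.
rewrite exprS; apply: bsum_le (bsum_prod g0 _ gB IH) => [p|x]; last by apply: prodr_ge0.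
rewrite big_ord_recl; apply: ler_pM => //; first exact: prodr_ge0.
  by rewrite (_ : ord0 = 0) // vcons0.
rewrite le_eqVlt; apply/orP; left; apply/eqP; apply: eq_bigr => i _; congr g.
have <- : dsubmx (vcons p) i 0 = p.2 i 0 by rewrite vconsd.
by rewrite [RHS]mxE; congr (vcons p _ _); apply: val_inj.
Qed.

End Vectors.

Section ThetaInversion.
Variable R : realType.

(* Intended for a positive real quadratic form Q on C^N with dual form Qd: every linear form b
   is represented by a vector v, which completes squares for Q and polarises Qd. *)
Definition dual_forms N (Q Qd : 'cV[R[i]]_N -> R[i]) :=
  forall b, exists v,
    (forall u c, Q (u + c *: v) = Q u + 2 * c * dot b u + c ^+ 2 * Qd b) /\
    (forall m, Qd (m - b) = Qd m + Qd b - 2 * dot m v).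

Definition coercive N (Q : 'cV[R[i]]_N -> R[i]) :=
  exists2 lam : R, 0 < lam & forall x : 'cV[R]_N, exists2 r : R,
    Q (rc x) = r%:C & lam * dot x x <= r.

(** The parameter is given through its logarithm w, so that al^(-N/2) is unambiguous also for the
    odd N through which the induction passes. *)
Definition theta_inversion_for N (Q Qd : 'cV[R[i]]_N -> R[i]) (D : R) :=
  forall w (z : 'cV[R[i]]_N), `|complex.Im w| < pi / 2 -> exists s,
    hsum (fun x : 'cV[int]_N => cexp (- (pi%:C * cexp w * Q (zc R x - z)))) s /\
    hsum (fun m : 'cV[int]_N => (Num.sqrt D)^-1%:C * cexp (- (N%:R * (w / 2))) *
      cexp (- (pi%:C / cexp w * Qd (zc R m)) + 2 * ipi R * dot (zc R m) z)) s.

Lemma gconst_mul (d : R) (w : R[i]) : 0 < d -> `|complex.Im w| < pi / 2 ->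
  gconst (d%:C * cexp w) = (Num.sqrt d)^-1%:C * cexp (- (w / 2)).
Proof.
move=> d0 hw; have -> : d%:C * cexp w = cexp ((ln d)%:C + w).
  by rewrite cexpD cexp_real lnK.
rewrite gconst_exp ?cImD ?add0r // mulrDl opprD cexpD; congr (_ * _).
rewrite -[2]/(2%:R) natrC -realcV -realcM -realcN cexp_real; congr (_%:C).
rewrite expRN; congr (_^-1); apply/eqP.
rewrite -(eqrXn2 (n := 2)) ?expR_ge0 ?sqrtr_ge0 // sqr_sqrtr ?(ltW d0) //.
by rewrite expr2 -expRD -splitr lnK.
Qed.

(** Translating by the integer part of Re z makes the bound depend on Im z only. Uniformity in Re z
    is required because the one-dimensional shift will vary with the other coordinates. *)
Lemma bsum_gauss_shift (al : R[i]) (B : R) : 0 < complex.Re al -> exists2 C, 0 <= C &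
  forall z, `|complex.Im z| <= B -> bsum (fun x : int => normc (gauss al (x%:~R - z))) C.
Proof.
move=> a0; have [K K0 HK] := gauss_decay (1 + B) a0.
exists (K * (8 * 1)) => [|z zB]; first by rewrite !mulr_ge0 // ltW.
pose n := Num.floor (complex.Re z).
have hn : normc (z - n%:~R) <= 1 + B.
  apply: (le_trans (normc_le_ReIm _)); rewrite cReD cImD cReN cImN intrC /= subr0 lerD //.
  have /andP[h1 h2] := floor_itv (complex.Re z).
  rewrite ger0_norm ?subr_ge0 // lerBlDr; apply: (le_trans (ltW h2)).
  by rewrite intrD addrC.
have inj : injective (fun x : int => x - n) by move=> x y /addIr.
have := bsum_inj inj (bsumZ (ltW K0) (bsum_cauchy (lexx 1))).
apply: bsum_le => x; rewrite divr1.
have -> : x%:~R - z = ((x - n)%:~R : R)%:C + (- (z - n%:~R)).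
  by rewrite -intrC intrB; ring.
by apply: HK; rewrite normcN.
Qed.

Lemma pm_half_pi (w : R[i]) : `|complex.Im w| < pi / 2 -> 0 < complex.Re (cexp w).
Proof.
move=> hw; rewrite /cexp cReM /= mul0r subr0 mulr_gt0 ?expR_gt0 //.
by apply: cos_gt0_pihalf; rewrite -ltr_norml.
Qed.

Lemma bsum_coercive N (Q : 'cV[R[i]]_N -> R[i]) (a : R[i]) (z : 'cV[R[i]]_N) :
  coercive Q -> 0 < complex.Re a -> exists B, bsum (fun x : 'cV[int]_N =>
    normc (cexp (- (pi%:C * a * Q (zc R x)) + 2 * ipi R * dot (zc R x) z))) B.
Proof.
move=> [lam l0 hl] a0; have p0 := pi_gt0 R.
have A0 : 0 < pi * complex.Re a * lam by rewrite !mulr_gt0.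
pose C := 2 * pi * \sum_i `|complex.Im (z i 0)|.
have [K K0 HK] := gauss_bound1 C A0.
pose g (x : int) : R := K * (1 + (x%:~R / 1) ^+ 2)^-1.
have g0 x : 0 <= g x by rewrite mulr_ge0 ?(ltW K0) // invr_ge0 addr_ge0 // sqr_ge0.
exists ((K * (8 * 1)) ^+ N).
apply: bsum_le (bsum_vec g0 (bsumZ (ltW K0) (bsum_cauchy (lexx 1)))) => x.
have [r hr lr] := hl (zr R x).
rewrite normc_cexp cReD cReN zc_rc hr.
have -> : complex.Re (pi%:C * a * r%:C) = pi * complex.Re a * r.
  by rewrite mulrAC -realcM cReM /= mul0r subr0 mulrAC.
have -> : complex.Re (2 * ipi R * dot (rc (zr R x)) z) =
   \sum_i - (2 * pi * (complex.Im (z i 0) * (x i 0)%:~R)).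
  rewrite /dot mulr_sumr (raddf_sum (@complex.Re R : Rcomplex R -> R)); apply: eq_bigr => i _ /=.
  by rewrite !mxE /ipi natrC !(cReM, cImM) /=; ring.
apply: (@le_trans _ _ (expR (\sum_i (- (pi * complex.Re a * lam * (x i 0)%:~R ^+ 2)
    + C * `|(x i 0)%:~R|)))).
  rewrite ler_expR big_split /=; apply: lerD.
    rewrite sumrN -mulr_sumr lerN2 -mulrA ler_pM2l ?mulr_gt0 //; apply: le_trans lr.
    rewrite ler_pM2l // /dot le_eqVlt; apply/orP; left; apply/eqP; apply: eq_bigr => i _.
    by rewrite !mxE expr2.
  apply: ler_sum => i _; apply: (le_trans (ler_norm _)); rewrite normrN !normrM.
  rewrite (ger0_norm (x := 2)) // (gtr0_norm p0) mulrA ler_wpM2r //.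
  rewrite /C ler_pM2l ?mulr_gt0 // (bigD1 i) //= lerDl; exact: sumr_ge0.
rewrite expR_sum; apply: ler_prod => i _; rewrite expR_ge0 /= /g divr1; exact: HK.
Qed.

Section Step.
Variables (N : nat) (Q Qd : 'cV[R[i]]_N -> R[i]) (D d : R) (b : 'cV[R]_N).
Hypotheses (D0 : 0 < D) (d0 : 0 < d) (dualQ : dual_forms Q Qd) (coQ : coercive Q) (coQd : coercive Qd)
  (thQ : theta_inversion_for Q Qd D).

(** One Schur complement step: a form in 1 + N variables with the first variable isolated in a
    square. [ext_dual] is the form of the inverse matrix. *)
Definition ext_form (x : 'cV[R[i]]_(1 + N)) : R[i] :=
  d%:C * (x 0 0 + dot (rc b) (dsubmx x)) ^+ 2 + Q (dsubmx x).
Definition ext_dual (m : 'cV[R[i]]_(1 + N)) : R[i] :=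
  m 0 0 ^+ 2 / d%:C + Qd (dsubmx m - m 0 0 *: rc b).

Let dn : d%:C != 0. Proof. by apply/eqP => -[] /eqP; rewrite gt_eqF. Qed.

Lemma ext_dual_forms : dual_forms ext_form ext_dual.
Proof.
move=> be; have [v [h1 h2]] := dualQ (dsubmx be - be 0 0 *: rc b).
exists (vcons (be 0 0 / d%:C - dot (rc b) v, v)); split.
  move=> u c; rewrite /ext_form /ext_dual linearD linearZ /= vconsd /= h1.
  rewrite [(u + _) 0 0]mxE [(c *: vcons _) 0 0]mxE vcons0 /= (dot_recl be u) !(dotDl, dotDr, dotZl, dotZr, dotNl).
  by field.
move=> m; rewrite /ext_dual (dot_recl m) vcons0 vconsd /= [(m - be) 0 0]mxE [(- be) 0 0]mxE.
have -> : dsubmx (m - be) - (m 0 0 - be 0 0) *: rc b =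
   (dsubmx m - m 0 0 *: rc b) - (dsubmx be - be 0 0 *: rc b).
  by rewrite linearB /= scalerBl !opprD !opprK !addrA; congr (_ + _); rewrite addrAC.
rewrite h2 !(dotDl, dotNl, dotZl); by field.
Qed.

Lemma ext_coercive : coercive ext_form.
Proof.
have [lam l0 hl] := coQ.
pose nb := dot b b; have nb0 : 0 <= nb by apply: sumr_ge0 => i _; rewrite -expr2 sqr_ge0.
pose E := 2 * nb; have E0 : 0 <= E by rewrite mulr_ge0.
(* From a^2 <= 2 (a + b.y)^2 + 2 (b.y)^2 and Cauchy-Schwarz, the squared length is at most 2 (a +
   b.y)^2 + (1 + 2 |b|^2) |y|^2. *)
pose mu' := Num.min (d / 2) (lam / (1 + E)).
have mu0 : 0 < mu'.
  by rewrite lt_min !divr_gt0 // ltr_pwDl.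
exists mu' => // x; have [r hr lr] := hl (dsubmx x).
exists (d * (x 0 0 + dot b (dsubmx x)) ^+ 2 + r).
  rewrite /ext_form (_ : dsubmx (rc x) = rc (dsubmx x)); last exact: dsubmx_map.
  by rewrite hr dot_rc mxE realcD realcM realcX realcD.
rewrite dot_recl -expr2; set y := dsubmx x in lr *; set a := x 0 0.
have cs : dot b y ^+ 2 <= nb * dot y y.
  have [z0|z0] := eqVneq nb 0.
    have b0 i : b i 0 = 0.
      move: z0 => /eqP; rewrite psumr_eq0 => [/allP/(_ i)|j _]; last by rewrite -expr2 sqr_ge0.
      by rewrite mem_index_enum => /(_ isT) /=; rewrite mulf_eq0 orbb => /eqP.
    by rewrite z0 mul0r /dot big1 ?expr0n // => i _; rewrite b0 mul0r.
  have nbp : 0 < nb by rewrite lt_neqAle eq_sym z0.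
  have : 0 <= dot (nb *: y - dot b y *: b) (nb *: y - dot b y *: b).
    by apply: sumr_ge0 => i _; rewrite -expr2 sqr_ge0.
  rewrite !(dotDl, dotDr, dotNl, dotNr, dotZl, dotZr) (dotC y b) -/nb.
  rewrite [X in 0 <= X](_ : _ = nb * (nb * dot y y - dot b y ^+ 2)); last by ring.
  by rewrite pmulr_rge0 // subr_ge0.
have yy0 : 0 <= dot y y by apply: sumr_ge0 => i _; rewrite -expr2 sqr_ge0.
have m1 : mu' <= d / 2 by rewrite ge_min lexx.
have m2 : mu' * (1 + E) <= lam by rewrite -ler_pdivlMr ?ltr_pwDl // ge_min lexx orbT.
have s1 : a ^+ 2 <= 2 * (a + dot b y) ^+ 2 + 2 * dot b y ^+ 2.
  by have := sqr_ge0 (a + 2 * dot b y); nra.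
have s2 : 0 <= (a + dot b y) ^+ 2 by exact: sqr_ge0.
apply: (@le_trans _ _ (mu' * (2 * (a + dot b y) ^+ 2 + (1 + E) * dot y y))).
  by rewrite ler_pM2l // /E; nra.
rewrite mulrDr; apply: lerD; first by rewrite mulrA; apply: ler_wpM2r => //; lra.
by apply: le_trans lr; rewrite mulrA ler_wpM2r.
Qed.

Lemma ext_dual_coercive : coercive ext_dual.
Proof.
have [lam l0 hl] := coQd.
pose nb := dot b b; have nb0 : 0 <= nb by apply: sumr_ge0 => i _; rewrite -expr2 sqr_ge0.
have q0 : 0 < 1 + 2 * nb by rewrite ltr_pwDl // mulr_ge0.
pose mu := Num.min (lam / 2) (d^-1 / (1 + 2 * nb)).
have mu0 : 0 < mu by rewrite lt_min !divr_gt0 // invr_gt0.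
exists mu => // x; have [r hr lr] := hl (dsubmx x - x 0 0 *: b).
exists (x 0 0 ^+ 2 / d + r).
  rewrite /ext_dual (_ : dsubmx (rc x) = rc (dsubmx x)); last exact: dsubmx_map.
  have -> : rc (dsubmx x) - (rc x) 0 0 *: rc b = rc (dsubmx x - x 0 0 *: b).
    by rewrite /rc map_mxB map_mxZ mxE.
  by rewrite hr mxE realcD realcM realcX realcV.
rewrite dot_recl -expr2; set y := dsubmx x in lr *; set a := x 0 0 in lr *.
set u := y - a *: b in lr.
have m1 : mu <= lam / 2 by rewrite ge_min lexx.
have m2 : mu * (1 + 2 * nb) <= d^-1 by rewrite -ler_pdivlMr // ge_min lexx orbT.
have s1 : dot y y <= 2 * dot u u + 2 * (a ^+ 2 * nb).
  rewrite /dot /nb /dot !mulr_sumr -big_split /=; apply: ler_sum => i _.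
  have uE : u i 0 = y i 0 - a * b i 0 by rewrite /u /y !mxE.
  by rewrite uE; have := sqr_ge0 (y i 0 - 2 * (a * b i 0)); nra.
have u0 : 0 <= dot u u by apply: sumr_ge0 => i _; rewrite -expr2 sqr_ge0.
have a2 := sqr_ge0 a.
apply: (@le_trans _ _ (mu * ((1 + 2 * nb) * a ^+ 2 + 2 * dot u u))).
  by rewrite ler_pM2l //; nra.
rewrite mulrDr; apply: lerD; first by rewrite mulrA [leRHS]mulrC ler_wpM2r.
by apply: le_trans lr; rewrite mulrA ler_wpM2r //; lra.
Qed.

(** The first coordinate is inverted for fixed x, then x for fixed dual variable n. In between, the
    double family [G] is absolutely summable, which permits exchanging the two sums. *)
Lemma ext_theta_inversion : theta_inversion_for ext_form ext_dual (d * D).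
Proof.
move=> w z hw; pose al := cexp w; have a0 := pm_half_pi hw; rewrite -/al in a0.
have an : al != 0 by exact: cexp_neq0.
have da0 : 0 < complex.Re (d%:C * al) by rewrite Re_realM mulr_gt0.
pose z' := dsubmx z.
pose E (x : 'cV[int]_N) := cexp (- (pi%:C * al * Q (zc R x - z'))).
pose zeta (x : 'cV[int]_N) := z 0 0 - dot (rc b) (zc R x - z').
have dzc (x : 'cV[int]_(1 + N)) : dsubmx (zc R x) = zc R (dsubmx x) by exact: dsubmx_map.
have T (p : 'cV[int]_N * int) :
    cexp (- (pi%:C * al * ext_form (zc R (vcons (p.2, p.1)) - z))) =
    E p.1 * gauss (d%:C * al) (p.2%:~R - zeta p.1).
  rewrite /E /gauss -cexpD /ext_form linearB /= dzc vconsd /= -/z' mxE [(- z) 0 0]mxE.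
  rewrite [zc _ _ 0 0]mxE vcons0 /= /zeta; congr cexp; ring.
(* The shift varies with x only by real numbers, so every one-dimensional bound is uniform in x. *)
have imz x : complex.Im (zeta x) = complex.Im (z 0 0 + dot (rc b) z').
  by rewrite /zeta dotDr dotNr zc_rc dot_rc !(cImD, cImN) /=; ring.
pose zt := z 0 0 + dot (rc b) z'.
have [s1 [hE0 _]] := thQ z' hw; have hE : hsum E s1 := hE0; have [BE bE] := hsum_bsum hE.
have [C C0 HC] := bsum_gauss_shift `|complex.Im zt| da0.
have b1 : bsum (fun p : 'cV[int]_N * int => normc (E p.1 * gauss (d%:C * al) (p.2%:~R - zeta p.1)))
    (C * BE).
  apply: (@bsum_pair _ _ _ (fun x n => normc (E x * gauss (d%:C * al) (n%:~R - zeta x)))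
     (fun x => C * normc (E x))) => [x n|x|]; first exact: normc_ge0.
    have hz : `|complex.Im (zeta x)| <= `|complex.Im zt| by rewrite imz.
    rewrite [C * _]mulrC; have := bsumZ (normc_ge0 (E x)) (HC _ hz); apply: bsum_le => n.
    by rewrite normcM.
  exact: bsumZ.
have [s hs] := hsum_ex b1; exists s; split.
  apply/(hsum_bij _ _ (vcons_bij int N)); apply/hsum_swap.
  by apply: eq_hsum hs => p; rewrite -T.
have rows x : hsum (fun n : int => E x * gauss (d%:C * al) (n%:~R - zeta x))
    (E x * tsum (fun n : int => gauss (d%:C * al) (n%:~R - zeta x))).
  have [r [h _]] := theta_inversion1 (zeta x) da0.
  by rewrite (hsum_tsum h); exact: hsumZ.
have hx := hsum_rows hs rows.
pose g := gconst (d%:C * al).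
pose G (p : 'cV[int]_N * int) := E p.1 *
   (g * (gauss (d%:C * al)^-1 p.2%:~R * ee (p.2%:~R * zeta p.1))).
have rowsG x : hsum (fun n : int => G (x, n))
    (E x * tsum (fun n : int => gauss (d%:C * al) (n%:~R - zeta x))).
  have [r [h h']] := theta_inversion1 (zeta x) da0.
  by rewrite (hsum_tsum h); exact: (hsumZ (E x) h').
have [r0 [_ hr0]] := theta_inversion1 zt da0; have [B2 bB2] := hsum_bsum hr0.
have bG : bsum (fun p => normc (G p)) (BE * B2).
  have nG p : normc (G p) = normc (E p.1) *
      normc (gconst (d%:C * al) * (gauss (d%:C * al)^-1 p.2%:~R * ee (p.2%:~R * zt))).
    rewrite /G normcM; congr (_ * _); rewrite !(normcM g) !(normcM (gauss _ _)); congr (_ * (_ * _)).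
    by rewrite !normc_ee intrC !Im_realM imz.
  have := bsum_prod (fun x => normc_ge0 (E x)) (fun n => normc_ge0 _) bE bB2.
  by apply: bsum_le => p; rewrite nG.
have hG := hsum_from_rows bG rowsG hx; move/hsum_swap: hG => hG.
pose K := (Num.sqrt D)^-1%:C * cexp (- (N%:R * (w / 2))).
pose F (p : int * 'cV[int]_N) : R[i] := g * K * cexp (- (pi%:C / al * ext_dual (zc R (vcons p)))
    + 2 * ipi R * dot (zc R (vcons p)) z).
have gK : g * K = (Num.sqrt (d * D))^-1%:C * cexp (- ((1 + N)%:R * (w / 2))).
  rewrite /g /al gconst_mul // /K sqrtrM ?(ltW d0) // invfM realcM natrD mulrDl mul1r opprD cexpD.
  by ring.
suff key n : exists r, hsum (fun x => G (x, n)) r /\ hsum (fun m => F (n, m)) r.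
  have [rr hrr] := choice key.
  have h1 := hsum_rows hG (fun n => (hrr n).1).
  apply/(hsum_bij _ _ (vcons_bij int N)).
  suff : hsum F s by apply: eq_hsum => p; rewrite /F -gK.
  have ia0 : 0 < complex.Re al^-1 by exact: Re_inv_gt0.
  have [B hB] := bsum_coercive z ext_dual_coercive ia0.
  apply: (@hsum_from_rows _ _ _ F rr s (normc (g * K) * B)) => //; last by move=> n; exact: (hrr n).2.
  have inj : injective (@vcons int N) by exact: bij_inj (vcons_bij int N).
  apply: bsum_le (bsum_inj inj (bsumZ (normc_ge0 (g * K)) hB)) => p.
  by rewrite /F normcM.
(* For fixed n the character contributes a linear form n b in x. Its representing vector v completes
   the square and moves z' to z2. *)
have [v [sq pol]] := dualQ (n%:~R *: rc b).
pose z2 := z' - ('i / al) *: v.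
have [s2 [h2 h3]] := thQ z2 hw; rewrite -/al in h2 h3.
pose c1 := g * gauss (d%:C * al)^-1 n%:~R * ee (n%:~R * z 0 0) *
   cexp (- (pi%:C / al * Qd (n%:~R *: rc b))).
have i2 : 'i * 'i = -1 :> R[i] by rewrite -expr2 sqr_i.
have perm1 (e1 e2 e3 e4 e5 e6 e7 : R[i]) :
  e3 * e4 * e5 = e6 * e7 -> e1 * e2 * e3 * e4 * e5 = e6 * (e1 * (e2 * e7)).
  by move=> h; transitivity (e1 * e2 * (e3 * e4 * e5)); [ring|rewrite h; ring].
have perm2 (e1 e2 e3 e4 e5 e6 e7 : R[i]) :
  e2 * e3 * e4 * e6 = e7 -> e1 * e2 * e3 * e4 * (e5 * e6) = e1 * e5 * e7.
  by move=> <-; ring.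
exists (c1 * s2); split.
  apply: eq_hsum (hsumZ c1 h2) => x; rewrite /G /= /c1 /E.
  have -> : zc R x - z2 = (zc R x - z') + ('i / al) *: v by rewrite /z2 opprB addrA addrAC.
  rewrite sq dotZl; set u := zc R x - z'.
  apply: perm1; rewrite /ee /zeta -/u -!cexpD; congr cexp; rewrite /ipi.
  have -> : ('i / al) ^+ 2 = ('i * 'i) / (al * al) by field.
  rewrite i2; set I := 'i; field; exact: an.
apply: eq_hsum (hsumZ c1 h3) => m; rewrite /F /c1 -/K /ext_dual.
have -> : dsubmx (zc R (vcons (n, m))) = zc R m by rewrite dzc vconsd.
have -> : zc R (vcons (n, m)) 0 0 = n%:~R by rewrite mxE vcons0.
rewrite (dot_recl _ z) dzc vconsd /= [zc _ _ 0 0]mxE vcons0 /= -/z' pol.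
have -> : dot (zc R m) z2 = dot (zc R m) z' - 'i / al * dot (zc R m) v.
  by rewrite /z2 dotDr dotNr dotZr.
apply: perm2; rewrite /gauss /ee -!cexpD; congr cexp; rewrite /ipi.
have -> : 2 * (pi%:C * 'i) * (dot (zc R m) z' - 'i / al * dot (zc R m) v) =
   2 * pi%:C * 'i * dot (zc R m) z' - ('i * 'i) * (2 * pi%:C / al * dot (zc R m) v) by field; exact: an.
rewrite i2; set I := 'i; field.
by rewrite an dn.
Qed.

End Step.
End ThetaInversion.

Section Forms.
Variables (N : nat) (S : 'M[int]_N).
Implicit Types K L : comNzRingType.

Lemma formE K (x y : 'cV[K]_N) : form S x y = dot x (map_mx intr S *m y).
Proof. by rewrite dot_mulmx. Qed.
Lemma formDl K (x y z : 'cV[K]_N) : form S (x + y) z = form S x z + form S y z.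
Proof. by rewrite !formE dotDl. Qed.
Lemma formDr K (x y z : 'cV[K]_N) : form S z (x + y) = form S z x + form S z y.
Proof. by rewrite !formE mulmxDr dotDr. Qed.
Lemma formZl K (x z : 'cV[K]_N) a : form S (a *: x) z = a * form S x z.
Proof. by rewrite !formE dotZl. Qed.
Lemma formZr K (x z : 'cV[K]_N) a : form S z (a *: x) = a * form S z x.
Proof. by rewrite !formE -scalemxAr dotZr. Qed.
Lemma formNl K (x z : 'cV[K]_N) : form S (- x) z = - form S x z.
Proof. by rewrite !formE dotNl. Qed.
Lemma formNr K (x z : 'cV[K]_N) : form S z (- x) = - form S z x.
Proof. by rewrite !formE mulmxN dotNr. Qed.

Definition formLE := (@formDl, @formDr, @formNl, @formNr, @formZl, @formZr).

Lemma map_intr_mx K L (f : {rmorphism K -> L}) : map_mx f (map_mx intr S : 'M[K]_N) = map_mx intr S.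
Proof. by apply/matrixP => i j; rewrite !mxE rmorph_int. Qed.

Lemma form_map K L (f : {rmorphism K -> L}) (x y : 'cV[K]_N) :
  form S (map_mx f x) (map_mx f y) = f (form S x y).
Proof. by rewrite !formE -(map_intr_mx f) -map_mxM dot_map. Qed.

Hypothesis S_sym : S^T = S.

Lemma formC K (x y : 'cV[K]_N) : form S x y = form S y x.
Proof.
rewrite /form -[LHS](mxE trmx_key (fun i j => (x^T *m map_mx intr S *m y) j i)) -/(trmx _).
by rewrite !trmx_mul trmxK map_trmx S_sym mulmxA.
Qed.

Hypothesis S_even : forall i, (2 %| S i i)%Z.

(** Upper triangular with half the diagonal, so that S is its symmetrisation and (x, x)/2 is the
    visibly integral [halfq]. *)
Definition half_gram : 'M[int]_N :=
  \matrix_(i, j) (if (i < j)%N then S i j else if i == j then (S i i %/ 2)%Z else 0).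

Definition halfq (x : 'cV[int]_N) : int := dot x (half_gram *m x).

Lemma gram_split : S = half_gram + half_gram^T.
Proof.
apply/matrixP => i j; rewrite !mxE.
case: (ltngtP i j) => [lt_ij|lt_ji|eq_ij].
- have /negbTE -> : j != i by rewrite neq_ltn lt_ij orbT.
  by rewrite addr0.
- have /negbTE -> : i != j by rewrite neq_ltn lt_ji orbT.
  by rewrite add0r -[in LHS]S_sym mxE.
- rewrite (val_inj eq_ij) eqxx; have /dvdzP[q ->] := S_even j.
  by rewrite mulzK // mulrDr mulr1 //; lia.
Qed.

Lemma form_int (x y : 'cV[int]_N) : form S x y = dot x (S *m y).
Proof. by rewrite formE; congr (dot _ (_ *m _)); apply/matrixP => i j; rewrite mxE intz. Qed.

Lemma form_halfq_int (x : 'cV[int]_N) : form S x x = 2 * halfq x.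
Proof.
rewrite form_int {1}gram_split mulmxDl dotDr -/(halfq x).
have -> : dot x (half_gram^T *m x) = halfq x.
  rewrite /halfq -!dot_mx -[LHS](mxE trmx_key (fun i j => (x^T *m (half_gram^T *m x)) j i)) -/(trmx _).
  by rewrite !trmx_mul !trmxK mulmxA.
by lia.
Qed.

Lemma form_halfq K (x : 'cV[int]_N) :
  form S (map_mx intr x : 'cV[K]_N) (map_mx intr x) = 2 * (halfq x)%:~R.
Proof. by rewrite (form_map (intr : {rmorphism int -> K})) form_halfq_int rmorphM. Qed.

Lemma halfqD (x y : 'cV[int]_N) : halfq (x + y) = halfq x + form S x y + halfq y.
Proof.
have h : 2 * halfq (x + y) = 2 * (halfq x + form S x y + halfq y).
  rewrite -form_halfq_int !formDl !formDr (formC y x) !mulrDr -!form_halfq_int; ring.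
by lia.
Qed.

Lemma halfqZ (a : int) (x : 'cV[int]_N) : halfq (a *: x) = a ^+ 2 * halfq x.
Proof. by rewrite /halfq -scalemxAr dotZl dotZr mulrA. Qed.

End Forms.

Section PosDef.
Variable R : realType.

Definition qf (K : comNzRingType) N (A : 'M[K]_N) (x : 'cV[K]_N) : K := (x^T *m A *m x) 0 0.

Definition shear (K : comNzRingType) N (b : 'cV[K]_N) : 'M[K]_(1 + N) :=
  block_mx 1%:M b^T 0 1%:M.
Definition schur (K : comNzRingType) N (d : K) (b : 'cV[K]_N) (A : 'M[K]_N) : 'M[K]_(1 + N) :=
  (shear b)^T *m block_mx d%:M 0 0 A *m shear b.

Lemma qf_schur (K : comNzRingType) N (d : K) (b : 'cV[K]_N) A (x : 'cV[K]_(1 + N)) :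
  qf (schur d b A) x = d * (x 0 0 + dot b (dsubmx x)) ^+ 2 + qf A (dsubmx x).
Proof.
have [g gK Kg] := vcons_bij K N; rewrite -[x]Kg; case: (g x) => [a y]; rewrite vcons0 vconsd /=.
have E : shear b *m vcons (a, y) = vcons (a + dot b y, y).
  rewrite /shear /vcons mul_block_col /= mul1mx mul0mx mul1mx add0r; congr col_mx.
  apply/matrixP => i j; rewrite !ord1 [LHS]mxE [in LHS]mxE [RHS]mxE.
  by rewrite dot_mx.
have -> : qf (schur d b A) (vcons (a, y)) = qf (block_mx d%:M 0 0 A) (vcons (a + dot b y, y)).
  by rewrite -E /qf /schur trmx_mul !mulmxA.
rewrite /qf -mulmxA {2}/vcons /= mul_block_col !mul0mx addr0 add0r /vcons tr_col_mx /= mul_row_col mxE.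
congr (_ + _); last by rewrite mulmxA.
by rewrite tr_scalar_mx -!scalar_mxM mxE eqxx mulr1n; ring.
Qed.

Lemma det_schur (K : comNzRingType) N (d : K) (b : 'cV[K]_N) A : \det (schur d b A) = d * \det A.
Proof.
have ds : \det (shear b) = 1 by rewrite /shear det_ublock !det1 mulr1.
by rewrite /schur !det_mulmx det_tr ds det_ublock det_scalar1 mul1r mulr1.
Qed.

Lemma schur_decomposition N (A : 'M[R]_(1 + N)) : A^T = A -> A 0 0 != 0 ->
  exists (b : 'cV[R]_N) (B : 'M[R]_N), B^T = B /\ A = schur (A 0 0) b B.
Proof.
move=> As d0; set d := A 0 0 in d0 *; pose b : 'cV[R]_N := d^-1 *: dlsubmx A.
exists b, (drsubmx A - d *: (b *m b^T)); split.
  by rewrite linearB linearZ /= trmx_mul trmxK trmx_drsub As.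
rewrite /schur /shear tr_block_mx !trmx1 trmx0 trmxK !mulmx_block.
rewrite !(mul1mx, mulmx1, mul0mx, mulmx0, addr0, add0r) mul_mx_scalar mul_scalar_mx.
rewrite -{1}(submxK A); congr block_mx.
- apply/matrixP => i j; rewrite !ord1 !mxE eqxx mulr1n; congr (A _ _); exact: val_inj.
- rewrite /b linearZ /= scalerA mulfV // scale1r -{1}As trmx_dlsub; reflexivity.
- by rewrite /b scalerA mulfV // scale1r.
- by rewrite -scalemxAl addrC subrK.
Qed.

Lemma map_schur (K L : comNzRingType) (f : {rmorphism K -> L}) N d (b : 'cV[K]_N) A :
  map_mx f (schur d b A) = schur (f d) (map_mx f b) (map_mx f A).
Proof.
rewrite /schur /shear !map_mxM -!map_trmx !map_block_mx !map_mx1 !map_mx0 map_trmx.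
by rewrite map_scalar_mx.
Qed.

Lemma hsum_vec0 (f : 'cV[int]_0 -> R[i]) : hsum f (f 0).
Proof.
have bij : bijective (fun _ : unit => 0 : 'cV[int]_0).
  by exists (fun _ => tt) => [[]|x] //; rewrite [x]flatmx0.
apply/(hsum_bij _ _ bij); have := hsum_fin (fun _ : unit => f 0).
by rewrite (big_pred1 tt) // => -[].
Qed.

(** Induction on N, splitting off the first variable by a Schur complement. *)
Lemma theta_inversion_posdef N (A : 'M[R]_N) : A^T = A -> (forall x, x != 0 -> 0 < qf A x) ->
  let Q := qf (map_mx (real_complex R) A) in
  exists Qd, [/\ 0 < \det A, dual_forms Q Qd, coercive Q, coercive Qd &
    theta_inversion_for Q Qd (\det A)].
Proof.
elim: N A => [|N IH] A As Ap Q.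
  have Q0 x : Q x = 0 by rewrite /Q /qf mxE big_ord0.
  have dot0 (x y : 'cV[R[i]]_0) : dot x y = 0 by rewrite /dot big_ord0.
  have co (P : 'cV[R[i]]_0 -> R[i]) : (forall x, P x = 0) -> coercive P.
    move=> P0; exists 1 => // x; exists 0; first by rewrite P0.
    by rewrite /dot big_ord0 mulr0.
  exists (fun=> 0); rewrite det_mx00; split => //; first by move=> b; exists 0; split=> *;
    rewrite ?Q0 ?dot0 !(mulr0, addr0, subr0).
  - exact: co.
  - exact: co.
  move=> w z hw; exists 1; split.
    by have := hsum_vec0 (fun x => cexp (- (pi%:C * cexp w * Q (zc R x - z))));
      rewrite Q0 mulr0 oppr0 cexp0.
  have := hsum_vec0 (fun m => (Num.sqrt 1)^-1%:C * cexp (- (0%:R * (w / 2))) *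
      cexp (- (pi%:C / cexp w * 0) + 2 * ipi R * dot (zc R m) z)).
  by rewrite dot0 sqrtr1 invr1 mul0r !mulr0 oppr0 addr0 cexp0 !mulr1.
have d0 : 0 < A 0 0.
  have e0 : (delta_mx 0 0 : 'cV[R]_(1 + N)) != 0.
    by apply/eqP => /matrixP/(_ 0 0)/eqP; rewrite !mxE !eqxx oner_eq0.
  by have := Ap _ e0; rewrite /qf trmx_delta -rowE -colE !mxE.
have [b [B [Bs AE]]] := schur_decomposition As (lt0r_neq0 d0).
have Bp x : x != 0 -> 0 < qf B x.
  (* This first coordinate annihilates the square, so positivity of A at this vector is positivity
     of the complement at x. *)
  move=> x0; have n0 : vcons (- dot b x, x) != 0.
    by apply: contraNneq x0 => /(congr1 (@dsubmx _ 1 N 1)); rewrite vconsd linear0 /= => ->.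
  by have := Ap _ n0; rewrite AE qf_schur vcons0 vconsd /= addNr expr0n mulr0 add0r.
have [Qd [D0 dQ cQ cQd th]] := IH _ Bs Bp.
have QE : Q = ext_form (qf (map_mx (real_complex R) B)) (A 0 0) b.
  by apply/funext => x; rewrite /Q {1}AE map_schur qf_schur.
have dE : \det A = A 0 0 * \det B by rewrite {1}AE det_schur.
exists (ext_dual Qd (A 0 0) b); rewrite QE dE; split.
- exact: mulr_gt0.
- exact: ext_dual_forms.
- exact: ext_coercive.
- exact: ext_dual_coercive.
- exact: ext_theta_inversion.
Qed.

(** The vector v representing A l pairs under A with every u as l does, whence Qd (A l) = A(v, v) =
    A(v, l) = A(l, l). This pins down the abstract dual form on the dual lattice. *)
Lemma dual_form_mul N (A : 'M[R[i]]_N) Qd (l : 'cV[R[i]]_N) : A^T = A ->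
  dual_forms (qf A) Qd -> Qd (A *m l) = qf A l.
Proof.
move=> As /(_ (A *m l))[v [h _]]; pose B (x y : 'cV[R[i]]_N) := (x^T *m A *m y) 0 0.
have BC x y : B x y = B y x.
  rewrite /B -[LHS](mxE trmx_key (fun i j => (x^T *m A *m y) j i)) -/(trmx _).
  by rewrite !trmx_mul trmxK As mulmxA.
have BE x y : B x y = dot x (A *m y) by rewrite dot_mulmx.
have qE u c : qf A (u + c *: v) = qf A u + 2 * c * B u v + c ^+ 2 * qf A v.
  have qB x : qf A x = B x x by [].
  rewrite !qB !BE mulmxDr -scalemxAr !(dotDl, dotDr, dotZl, dotZr) -!BE (BC v u); ring.
have e0 : qf A v = Qd (A *m l).
  have := h 0 1; rewrite qE /B linear0 /qf linear0 !mul0mx !mxE (dotC _ 0) dot0l; by rewrite !(mulr0, add0r, expr1n, mul1r).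
have e1 u : B u v = B u l.
  have := h u 1; rewrite qE e0 (dotC _ u) -BE => /addIr/addrI; rewrite mulr1 => /mulfI; apply.
  by rewrite pnatr_eq0.
by rewrite -e0 -[qf A v]/(B v v) e1 BC e1.
Qed.

End PosDef.

Section LatticeTheta.
Variables (R : realType) (N : nat) (S : 'M[int]_N).
Hypotheses (S_sym : S^T = S) (S_pos : pos_def R S) (N_even : ~~ odd N).

Definition dual_vec (v : 'cV[int]_N) : 'cV[R]_N := invmx (map_mx intr S) *m zr R v.
Definition dualq (v : 'cV[int]_N) : R := form S (dual_vec v) (dual_vec v) / 2.

Local Notation Q := (fun x : 'cV[R[i]]_N => form S x x).

Lemma gram_forms : exists Qd, [/\ 0 < (\det S)%:~R :> R, dual_forms Q Qd, coercive Q, coercive Qd &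
    theta_inversion_for Q Qd ((\det S)%:~R)].
Proof.
have As : (map_mx intr S : 'M[R]_N)^T = map_mx intr S by rewrite map_trmx S_sym.
have := theta_inversion_posdef As S_pos; rewrite det_map_mx map_intr_mx.
exact.
Qed.

Lemma det_gram_gt0 : 0 < \det S.
Proof. by have [Qd []] := gram_forms; rewrite ltr0z. Qed.

Lemma gram_unit : (map_mx intr S : 'M[R]_N) \in unitmx.
Proof. by rewrite unitmxE det_map_mx unitfE intr_eq0 gt_eqF // det_gram_gt0. Qed.

Lemma gram_dual_vec v : map_mx intr S *m dual_vec v = zr R v.
Proof. by rewrite /dual_vec mulKVmx // gram_unit. Qed.

Lemma dual_vec_inj : injective dual_vec.
Proof.
move=> u v /(congr1 (mulmx (map_mx intr S))); rewrite !gram_dual_vec => /matrixP h.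
by apply/matrixP => i j; have /eqP := h i j; rewrite !mxE eqr_int => /eqP.
Qed.

Lemma form_dual_vec v (z : 'cV[R[i]]_N) : form S (rc (dual_vec v)) z = dot (zc R v) z.
Proof.
rewrite formC // formE dotC; congr dot.
by rewrite -(map_intr_mx S (real_complex R)) /rc -map_mxM gram_dual_vec zc_rc.
Qed.

Lemma form_dual_vecR v (z : 'cV[R]_N) : form S (dual_vec v) z = dot (zr R v) z.
Proof. by rewrite formC // formE dotC gram_dual_vec. Qed.

Lemma gram_dual_form Qd v : dual_forms Q Qd -> Qd (zc R v) = (2 * dualq v)%:C.
Proof.
move=> h; have As : (map_mx intr S : 'M[R[i]]_N)^T = map_mx intr S by rewrite map_trmx S_sym.
have -> : zc R v = map_mx intr S *m rc (dual_vec v).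
  by rewrite -(map_intr_mx S (real_complex R)) /rc -map_mxM gram_dual_vec zc_rc.
rewrite (dual_form_mul _ As h) -[qf _ _]/(form S (rc (dual_vec v)) (rc (dual_vec v))).
by rewrite form_map /dualq mulrC divfK.
Qed.

Lemma dualq_ge0 v : 0 <= dualq v.
Proof.
rewrite divr_ge0 //; have [->|] := eqVneq (dual_vec v) 0; first by rewrite formE dot0l.
by move/S_pos/ltW.
Qed.

Lemma bsum_dual (t : R[i]) z : 0 < complex.Im t -> exists B, bsum (fun v : 'cV[int]_N =>
  normc (ee ((dualq v)%:C * t + dot (zc R v) z))) B.
Proof.
move=> t0; have [Qd [_ dQ _ cQd _]] := gram_forms.
have i0 : 0 < complex.Re (- 'i * t) by rewrite cReM /= oppr0 mul0r sub0r mulN1r opprK.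
have [B hB] := bsum_coercive z cQd i0; exists B; apply: bsum_le hB => v.
rewrite (gram_dual_form v dQ) le_eqVlt; apply/orP; left; apply/eqP; congr (normc (cexp _)).
by rewrite realcM -[(2%:R)%:C]natrC /ipi; ring.
Qed.

Lemma bsum_theta (t : R[i]) (z : 'cV[R[i]]_N) : 0 < complex.Im t -> exists B, bsum (fun x : 'cV[int]_N =>
  normc (cexp (ipi R * (form S (zc R x) (zc R x) * t + 2 * form S (zc R x) z)))) B.
Proof.
move=> t0; have [Qd [_ _ cQ _ _]] := gram_forms.
have i0 : 0 < complex.Re (- 'i * t) by rewrite cReM /= oppr0 mul0r sub0r mulN1r opprK.
have [B hB] := bsum_coercive (map_mx intr S *m z) cQ i0; exists B; apply: bsum_le hB => v.
rewrite le_eqVlt; apply/orP; left; apply/eqP; congr (normc (cexp _)).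
by rewrite (formE _ _ z) /ipi; ring.
Qed.

Definition vtheta (w : R[i]) (z : 'cV[R[i]]_N) (y : 'cV[int]_N) :=
  cexp (- (ipi R * (form S (zc R y - z) (zc R y - z) / w))).

(** The case al = i/w, which lies in the right half plane. N being even, al^(-N/2) is the integral
    power (w/i)^(N/2). *)
Lemma lattice_theta_inversion (w : R[i]) (z : 'cV[R[i]]_N) : 0 < complex.Im w -> exists s,
  hsum (vtheta w z) s /\
  hsum (fun v : 'cV[int]_N => (covolume R S)^-1%:C * (w / 'i) ^+ N./2 *
    ee ((dualq v)%:C * w + dot (zc R v) z)) s.
Proof.
move=> w0; have [Qd [_ dQ _ _ th]] := gram_forms.
have wn : w != 0 by apply: contraTneq w0 => ->; rewrite ltxx.
have in0 : ('i : R[i]) != 0 by apply/eqP => /(congr1 (@complex.Im R))/eqP; rewrite /= oner_eq0.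
have i2 : 'i * 'i = -1 :> R[i] by rewrite -expr2 sqr_i.
have wi : 0 < complex.Re (w / 'i).
  have -> : w / 'i = - ('i * w) by apply: (mulfI in0); rewrite mulrC divfK // mulrN mulrA i2 mulN1r opprK.
  by rewrite cReN cReM /= mul0r mul1r sub0r opprK.
have [om E oI] := cexp_onto (Re_inv_gt0 wi).
have [s [h1 h2]] := th om z oI; exists s; split.
  apply: eq_hsum h1 => y; rewrite E /vtheta; congr (cexp (- _)).
  by rewrite /ipi; field; rewrite wn in0.
apply: eq_hsum h2 => v; rewrite -[Num.sqrt _]/(covolume R S); congr (_ * _ * _).
  have -> : - (N%:R * (om / 2)) = - (N./2%:R * om).
    rewrite -{1}(odd_double_half N) (negbTE N_even) add0n -muln2 natrM; congr (- _); by field.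
  by rewrite cexpN cexpMn E exprVn invrK.
rewrite (gram_dual_form v dQ) E /ee; congr cexp.
rewrite realcM -[(2%:R)%:C]natrC /ipi.
have -> : pi%:C / (w / 'i)^-1 = - (pi%:C * 'i) * w.
  rewrite invrK; apply: (mulfI in0); rewrite mulrCA [_ * (w / _)]mulrC divfK //.
  by transitivity (- ('i * 'i) * pi%:C * w); [rewrite i2; ring | ring].
ring.
Qed.

End LatticeTheta.

(** * The Lipschitz formula over the dual lattice *)

Section LatticeLipschitz.
Variables (R : realType) (N : nat) (S : 'M[int]_N) (k : nat).
Hypotheses (S_sym : S^T = S) (S_pos : pos_def R S) (N_even : ~~ odd N) (k_gt : (2 + N < k)%N).

Local Notation dq := (dualq R S).
Local Notation a := (k - N./2 - 1)%N.

Let a_gt0 : (0 < a)%N. Proof. by lia. Qed.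
Let kE : k = (a.+1 + N./2)%N. Proof. by lia. Qed.

(** The adjugate shows 2 det S to be a denominator. Subtracting from the ceiling n0 leaves a
    fractional part s/D in [0, 1), the shift in the Lipschitz formula. *)
Lemma dualq_rational v : exists n0 s D : nat,
  (s < D)%N /\ dq v = n0%:R - s%:R / D%:R.
Proof.
have dS := det_gram_gt0 S_sym S_pos.
pose D := (2 * `|\det S|)%N; pose p := dot v (\adj S *m v).
have D0 : (0 < D)%N by rewrite /D; lia.
have DR : (D%:R : R) != 0 by rewrite pnatr_eq0 -lt0n.
have DE : (D%:R : R) = 2 * (\det S)%:~R.
  by rewrite /D natrM; congr (_ * _); rewrite pmulrn; congr (_%:~R); lia.
have qE : dq v = p%:~R / D%:R.
  rewrite /dq /dualq form_dual_vecR // /dual_vec /invmx gram_unit //.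
  rewrite -scalemxAl dotZr -map_mx_adj det_map_mx -map_mxM dot_map DE -/p.
  by rewrite invfM; ring.
have p0 : 0 <= p.
  have := dualq_ge0 S_pos v; rewrite -/(dq v) qE pmulr_lge0 ?invr_gt0 ?ltr0n // ler0z.
  exact.
pose P := `|p|%N; pose n0 := ((P + D.-1) %/ D)%N.
have e1 := divn_eq (P + D.-1) D; have e2 := ltn_pmod (P + D.-1) D0; rewrite -/n0 in e1.
exists n0, (n0 * D - P)%N, D; split; first by lia.
rewrite qE natrB; last by lia.
rewrite natrM mulrBl mulfK // opprB addrC subrK; congr (_ / _).
by rewrite pmulrn; congr (_%:~R); rewrite /P; lia.
Qed.

(** The positive part lets the Fourier sum run over all n: its a-th power vanishes outside n > (l,
    l)/2, as a > 0. *)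
Definition gap v (n : nat) : R := Num.max 0 (n%:R - dq v).
Definition lip_coef : R[i] := (- (2 * ipi R)) ^+ a.+1 / (a`!)%:R.

Lemma gap_ge0 v n : 0 <= gap v n. Proof. by rewrite /gap le_max lexx. Qed.

Lemma gap_rational v : exists n0 s D : nat, [/\ (s < D)%N, dq v = n0%:R - s%:R / D%:R,
  (forall i, gap v (n0 + i) = i%:R + s%:R / D%:R) &
  (forall n, (n < n0)%N -> gap v n = 0)].
Proof.
have [n0 [s [D [sD E]]]] := dualq_rational v; exists n0, s, D.
have D0 : 0 < D%:R :> R by rewrite ltr0n (leq_ltn_trans _ sD).
have rho1 : s%:R / D%:R < 1 :> R by rewrite ltr_pdivrMr // mul1r ltr_nat.
split => // [i|n ltn].
  have -> : gap v (n0 + i) = Num.max 0 (i%:R + s%:R / D%:R).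
    by rewrite /gap E natrD; congr (Num.max _ _); ring.
  by apply/max_idPr; rewrite addr_ge0 // divr_ge0.
have : n.+1%:R <= n0%:R :> R by rewrite ler_nat.
rewrite -natr1 /gap E => h; apply/max_idPl; lra.
Qed.

Lemma off_shift n0 (n : nat) : (forall i : nat, (n0 + i)%N <> n) -> (n < n0)%N.
Proof. by rewrite ltnNge => h; apply/negP => /subnKC; apply: h. Qed.

(** At integers m the frequency (l, l)/2 = n0 - rho may be replaced by -rho, since e(n0 m) = 1; the
    index i of the Lipschitz formula becomes n = n0 + i. *)
Lemma lipschitz_dual v (t : R[i]) : 0 < complex.Im t -> exists l,
  hsum (fun m : int => (t + m%:~R) ^- a.+1 * ee ((dq v)%:C * (t + m%:~R))) l /\
  hsum (fun n : nat => lip_coef * ((gap v n ^+ a)%:C * ee (n%:R * t))) l.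
Proof.
move=> t0; have [n0 [s [D [sD E g1 g2]]]] := gap_rational v.
have [l [h1 h2]] := lipschitz_formula t0 sD a_gt0.
set rho := s%:R / D%:R in h1 h2.
have rE : (dq v)%:C = n0%:R - rho by rewrite E realcB realcM realcV -!natrC.
exists (ee ((dq v)%:C * t) * l); split.
  apply: eq_hsum (hsumZ _ h1) => m; rewrite mulrCA; congr (_ * _).
  rewrite -eeD mulrDr; have -> : (dq v)%:C * m%:~R = - (rho * m%:~R) + (n0%:Z * m)%:~R.
    by rewrite rE rmorphM /= -pmulrn; ring.
  by rewrite addrA eeDint.
have inj : injective (fun i : nat => n0 + i)%N by exact: addnI.
apply/(hsum_reindex _ inj).
  by move=> n /off_shift/g2 ->; rewrite expr0n; move: a_gt0; case: (a) => // b _; rewrite mul0r mulr0.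
apply: eq_hsum (hsumZ _ h2) => i; have rhoC : (s%:R / D%:R : R)%:C = rho by rewrite realcM realcV -!natrC.
rewrite g1 realcX realcD -natrC rhoC /lip_coef natrD.
have -> : ee ((n0%:R + i%:R) * t) = ee ((dq v)%:C * t) * ee ((i%:R + rho) * t).
  by rewrite -eeD rE; congr ee; ring.
by move: (ee _) (ee _) => X Y; ring.
Qed.

Lemma bsum_gap (y : R) : 0 < y -> exists2 C, 0 <= C & forall v,
  bsum (fun n : nat => gap v n ^+ a * expR (- (2 * pi * y * n%:R)))
    (C * expR (- (2 * pi * y * dq v))).
Proof.
move=> y0; have d0 : 0 < 2 * pi * y by rewrite !mulr_gt0 ?pi_gt0.
have [K K0 HK] := poly_exp_bound a d0 (lexx 1).
exists (K * (2 / 1)) => [|v]; first by rewrite mulr_ge0 ?divr_ge0 // ltW.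
have [n0 [s [D [sD E g1 g2]]]] := gap_rational v.
have D0 : 0 < D%:R :> R by rewrite ltr0n (leq_ltn_trans _ sD).
set rho := s%:R / D%:R in E g1.
have rho1 : rho < 1 by rewrite ltr_pdivrMr // mul1r ltr_nat.
have rho0 : 0 <= rho by rewrite divr_ge0 // ltW.
have inj : injective (fun i : nat => n0 + i)%N by exact: addnI.
apply: (bsum_inj_ext inj).
  by move=> n /off_shift/g2 ->; rewrite expr0n; move: a_gt0; case: (a) => // b _; rewrite mul0r.
rewrite [K * _ * _]mulrC mulrA.
have h := bsumZ (mulr_ge0 (expR_ge0 (- (2 * pi * y * dq v))) (ltW K0)) (bsum_inv_sqr (lexx 1)).
apply: bsum_le h => i /=; rewrite g1 E.
have -> : expR (- (2 * pi * y * (n0 + i)%:R)) =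
   expR (- (2 * pi * y * (n0%:R - rho))) * expR (- (2 * pi * y * (i%:R + rho))).
  by rewrite -expRD natrD; congr expR; ring.
rewrite mulrCA -[leRHS]mulrA ler_pM2l ?expR_gt0 //; apply: le_trans (HK i%:R _) => //.
apply: ler_pM; rewrite ?expR_ge0 ?exprn_ge0 ?addr_ge0 //.
  by rewrite lerXn2r ?nnegrE ?addr_ge0 // lerD2l ltW.
by rewrite ler_expR lerN2 ler_pM2l // lerDl.
Qed.

Definition fterm (t : R[i]) (z : 'cV[R[i]]_N) (p : 'cV[int]_N * nat) : R[i] :=
  (gap p.1 p.2 ^+ a)%:C * ee (p.2%:R * t + dot (zc R p.1) z).

Lemma bsum_fterm t z : 0 < complex.Im t -> exists B, bsum (fun p => normc (fterm t z p)) B.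
Proof.
move=> t0; have [C C0 HC] := bsum_gap t0; have [B hB] := bsum_dual S_sym S_pos z t0.
exists (C * B).
apply: (@bsum_pair _ _ _ (fun v n => normc (fterm t z (v, n)))
   (fun v => C * normc (ee ((dq v)%:C * t + dot (zc R v) z)))) => [v n|v|]; first exact: normc_ge0.
  have nE (r : R) (u w : R[i]) : normc (ee (r%:C * u + w)) =
      expR (- (2 * pi * complex.Im u * r)) * normc (ee w).
    by rewrite eeD normcM normc_ee Im_realM; congr (expR (- _) * _); ring.
  rewrite nE mulrA; have := bsumZ (normc_ge0 (ee (dot (zc R v) z))) (HC v).
  rewrite [_ * (C * _)]mulrC; apply: bsum_le => n.
  rewrite /fterm normcM normc_real_ge0 ?exprn_ge0 ?gap_ge0 // natrC nE.
  have perm (e1 e2 e3 : R) : e1 * (e2 * e3) = e3 * (e1 * e2) by ring.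
  by rewrite [leLHS]perm; exact: lexx.
exact: bsumZ.
Qed.

Definition fcoef : R[i] := (covolume R S)^-1%:C * 'i ^- N./2 * lip_coef.

Definition thetasum (w : R[i]) (z : 'cV[R[i]]_N) : R[i] := tsum (vtheta S w z).

(** Theta inversion for each m gives the power w^(N/2 - k) = w^-(a+1) with w = t + m; after
    exchanging the sums, the Lipschitz formula applies for each v. *)
Lemma lattice_lipschitz t z : 0 < complex.Im t -> exists l,
  hsum (fun m : int => (t + m%:~R) ^- k * thetasum (t + m%:~R) z) l /\
  hsum (fun p => fcoef * fterm t z p) l.
Proof.
move=> t0; pose c0 : R[i] := (covolume R S)^-1%:C * 'i ^- N./2.
pose F (p : 'cV[int]_N * int) : R[i] := c0 * ((t + p.2%:~R) ^- a.+1 *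
   ee ((dq p.1)%:C * (t + p.2%:~R) + dot (zc R p.1) z)).
have imt (m : int) : complex.Im (t + m%:~R) = complex.Im t by rewrite cImD intrC addr0.
(* The shift 0/1 is used only for the absolute convergence of the powers of t + m. Since Im (t + m)
   = Im t, the double family has a product majorant. *)
have [l0 [h0 _]] := lipschitz_formula t0 (ltn0Sn 0) a_gt0; have [B1 b1] := hsum_bsum h0.
have [B2 b2] := bsum_dual S_sym S_pos z t0.
have bF : bsum (fun p => normc (F p)) (normc c0 * (B2 * B1)).
  have := bsumZ (normc_ge0 c0) (bsum_prod (fun v => normc_ge0 _) (fun m => normc_ge0 _) b2 b1).
  apply: bsum_le => p; rewrite /F (normcM c0) ler_wpM2l ?normc_ge0 // normcM [leRHS]mulrC.
  rewrite mul0r mul0r oppr0 ee0 mulr1 le_eqVlt; apply/orP; left; apply/eqP; congr (_ * _).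
  by rewrite !normc_ee !cImD !Im_realM imt.
have [l hF] := hsum_ex bF; exists l.
have tn (m : int) : t + m%:~R != 0 by apply: contraTneq t0 => h; rewrite -(imt m) h ltxx.
have in0 : ('i : R[i]) != 0 by apply/eqP => /(congr1 (@complex.Im R))/eqP; rewrite /= oner_eq0.
have fE (A B C Z X : R[i]) : A != 0 -> B != 0 -> C != 0 ->
    (A * B)^-1 * (Z * (B / C) * X) = Z / C * (A^-1 * X).
  by move=> A0 B0 C0; field; rewrite A0 B0 C0.
split.
  move/hsum_swap: hF => hF; apply: (hsum_rows hF) => m /=.
  have tm : 0 < complex.Im (t + m%:~R) by rewrite imt.
  have [s [hs1 hs2]] := lattice_theta_inversion S_sym S_pos N_even z tm.
  rewrite /thetasum (hsum_tsum hs1); apply: eq_hsum (hsumZ _ hs2) => v.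
  rewrite /F /= /c0 -!/(dq _); move: (tn m); move: (t + m%:~R) => w wn.
  set X := ee _; rewrite expr_div_n [in w ^- k]kE exprD.
  by apply: fE; exact: expf_neq0.
have rows v : exists r, hsum (fun m => F (v, m)) r /\ hsum (fun n => fcoef * fterm t z (v, n)) r.
  have [r [h1 h2]] := lipschitz_dual v t0; exists (c0 * ee (dot (zc R v) z) * r); split.
    apply: eq_hsum (hsumZ _ h1) => m; rewrite /F /= eeD.
    by set X := ee _; set Y := ee _; ring.
  apply: eq_hsum (hsumZ _ h2) => n; rewrite /fcoef /fterm /= -/c0 eeD.
  by set X := ee _; set Y := ee _; ring.
have [rr hrr] := choice rows.
have hl := hsum_rows hF (fun v => (hrr v).1).
have [B hB] := bsum_fterm z t0.
apply: (@hsum_from_rows _ _ _ _ rr _ (normc fcoef * B)) => // [|v]; last exact: (hrr v).2.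
by apply: bsum_le (bsumZ (normc_ge0 fcoef) hB) => p; rewrite normcM.
Qed.

End LatticeLipschitz.

(** * Sums over bottom rows of SL(2,Z) *)

Section TotalSumReindex.
Variable R : realType.

Lemma tsum_bij (I J : choiceType) (h : J -> I) (f : I -> R[i]) : bijective h ->
  tsum f = tsum (fun j => f (h j)).
Proof.
by move=> bij; rewrite /tsum; congr (xget 0 _); apply/seteqP; split => l /= /(hsum_bij _ _ bij).
Qed.

Lemma eq_tsum (I : choiceType) (f g : I -> R[i]) : (forall i, f i = g i) -> tsum f = tsum g.
Proof. by move=> fg; congr tsum; apply/funext. Qed.

End TotalSumReindex.

Section Residues.
Variables (R : realType) (N : nat).

Definition oint c (x : 'cV['I_c]_N) : 'cV[int]_N := map_mx (fun i : 'I_c => (i : nat)%:Z) x.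

Fact digits_subproof b c (i : 'I_c) (j : 'I_b) : (i + c * j < b * c)%N.
Proof.
apply: (@leq_trans (c + c * j)); first by rewrite ltn_add2r.
by rewrite -mulnS mulnC leq_mul2r ltn_ord orbT.
Qed.

(** Residues modulo bc written uniquely as x + c y. *)
Definition digits b c (p : 'cV['I_c]_N * 'cV['I_b]_N) : 'cV['I_(b * c)]_N :=
  \matrix_(i, j) Ordinal (digits_subproof (p.1 i j) (p.2 i j)).

Lemma digits_bij b c : bijective (@digits b c).
Proof.
apply: inj_card_bij; last by rewrite card_prod !card_mx !card_ord muln1 mulnC expnMn.
move=> [x y] [x' y'] /matrixP h.
have {}h i j : (x i j + c * y i j = x' i j + c * y' i j)%N.
  by have /(congr1 val) := h i j; rewrite !mxE.
have c0 (i : 'I_N) (j : 'I_1) : (0 < c)%N by have := ltn_ord (x i j : 'I_c); lia.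
have hx i j : x i j = x' i j.
  apply: val_inj; have := congr1 (fun n => n %% c)%N (h i j).
  by rewrite /= !(addnC _ (c * _)%N) ![(c * _)%N]mulnC !modnMDl !modn_small.
congr pair; apply/matrixP => i j; first exact: hx.
apply: val_inj; have /eqP := h i j; rewrite hx eqn_add2l eqn_pmul2l ?(c0 i j) //.
by move/eqP.
Qed.

Lemma sum_periodic (f : 'cV[int]_N -> R[i]) b c :
  (forall x y, f (x + c%:Z *: y) = f x) ->
  \sum_(x : 'cV['I_(b * c)]_N) f (oint x) = b%:R ^+ N * \sum_(x : 'cV['I_c]_N) f (oint x).
Proof.
move=> fP; rewrite (reindex (@digits b c)) /=; last exact: onW_bij (digits_bij b c).
rewrite (eq_bigr (fun p : 'cV['I_c]_N * 'cV['I_b]_N => f (oint p.1))); last first.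
  move=> p _; rewrite -(fP (oint p.1) (oint p.2)); congr f; apply/matrixP => i j.
  by rewrite !mxE /= PoszD PoszM.
rewrite -(pair_bigA _ (fun x (y : 'cV['I_b]_N) => f (oint x))) /= mulr_sumr.
have cE : #|{: 'cV['I_b]_N}| = (b ^ N)%N by rewrite card_mx card_ord muln1.
by apply: eq_bigr => x _; rewrite sumr_const cE -natrX mulr_natl.
Qed.

Lemma sum_ord_ee (b : int) M : (0 < M)%N ->
  \sum_(i < M) ee ((i : nat)%:R * (b%:~R / M%:R) : R[i]) = if (M%:Z %| b)%Z then M%:R else 0.
Proof.
move=> M0; rewrite -(@sum_win_ee R b M M0).
have E (i : 'I_M) : ee ((win i)%:~R * b%:~R / M%:R : R[i]) =
   ee (- ((M./2)%:R * (b%:~R / M%:R))) * ee ((i : nat)%:R * (b%:~R / M%:R)).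
  by rewrite -eeD /win rmorphB /= -!pmulrn; congr ee; ring.
rewrite (eq_bigr _ (fun i _ => E i)) -mulr_sumr.
have [/dvdzP[q bq]|nd] := boolP (M%:Z %| b)%Z.
  have -> : b%:~R / M%:R = q%:~R :> R[i].
    by rewrite bq rmorphM /= -pmulrn mulfK // pnatr_eq0 -lt0n.
  have -> : - ((M./2)%:R * q%:~R) = (- ((M./2)%:Z * q))%:~R :> R[i].
    by rewrite rmorphN rmorphM /= -pmulrn.
  by rewrite ee_int mul1r.
have := @sum_win_ee R b M M0; rewrite (negbTE nd) (eq_bigr _ (fun i _ => E i)) -mulr_sumr => h.
by rewrite h; move/eqP: h; rewrite mulf_eq0 (negbTE (ee_neq0 _)) /= => /eqP.
Qed.

(** As a inverts d modulo c, x is recovered as the residue of a u, and then y by division by c. *)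
Lemma coprime_residues_bij c (d a b : int) : (0 < c)%N -> a * d - b * c%:Z = 1 ->
  bijective (fun p : 'cV['I_c]_N * 'cV[int]_N => d *: oint p.1 + c%:Z *: p.2).
Proof.
move=> c0 ab; have cz : c%:Z != 0 by rewrite -lt0n.
pose res (u : int) : nat := `|(a * u) %% c%:Z|%Z%N.
have resE u : (res u)%:Z = ((a * u) %% c%:Z)%Z by rewrite /res gez0_abs // modz_ge0.
have resP u : (res u < c)%N by rewrite -ltz_nat resE ltz_pmod.
pose X (u : 'cV[int]_N) : 'cV['I_c]_N := \matrix_(i, j) Ordinal (resP (u i j)).
pose Y (u : 'cV[int]_N) : 'cV[int]_N := \matrix_(i, j) ((u i j - d * (res (u i j))%:Z) %/ c%:Z)%Z.
have resK (x y : int) : 0 <= x -> x < c%:Z -> ((a * (d * x + c%:Z * y)) %% c%:Z)%Z = x.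
  move=> x0 xc.
  have -> : a * (d * x + c%:Z * y) = (b * x + a * y) * c%:Z + x.
    have -> : a * (d * x + c%:Z * y) = (a * d) * x + a * y * c%:Z by ring.
    have -> : a * d = 1 + b * c%:Z by rewrite -ab subrK.
    by ring.
  by rewrite modzMDl modz_small // x0.
exists (fun u => (X u, Y u)) => [[x y]|u].
  have E i j : (res ((d *: oint x + c%:Z *: y) i j))%:Z = (x i j : nat)%:Z.
    have xc : (x i j : nat)%:Z < c%:Z by rewrite ltz_nat.
    by rewrite resE !mxE resK.
  congr pair; apply/matrixP => i j; first by apply: val_inj; rewrite mxE /=; apply/eqP; rewrite -eqz_nat E.
  by rewrite [LHS]mxE E !mxE addrAC subrr add0r mulrC mulzK.
apply/matrixP => i j; rewrite !mxE /=; set v := u i j; rewrite resE.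
suff /dvdzP[q e] : (c%:Z %| v - d * ((a * v) %% c%:Z)%Z)%Z.
  by rewrite e mulzK // [c%:Z * q]mulrC -e addrC subrK.
have -> : ((a * v) %% c%:Z)%Z = a * v - (a * v %/ c%:Z)%Z * c%:Z.
  by apply/eqP; rewrite eq_sym subr_eq addrC -divz_eq.
have -> : v - d * (a * v - (a * v %/ c%:Z)%Z * c%:Z) = (d * (a * v %/ c%:Z)%Z - b * v) * c%:Z.
  move: (a * v %/ c%:Z)%Z => w.
  have -> : v - d * (a * v - w * c%:Z) = v * (1 - a * d) + d * w * c%:Z by ring.
  by rewrite -ab; ring.
exact: dvdz_mull.
Qed.

End Residues.

(** * Finite theta sums attached to pairs (c, d) *)

Section EisensteinSums.
Variables (R : realType) (N : nat) (S : 'M[int]_N) (k : nat).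
Hypotheses (S_sym : S^T = S) (S_even : forall i, (2 %| S i i)%Z) (S_pos : pos_def R S)
  (N_even : ~~ odd N) (k_gt : (2 + N < k)%N).
Variables (t : R[i]) (z : 'cV[R[i]]_N).
Hypothesis t0 : 0 < complex.Im t.

Local Notation q := (halfq S).
Local Notation thsum := (thetasum S).

Lemma thetasum_shift w (z' : 'cV[R[i]]_N) y : thsum w (z' + zc R y) = thsum w z'.
Proof.
have bij : bijective (fun x : 'cV[int]_N => x + y).
  by exists (fun x => x - y) => x; rewrite ?addrK ?subrK.
rewrite /thetasum (tsum_bij _ bij); apply: eq_tsum => x.
have zcD : zc R (x + y) = zc R x + zc R y by exact: map_mxD.
by rewrite /vtheta zcD opprD addrACA subrr addr0.
Qed.

Lemma cocycle_neq0 (c : nat) (d : int) : (0 < c)%N -> c%:R * t + d%:~R != 0.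
Proof.
move=> c0; apply/eqP => /(congr1 (@complex.Im R)); rewrite cImD natrC intrC Im_realM addr0 => /eqP.
by rewrite mulf_eq0 pnatr_eq0 -leqn0 leqNgt c0 gt_eqF.
Qed.

Definition gterm (c : nat) (d : int) (x : 'cV[int]_N) : R[i] :=
  ee (d%:~R * ((q x)%:~R / c%:R)) *
  thsum ((c%:R * t + d%:~R) / c%:R) (z - (d%:~R / c%:R) *: zc R x).

Definition wterm (c : nat) (d : int) : R[i] :=
  (c%:R * t + d%:~R) ^- k * \sum_(x : 'cV['I_c]_N) gterm c d (oint x).

(** The phase changes by e of an integer, because (y, y)/2 is integral, and the argument of the
    theta series moves by a lattice vector. *)
Lemma gterm_periodic c d x y : (0 < c)%N -> gterm c d (x + c%:Z *: y) = gterm c d x.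
Proof.
move=> c0; have cn : (c%:R : R[i]) != 0 by rewrite pnatr_eq0 -lt0n.
have h1 : ee (d%:~R * ((q (x + c%:Z *: y))%:~R / c%:R)) = ee (d%:~R * ((q x)%:~R / c%:R)) :> R[i].
  rewrite halfqD // halfqZ formZr.
  have -> : d%:~R * ((q x + c%:Z * Defs.form S x y + c%:Z ^+ 2 * q y)%:~R / c%:R) =
    d%:~R * ((q x)%:~R / c%:R) + (d * (Defs.form S x y + c%:Z * q y))%:~R :> R[i].
    by rewrite !(rmorphD, rmorphM, rmorphXn) /= -!pmulrn; field.
  by rewrite eeDint.
have h2 : z - (d%:~R / c%:R) *: zc R (x + c%:Z *: y) =
   z - (d%:~R / c%:R) *: zc R x + zc R (- (d *: y)).
  apply/matrixP => i j; rewrite !mxE !(rmorphD, rmorphM, rmorphN) /= -!pmulrn; by field.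
by rewrite /gterm h1 h2 thetasum_shift.
Qed.

Lemma gterm_scale b c d x : (0 < b)%N -> (0 < c)%N ->
  gterm (b * c) (b%:Z * d) x = gterm c d x.
Proof.
move=> b0 c0; have cn : (c%:R : R[i]) != 0 by rewrite pnatr_eq0 -lt0n.
have bn : (b%:R : R[i]) != 0 by rewrite pnatr_eq0 -lt0n.
rewrite /gterm natrM rmorphM /= -pmulrn.
have -> : b%:R * d%:~R * ((q x)%:~R / (b%:R * c%:R)) = d%:~R * ((q x)%:~R / c%:R) :> R[i].
  by field; rewrite bn cn.
have -> : (b%:R * c%:R * t + b%:R * d%:~R) / (b%:R * c%:R) = (c%:R * t + d%:~R) / c%:R :> R[i].
  by field; rewrite bn cn.
by have -> : b%:R * d%:~R / (b%:R * c%:R) = d%:~R / c%:R :> R[i] by field; rewrite bn cn.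
Qed.

(* Non-coprime pairs (c, d) only contribute the factor zeta (k - N), so that the sum over
   coprime pairs can be completed without Moebius inversion. *)
Lemma wterm_scale b c d : (0 < b)%N -> (0 < c)%N ->
  wterm (b * c) (b%:Z * d) = b%:R ^- (k - N) * wterm c d.
Proof.
move=> b0 c0; rewrite /wterm (eq_bigr (fun x => gterm c d (oint x))); last first.
  by move=> x _; rewrite gterm_scale.
rewrite (@sum_periodic _ _ (gterm c d)); last by move=> x y; exact: gterm_periodic.
have bn : (b%:R : R[i]) != 0 by rewrite pnatr_eq0 -lt0n.
have -> : (b * c)%:R * t + (b%:Z * d)%:~R = b%:R * (c%:R * t + d%:~R).
  by rewrite natrM rmorphM /= -pmulrn; ring.
have kN : (N <= k)%N by lia.
rewrite exprMn; have -> : b%:R ^+ k = b%:R ^+ (k - N) * b%:R ^+ N :> R[i] by rewrite -exprD subnK.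
have fE (A B J s : R[i]) : B != 0 -> (A * B * J)^-1 * (B * s) = A^-1 * (J^-1 * s).
  by move=> B0; rewrite !invfM; transitivity (B^-1 * B * (A^-1 * (J^-1 * s))); [ring|rewrite mulVf ?mul1r].
by apply: fE; exact: expf_neq0.
Qed.

(** The Eisenstein term rewritten with (a t + b)/(c t + d) = a/c - 1/(c (c t + d)), which completes
    the square in u. *)
Definition eterm (a : int) (c : nat) (d : int) (u : 'cV[int]_N) : R[i] :=
  ee (a%:~R * ((q u)%:~R / c%:R)) * ((c%:R * t + d%:~R) ^- k *
  cexp (- (ipi R * (Defs.form S (zc R u - c%:R *: z) (zc R u - c%:R *: z) /
     (c%:R * (c%:R * t + d%:~R)))))).

Lemma im_cocycle (c : nat) (d : int) : (0 < c)%N -> complex.Im ((c%:R * t + d%:~R) / c%:R) = complex.Im t.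
Proof.
move=> c0; have cn : (c%:R : R[i]) != 0 by rewrite pnatr_eq0 -lt0n.
have -> : (c%:R * t + d%:~R) / c%:R = t + (d%:~R / c%:R : R)%:C.
  by rewrite realcM realcV -natrC -intrC; field.
by rewrite cImD addr0.
Qed.

Lemma hsum_eterm (a b : int) c d : (0 < c)%N -> a * d - b * c%:Z = 1 ->
  hsum (eterm a c d) (wterm c d).
Proof.
move=> c0 ab; have cn : (c%:R : R[i]) != 0 by rewrite pnatr_eq0 -lt0n.
have jn := cocycle_neq0 d c0.
have bij := coprime_residues_bij N c0 ab.
apply/(hsum_bij _ _ bij).
rewrite /wterm mulr_sumr; apply: hsum_fin_rows => x /=; rewrite /gterm mulrCA.
have w0 : 0 < complex.Im ((c%:R * t + d%:~R) / c%:R) by rewrite im_cocycle.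
have [s [hs _]] := lattice_theta_inversion S_sym S_pos N_even (z - (d%:~R / c%:R) *: zc R (oint x)) w0.
rewrite /thetasum (hsum_tsum hs) mulrA.
apply: eq_hsum (hsumZ _ hs) => y; rewrite /eterm -mulrA; congr (_ * (_ * _)).
  rewrite halfqD // !halfqZ !(formZl, formZr).
  (* Since a d = 1 + b c, the phase a q(u)/c equals d q(x)/c up to an integer; a and y disappear
     from it. *)
  have -> : a%:~R * ((d ^+ 2 * q (oint x) + d * (c%:Z * Defs.form S (oint x) y) + c%:Z ^+ 2 * q y)%:~R / c%:R)
    = d%:~R * ((q (oint x))%:~R / c%:R) +
      (b * d * q (oint x) + a * (d * Defs.form S (oint x) y + c%:Z * q y))%:~R :> R[i].
    have : a%:~R * d%:~R = 1 + b%:~R * c%:R :> R[i].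
      by rewrite -rmorphM /= -[a * d](subrK (b * c%:Z)) ab rmorphD rmorphM /= -!pmulrn.
    rewrite !(rmorphD, rmorphM, rmorphXn) /= -!pmulrn => adE.
    transitivity ((a%:~R * d%:~R) * (d%:~R * (q (oint x))%:~R / c%:R) +
       a%:~R * (d%:~R * (Defs.form S (oint x) y)%:~R + c%:R * (q y)%:~R) : R[i]); first by field.
    by rewrite adE; field.
  by rewrite eeDint.
rewrite /vtheta; congr (cexp (- (_ * _))).
set Y := zc R y - _.
have -> : zc R (d *: oint x + c%:Z *: y) - c%:R *: z = c%:R *: Y.
  rewrite /Y; apply/matrixP => i j; rewrite !mxE !(rmorphD, rmorphM) /= -!pmulrn; by field.
by rewrite formZl formZr; field; rewrite cn jn.
Qed.

End EisensteinSums.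

Section RealSeries.
Variable R : realType.

Lemma hsum_series (b : nat -> R) (l : R[i]) : hsum (fun i => (b i)%:C) l ->
  limn (series b) = complex.Re l.
Proof.
move=> [_ h]; apply/cvg_lim; first exact: Rhausdorff.
apply/cvgrPdist_le => e e0; have [A HA] := h e e0.
exists (\max_(i <- A) i).+1 => // n /= An.
have := HA (index_iota 0 n) (iota_uniq _ _); rewrite -rmorph_sum /=.
have sub : {subset A <= index_iota 0 n}.
  by move=> i iA; rewrite mem_index_iota /=; apply: leq_trans An; rewrite ltnS; exact: leq_bigmax_seq.
move=> /(_ sub); apply: le_trans; apply: le_trans (Re_le_normc _).
by rewrite cReD cReN.
Qed.

Lemma hsum_zeta (m : nat) : (2 <= m)%N ->
  hsum (fun i : nat => (i.+1%:R ^- m : R[i])) (zeta (m%:R : R))%:C /\ 1 <= zeta (m%:R : R).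
Proof.
move=> m2; pose b (i : nat) : R := i.+1%:R ^- m.
have b0 i : 0 <= b i by rewrite invr_ge0 exprn_ge0.
have bb : bsum b (2 / 1).
  apply: bsum_le (bsum_inv_sqr (lexx 1)) => i; rewrite /b nat1r.
  rewrite lef_pV2 ?posrE ?exprn_gt0 ?ltr0n // ler_weXn2l // ler1n //.
have [l hl] := hsum_ex_ge0 b0 bb.
have zE : zeta (m%:R : R) = l.
  rewrite -[RHS]/(complex.Re l%:C) -(hsum_series hl) /zeta; congr (limn (series _)).
  by apply/funext => i; rewrite /riemannR powR_mulrn.
rewrite zE; split.
  by apply: eq_hsum hl => i; rewrite /b realcV realcX natrC.
have := hsum_real_ge (s := [:: 0%N]) b0 hl isT.
by rewrite big_seq1 /b expr1n invr1.
Qed.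

Lemma Im_inv (x : R[i]) : x != 0 -> complex.Im x^-1 = - (complex.Im x / normc x ^+ 2).
Proof.
move=> x0; have n0 : normc x ^+ 2 != 0 by rewrite expf_neq0 // normc_eq0.
apply: (mulIf n0); rewrite mulNr divfK // normc_sqr.
have := mulfV x0; move: (x^-1) => [p q] h.
have h1 := congr1 (@complex.Re R) h; have h2 := congr1 (@complex.Im R) h.
rewrite cReM cImM /= in h1 h2; move: (complex.Re x) (complex.Im x) h1 h2 => a b h1 h2 /=.
apply/eqP; rewrite -subr_eq0 opprK; apply/eqP.
transitivity (a * (a * q + b * p) - b * (a * p - b * q - 1)); first by ring.
by rewrite h1 h2 subrr !mulr0 subrr.
Qed.

End RealSeries.

(** * Absolute convergence of the Eisenstein series *)

Section EisensteinBound.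
Variables (R : realType) (N : nat) (S : 'M[int]_N) (k : nat).
Hypotheses (S_sym : S^T = S) (S_pos : pos_def R S) (k_gt : (2 + N < k)%N).
Variables (t : R[i]) (z : 'cV[R[i]]_N).
Hypothesis t0 : 0 < complex.Im t.

Let k3 : (3 <= k - N)%N. Proof. by lia. Qed.
Let kN : (N <= k)%N. Proof. by lia. Qed.

Definition ecoef (c : nat) (d : int) (u : 'cV[int]_N) : R[i] := (c%:R * t + d%:~R) ^- k *
  cexp (- (ipi R * (form S (zc R u - c%:R *: z) (zc R u - c%:R *: z) /
     (c%:R * (c%:R * t + d%:~R))))).

Lemma Im_cocycle c d : complex.Im (c%:R * t + d%:~R) = c%:R * complex.Im t.
Proof. by rewrite cImD natrC intrC Im_realM addr0. Qed.

(** Here c Im t is the imaginary part of c t + d, and |d| <= |c t + d| + c |t|. *)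
Lemma cocycle_lower : exists2 de : R, 0 < de & forall (c : nat) (d : int),
  de * (c%:R + `|d|%:R) <= normc (c%:R * t + d%:~R).
Proof.
have v0 := t0; set v := complex.Im t in v0 *; pose E := v^-1 + 1 + normc t / v.
have i0 : 0 < v^-1 by rewrite invr_gt0.
have n0 : 0 <= normc t / v by rewrite divr_ge0 ?normc_ge0 // ltW.
have E0 : 0 < E by rewrite /E; lra.
exists E^-1 => [|c d]; first by rewrite invr_gt0.
rewrite mulrC ler_pdivrMr //; set j := c%:R * t + d%:~R.
have cv : c%:R * v <= normc j.
  by rewrite -(Im_cocycle c d); apply: (le_trans (ler_norm _)); exact: Im_le_normc.
have cj : c%:R <= normc j / v by rewrite ler_pdivlMr.
have dj : `|d|%:R <= normc j + c%:R * normc t.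
  have -> : `|d|%:R = normc (d%:~R : R[i]) by rewrite intrC normc_real abs_intr.
  have -> : d%:~R = j - c%:R * t by rewrite /j addrC addKr.
  by apply: (le_trans (normcB _ _)); rewrite normcM normc_nat.
apply: (@le_trans _ _ (normc j / v + (normc j + normc j / v * normc t))).
  apply: lerD => //; apply: (le_trans dj); rewrite lerD2l ler_wpM2r ?normc_ge0 //.
by rewrite /E le_eqVlt; apply/orP; left; apply/eqP; ring.
Qed.

Lemma normc_dot (u : 'cV[int]_N) (y : 'cV[R[i]]_N) :
  normc (dot (zc R u) y) <= (\sum_i normc (y i 0)) * \sum_i `|(u i 0)%:~R : R|.
Proof.
apply: (le_trans (normc_sum _ _ _)); rewrite mulr_sumr; apply: ler_sum => i _.
rewrite normcM !mxE intrC normc_real mulrC ler_wpM2r // (bigD1 i) //= lerDl.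
by apply: sumr_ge0 => j _; exact: normc_ge0.
Qed.

(** Because Im (1/j) = -c Im t/|j|^2, the factor c cancels: the term is a Gaussian in u/|j| whose
    constants do not depend on (c, d). *)
Lemma ecoef_exponent : exists A C K0 : R, 0 < A /\ forall (c : nat) (d : int) (u : 'cV[int]_N), (0 < c)%N ->
  complex.Re (- (ipi R * (form S (zc R u - c%:R *: z) (zc R u - c%:R *: z) /
     (c%:R * (c%:R * t + d%:~R))))) <=
  K0 + \sum_i (- (A * ((u i 0)%:~R / normc (c%:R * t + d%:~R)) ^+ 2) +
     C * `|(u i 0)%:~R / normc (c%:R * t + d%:~R)|).
Proof.
have [Qd [_ _ [lam l0 hl] _ _]] := gram_forms S_sym S_pos; have p0 := pi_gt0 R.
pose y := map_mx intr S *m z; pose Z : R := \sum_i normc (y i 0).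
exists (pi * complex.Im t * lam), (2 * pi * Z), (pi * (normc (form S z z) / complex.Im t)).
split=> [|c d u c0]; first by rewrite !mulr_gt0.
have cn : (c%:R : R[i]) != 0 by rewrite pnatr_eq0 -lt0n.
have cR : (c%:R : R) != 0 by rewrite pnatr_eq0 -lt0n.
have jn := cocycle_neq0 t0 d c0; set j := c%:R * t + d%:~R in jn *.
have n0 : 0 < normc j by rewrite normc_gt0.
have [r hr lr] := hl (zr R u); rewrite -zc_rc in hr.
have reI (X : R[i]) : complex.Re (- (ipi R * X)) = pi * complex.Im X.
  by rewrite /ipi cReN !cReM cImM /=; ring.
have -> : form S (zc R u - c%:R *: z) (zc R u - c%:R *: z) / (c%:R * j) =
   (r / c%:R)%:C * j^-1 - 2 * (dot (zc R u) y / j) + c%:R * form S z z / j.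
  rewrite !formLE hr (formC S_sym z) (formE _ (zc R u) z) -/y realcM realcV -natrC.
  by field; rewrite cn jn.
rewrite reI cImD (cImD (_%:C * _)) cImN Im_realM.
have -> : complex.Im (2 * (dot (zc R u) y / j)) = 2 * complex.Im (dot (zc R u) y / j).
  by rewrite natrC Im_realM.
have e1 : r / c%:R * complex.Im j^-1 <= - (complex.Im t * lam * \sum_i ((u i 0)%:~R / normc j) ^+ 2).
  rewrite Im_inv // Im_cocycle mulrN lerN2.
  have -> : r / c%:R * (c%:R * complex.Im t / normc j ^+ 2) = complex.Im t * r / normc j ^+ 2.
    by field; rewrite cR gt_eqF.
  have -> : \sum_i ((u i 0)%:~R / normc j) ^+ 2 = dot (zr R u) (zr R u) / normc j ^+ 2.
    by rewrite /dot mulr_suml; apply: eq_bigr => i _; rewrite !mxE expr_div_n expr2.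
  by rewrite mulrA -[complex.Im t * lam * _]mulrA ler_pM2r ?invr_gt0 ?exprn_gt0 // ler_pM2l.
have e2 : - (2 * complex.Im (dot (zc R u) y / j)) <= 2 * Z * \sum_i `|(u i 0)%:~R / normc j|.
  apply: (@le_trans _ _ (2 * normc (dot (zc R u) y / j))).
    rewrite -mulrN ler_pM2l //; apply: (le_trans (ler_norm _)); rewrite normrN; exact: Im_le_normc.
  rewrite -mulrA ler_pM2l // normcM normcV //.
  have -> : \sum_i `|(u i 0)%:~R / normc j| = (\sum_i `|(u i 0)%:~R|) / normc j.
    rewrite mulr_suml; apply: eq_bigr => i _; rewrite normrM normfV (gtr0_norm n0); exact: erefl.
  by rewrite mulrA ler_pM2r ?invr_gt0 //; exact: normc_dot.
have e3 : complex.Im (c%:R * form S z z / j) <= normc (form S z z) / complex.Im t.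
  apply: (le_trans (ler_norm _)); apply: (le_trans (Im_le_normc _)).
  have -> : normc (c%:R * form S z z / j) = c%:R * normc (form S z z) / normc j.
    by rewrite normcM normcV (normcM c%:R) normc_nat.
  have cv : c%:R * complex.Im t <= normc j.
    by rewrite -(Im_cocycle c d); apply: (le_trans (ler_norm _)); exact: Im_le_normc.
  rewrite ler_pdivrMr // [leRHS]mulrAC ler_pdivlMr // [leLHS]mulrAC [leRHS]mulrC.
  by rewrite ler_wpM2r ?normc_ge0.
apply: (@le_trans _ _ (pi * (- (complex.Im t * lam * \sum_i ((u i 0)%:~R / normc j) ^+ 2) +
   2 * Z * \sum_i `|(u i 0)%:~R / normc j| + normc (form S z z) / complex.Im t))).
  by rewrite ler_pM2l // !lerD.
rewrite big_split /= sumrN -!mulr_sumr le_eqVlt; apply/orP; left; apply/eqP; ring.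
Qed.

(** The Gaussian sum over u is O(|j|^N), which leaves |j|^(N - k). With k - N >= 3 this is summable
    over pairs; the first index stores c - 1. *)
Lemma bsum_ecoef : exists B, bsum (fun p : (nat * int) * 'cV[int]_N =>
  normc (ecoef p.1.1.+1 p.1.2 p.2)) B.
Proof.
have [A [C [K0 [A0 hE]]]] := ecoef_exponent; have [de de0 hde] := cocycle_lower.
have A'0 : 0 < A / de ^+ 2 by rewrite divr_gt0 // exprn_gt0.
have [K Kp HK] := gauss_bound1 (C / de) A'0.
pose KK := expR K0 * (K * 8) ^+ N / de ^+ k.
have KK0 : 0 <= KK by rewrite !mulr_ge0 ?expR_ge0 ?exprn_ge0 ?invr_ge0 ?mulr_ge0 ?exprn_ge0 // ltW.
exists (KK * 16).
have inj : injective (fun p : nat * int => (p.1%:Z, p.2)) by move=> [a b] [c d] [-> ->].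
apply: (@bsum_pair _ _ _ (fun p u => normc (ecoef p.1.+1 p.2 u))
   (fun p : nat * int => KK * (1 + `|p.1%:Z|%:R + `|p.2|%:R) ^- 3)) => [p u|[c d]|].
- exact: normc_ge0.
- set j := c.+1%:R * t + d%:~R; set r : R := 1 + _ + _.
  have rE : r = c.+1%:R + `|d|%:R by rewrite /r /= nat1r.
  (* Dividing by [de] makes M >= 1, as [bsum_cauchy] requires; the constant K was prepared for the
     rescaled variable u/M. *)
  pose M := normc j / de.
  have Mr : r <= M by rewrite ler_pdivlMr // mulrC rE; exact: hde.
  have r1 : 1 <= r by rewrite /r -addrA lerDl addr_ge0.
  have M1 : 1 <= M by exact: le_trans Mr.
  have M0 : 0 < M by exact: lt_le_trans M1.
  have jE : normc j = de * M by rewrite /M mulrC divfK // gt_eqF.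
  pose g (x : int) : R := K * (1 + (x%:~R / M) ^+ 2)^-1.
  have g0 x : 0 <= g x by rewrite mulr_ge0 ?(ltW Kp) // invr_ge0 addr_ge0 // sqr_ge0.
  have bg := bsum_vec (N := N) g0 (bsumZ (ltW Kp) (bsum_cauchy M1)).
  have j0 : 0 <= (normc j ^+ k)^-1 * expR K0 by rewrite mulr_ge0 ?expR_ge0 // invr_ge0 exprn_ge0 // normc_ge0.
  have := bsumZ j0 bg.
  have B' : (normc j ^+ k)^-1 * expR K0 * (K * (8 * M)) ^+ N <= KK * r ^- 3.
    rewrite jE exprMn invfM /KK.
    have kE : M ^+ k = M ^+ (k - N) * M ^+ N by rewrite -exprD subnK.
    rewrite mulrA [(K * 8 * M) ^+ N]exprMn kE.
    have MN : M ^+ N != 0 by rewrite expf_neq0 // gt_eqF.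
    have -> : de ^- k / (M ^+ (k - N) * M ^+ N) * expR K0 * ((K * 8) ^+ N * M ^+ N) =
       expR K0 * (K * 8) ^+ N / de ^+ k * M ^- (k - N).
      rewrite invfM; transitivity (expR K0 * (K * 8) ^+ N / de ^+ k * M ^- (k - N) * (M ^- N * M ^+ N)); first by ring.
      by rewrite mulVf // mulr1.
    rewrite -/KK ler_wpM2l // lef_pV2 ?posrE ?exprn_gt0 // ?(lt_le_trans ltr01 r1) //.
    apply: (@le_trans _ _ (M ^+ 3)); first by rewrite lerXn2r ?nnegrE // ?(le_trans ler01 r1) // ltW.
    exact: (ler_weXn2l M1 k3).
  move=> h; apply: bsum_leB B' _; apply: bsum_le h => u.
  rewrite -[ecoef _ _ _]/(ecoef c.+1 d u) /ecoef -/j normcM normcV normcX normc_cexp -[leRHS]mulrA ler_wpM2l ?invr_ge0 ?exprn_ge0 ?normc_ge0 //.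
  apply: le_trans (_ : expR (K0 + _) <= _); first by rewrite ler_expR; exact: hE.
  rewrite expRD ler_pM2l ?expR_gt0 // expR_sum; apply: ler_prod => i _; rewrite expR_ge0 /= /g.
  apply: le_trans (HK _); rewrite ler_expR -/j jE.
  have dn : de != 0 by rewrite gt_eqF.
  have -> : (u i 0)%:~R / (de * M) = (u i 0)%:~R / M / de by rewrite invfM; ring.
  rewrite expr_div_n normrM normfV (gtr0_norm de0) le_eqVlt; apply/orP; left; apply/eqP; ring.
- have := bsumZ KK0 (bsum_inj inj (bsum_int2_inv_cube R)).
  exact.
Qed.

End EisensteinBound.

Section CoprimePairs.

(** Storing c - 1 forces c >= 1, which selects one representative of each pair of opposite bottom
    rows. *)
Definition coprime_pair : Type := {p : nat * int | coprimez p.1.+1%:Z p.2}.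
HB.instance Definition _ := Choice.on coprime_pair.

Definition bezout (p : nat * int) : int * int :=
  xget (0, 0) [set ab | ab.1 * p.2 - ab.2 * p.1.+1%:Z = 1].

Lemma bezoutP (p : coprime_pair) :
  (bezout (val p)).1 * (val p).2 - (bezout (val p)).2 * (val p).1.+1%:Z = 1.
Proof.
have /coprimezP[[u v] /= e] := valP p.
apply: (@xgetPex _ (0, 0) [set ab | ab.1 * (val p).2 - ab.2 * (val p).1.+1%:Z = 1]).
by exists (v, - u) => /=; rewrite mulNr opprK addrC.
Qed.

Definition multiple_pair (q : nat * coprime_pair) : nat * int :=
  ((q.1.+1 * (val q.2).1.+1).-1, q.1.+1%:Z * (val q.2).2).

(** The multiplier is recovered as the gcd of the two entries. *)
Lemma multiple_pair_inj : injective multiple_pair.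
Proof.
move=> [b [[c d] cop]] [b' [[c' d'] cop']] [] /= e1 e2.
have gE (n m : nat) (e : int) : coprimez m.+1%:Z e -> gcdz (n.+1%:Z * m.+1%:Z) (n.+1%:Z * e) = n.+1%:Z.
  by rewrite /coprimez => /eqP ce; rewrite -mulz_gcdr ?ce ?mulr1.
have e1' : b.+1%:Z * c.+1%:Z = b'.+1%:Z * c'.+1%:Z.
  by rewrite -!PoszM; congr Posz; lia.
have /eqP : b.+1%:Z = b'.+1%:Z by rewrite -(gE b c d cop) -(gE b' c' d' cop') e1' e2.
rewrite eqz_nat eqSS => /eqP be; subst b'; congr pair; apply: val_inj => /=.
have bn : b.+1%:Z != 0 by [].
move/(mulfI bn): e1' => /eqP; rewrite eqz_nat eqSS => /eqP ->.
by move/(mulfI bn): e2 => ->.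
Qed.

Lemma multiple_pair_surj p : exists q, multiple_pair q = p.
Proof.
case: p => c d; pose g := gcdz c.+1%:Z d.
have g0 : 0 < g by rewrite /g /gcdz ltz_nat gcdn_gt0.
have /dvdzP[c' cE] : (g %| c.+1%:Z)%Z by exact: dvdz_gcdl.
have /dvdzP[d' dE] : (g %| d)%Z by exact: dvdz_gcdr.
have c'0 : 0 < c' by rewrite -(pmulr_lgt0 _ g0) -cE.
have cop : coprimez c' d'.
  have gn : g != 0 by rewrite gt_eqF.
  rewrite /coprimez; apply/eqP; apply: (mulfI gn).
  have := mulz_gcdr g c' d'; rewrite gez0_abs ?(ltW g0) // mulr1 => ->.
  by rewrite ![g * _]mulrC -cE -dE.
have c'E : c' = (`|c'|.-1).+1%:Z by lia.
have copE : coprimez (`|c'|.-1).+1%:Z d' by rewrite -c'E.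
exists ((`|g|.-1)%N, exist _ ((`|c'|.-1)%N, d') copE); rewrite /multiple_pair /=.
have gE : (`|g|.-1).+1%:Z = g by lia.
congr pair; last by rewrite gE dE mulrC.
have : ((`|g|.-1).+1 * (`|c'|.-1).+1)%N%:Z = c.+1%:Z by rewrite PoszM gE -c'E cE mulrC.
by move=> [->].
Qed.

End CoprimePairs.

(** * Fourier expansion of the terms with c >= 1 *)

Section EisensteinFourier.
Variables (R : realType) (N : nat) (S : 'M[int]_N) (k : nat).
Hypotheses (S_sym : S^T = S) (S_even : forall i, (2 %| S i i)%Z) (S_pos : pos_def R S)
  (N_even : ~~ odd N) (k_gt : (2 + N < k)%N).
Variables (t : R[i]) (z : 'cV[R[i]]_N).
Hypothesis t0 : 0 < complex.Im t.

Local Notation etm := (eterm S k t z).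
Local Notation wtm := (wterm S k t z).
Local Notation zt := (zeta ((k - N)%:R : R)).

Definition cop_term (q : coprime_pair * 'cV[int]_N) : R[i] :=
  etm (bezout (val q.1)).1 (val q.1).1.+1 (val q.1).2 q.2.

Lemma normc_eterm a c d u : normc (etm a c d u) = normc (ecoef S k t z c d u).
Proof.
rewrite /eterm normcM.
have -> : a%:~R * ((halfq S u)%:~R / c%:R) = (a%:~R * ((halfq S u)%:~R / c%:R) : R)%:C.
  by rewrite !realcM realcV -natrC -!intrC.
by rewrite normc_ee_real mul1r.
Qed.

Lemma hsum_cop : exists P, hsum cop_term P /\
  hsum (fun p : coprime_pair => wtm (val p).1.+1 (val p).2) P.
Proof.
have [B hB] := bsum_ecoef S_sym S_pos k_gt z t0.
have inj : injective (fun q : coprime_pair * 'cV[int]_N => (val q.1, q.2)).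
  by move=> [p u] [p' u'] /= [] e1 ->; congr pair; apply: val_inj.
have bc : bsum (fun q => normc (cop_term q)) B.
  by apply: bsum_le (bsum_inj inj hB) => q; rewrite /cop_term normc_eterm.
have [P hP] := hsum_ex bc; exists P; split => //.
apply: (hsum_rows hP) => p.
have := @hsum_eterm R N S k S_sym S_even S_pos N_even t z t0 (bezout (val p)).1 (bezout (val p)).2
  (val p).1.+1 (val p).2 (ltn0Sn _) (bezoutP p).
exact.
Qed.

Lemma hsum_wterm P : hsum (fun p : coprime_pair => wtm (val p).1.+1 (val p).2) P ->
  hsum (fun q : nat * int => wtm q.1.+1 q.2) (zt%:C * P).
Proof.
move=> hP; have m2 : (2 <= k - N)%N by lia.
have [hz _] := hsum_zeta R m2.
apply/(hsum_reindex _ multiple_pair_inj).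
  by move=> p h; have [q /h] := multiple_pair_surj p.
apply: eq_hsum (hsum_mul hz hP) => -[b p] /=.
by rewrite -wterm_scale.
Qed.

Definition rescount (c : nat) (v : 'cV[int]_N) (n : nat) : nat :=
  #|[pred x : 'cV['I_c]_N | (c%:Z %| halfq S (oint x) - dot v (oint x) + n%:Z)%Z]|.

Local Notation ftm := (fterm S k).
Local Notation fcf := (fcoef R S k).

Lemma fterm_shift c (d : nat) (x : 'cV[int]_N) p : (0 < c)%N ->
  ftm (t + d%:R / c%:R) (z - (d%:R / c%:R) *: zc R x) p =
  ftm t z p * ee (d%:R * ((p.2%:Z - dot p.1 x)%:~R / c%:R)).
Proof.
move=> c0; have cn : (c%:R : R[i]) != 0 by rewrite pnatr_eq0 -lt0n.
rewrite /fterm -mulrA -eeD; congr (_ * ee _).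
rewrite dotDr dotNr dotZr (dot_map (intr : {rmorphism int -> R[i]})) rmorphB /= -pmulrn; by field.
Qed.

Lemma wterm_row c (d : nat) (m : int) : (0 < c)%N ->
  wtm c (m * c%:Z + d%:Z) = \sum_(x : 'cV['I_c]_N) c%:R ^- k *
   ee (d%:R * ((halfq S (oint x))%:~R / c%:R)) *
   ((t + d%:R / c%:R + m%:~R) ^- k * thetasum S (t + d%:R / c%:R + m%:~R)
       (z - (d%:R / c%:R) *: zc R (oint x))).
Proof.
move=> c0; have cn : (c%:R : R[i]) != 0 by rewrite pnatr_eq0 -lt0n.
have [w wE] : exists w, w = t + d%:R / c%:R + m%:~R by eexists.
rewrite -wE; have jE : c%:R * t + (m * c%:Z + d%:Z)%:~R = c%:R * w.
  by rewrite wE rmorphD rmorphM /= -!pmulrn; field.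
have jc : (c%:R * t + (m * c%:Z + d%:Z)%:~R) / c%:R = w by rewrite jE mulrAC divff ?mul1r.
have gE x : gterm S t z c (m * c%:Z + d%:Z) x =
    ee (d%:R * ((halfq S x)%:~R / c%:R)) * thetasum S w (z - (d%:R / c%:R) *: zc R x).
  rewrite /gterm jc.
  have -> : ee ((m * c%:Z + d%:Z)%:~R * ((halfq S x)%:~R / c%:R)) =
     ee (d%:R * ((halfq S x)%:~R / c%:R)) :> R[i].
    rewrite -[RHS](eeDint _ (m * halfq S x)); congr ee.
    by rewrite rmorphD !rmorphM /= -!pmulrn; field.
  have -> : z - ((m * c%:Z + d%:Z)%:~R / c%:R) *: zc R x =
     z - (d%:R / c%:R) *: zc R x + zc R (- (m *: x)).
    apply/matrixP => i j; rewrite !mxE !(rmorphD, rmorphM, rmorphN) /= -!pmulrn; by field.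
  by rewrite thetasum_shift.
have perm (A B C D : R[i]) : (A * B)^-1 * (C * D) = A^-1 * C * (B^-1 * D) by rewrite invfM; ring.
rewrite /wterm jE exprMn mulr_sumr; apply: eq_bigr => x _; rewrite gE.
exact: perm.
Qed.

(** Each d is m c + d0: the sum over m is [lattice_lipschitz] at t + d0/c, and the sum over d0
    produces c times the indicator of the congruence, whence the exponent k - 1. *)
Lemma hsum_wterm_row c V : (0 < c)%N -> hsum (wtm c) V ->
  hsum (fun p : 'cV[int]_N * nat =>
    c%:R ^- (k - 1) * (rescount c p.1 p.2)%:R * (fcf * ftm t z p)) V.
Proof.
move=> c0 hV; have cn : (c%:R : R[i]) != 0 by rewrite pnatr_eq0 -lt0n.
pose tt (d : nat) := t + d%:R / c%:R; pose zz (d : nat) (x : 'cV['I_c]_N) := z - (d%:R / c%:R) *: zc R (oint x).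
pose ex (d : nat) (x : 'cV['I_c]_N) : R[i] := c%:R ^- k * ee (d%:R * ((halfq S (oint x))%:~R / c%:R)).
have tt0 d : 0 < complex.Im (tt d).
  by rewrite /tt natrC (natrC _ c) -realcV -realcM cImD addr0.
have [l hl] := choice (fun dx : nat * 'cV['I_c]_N =>
   lattice_lipschitz S_sym S_pos N_even k_gt (zz dx.1 dx.2) (tt0 dx.1)).
pose row (d : nat) := \sum_(x : 'cV['I_c]_N) ex d x * l (d, x).
have VE : V = \sum_(d < c) row d.
  apply: (hsum_unique hV); apply/(hsum_bij _ _ (divmod_bij c0)).
  apply: (@hsum_fin_rows _ _ _ _ (fun d : 'I_c => row d)) => d /=.
  apply: (@eq_hsum _ _ (fun m : int => \sum_(x : 'cV['I_c]_N) ex d x *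
     ((tt d + m%:~R) ^- k * thetasum S (tt d + m%:~R) (zz d x)))) => [m|]; first by rewrite wterm_row.
  by apply: hsum_sum => x; apply: hsumZ; exact: (hl (_, x)).1.
rewrite VE; have rowP (d : 'I_c) : hsum (fun p => \sum_(x : 'cV['I_c]_N) ex d x * (fcf * ftm (tt d) (zz d x) p)) (row d).
  by apply: hsum_sum => x; apply: hsumZ; exact: (hl (_, x)).2.
apply: eq_hsum (hsum_sum (index_enum 'I_c) rowP) => p.
rewrite exchange_big /=.
transitivity (\sum_(x : 'cV['I_c]_N) c%:R ^- k * (fcf * ftm t z p) *
   (if (c%:Z %| halfq S (oint x) - dot p.1 (oint x) + p.2%:Z)%Z then c%:R else 0)).
  apply: eq_bigr => x _; rewrite -(@sum_ord_ee R _ _ c0) mulr_sumr; apply: eq_bigr => d _.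
  rewrite /tt /zz fterm_shift // /ex.
  have -> : ee ((d : nat)%:R * ((halfq S (oint x) - dot p.1 (oint x) + p.2%:Z)%:~R / c%:R)) =
    ee (d%:R * ((halfq S (oint x))%:~R / c%:R)) * ee (d%:R * ((p.2%:Z - dot p.1 (oint x))%:~R / c%:R)) :> R[i].
    by rewrite -eeD; congr ee; rewrite !(rmorphD, rmorphN) /=; ring.
  move: (ee _) (ee _) (fterm _ _ _ _ _) => X Y Z; ring.
rewrite -mulr_sumr -big_mkcond sumr_const -[#|_|]/(rescount c p.1 p.2).
have -> : c%:R ^- (k - 1) = c%:R ^- k * c%:R :> R[i].
  by rewrite -{2}(subnK (_ : (1 <= k)%N)) ?exprD ?expr1 ?invfM ?mulfVK //; lia.
by rewrite -mulr_natr; ring.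
Qed.

Lemma rescount_le c v n : (rescount c v n <= c ^ N)%N.
Proof. by rewrite (leq_trans (max_card _)) // card_mx card_ord muln1. Qed.

Let kN3 : (N + 2 <= k - 1)%N. Proof. by lia. Qed.

(** The trivial bound c^N for the count suffices, since k - 1 >= N + 2. *)
Lemma rescount_decay v n c :
  (rescount c.+1 v n)%:R / c.+1%:R ^+ (k - 1) <= (1 + c%:R) ^- 2 :> R.
Proof.
have c0 : 0 < c.+1%:R :> R by rewrite ltr0n.
rewrite nat1r ler_pdivrMr ?exprn_gt0 // mulrC ler_pdivlMr ?exprn_gt0 //.
apply: (@le_trans _ _ (c.+1%:R ^+ N * c.+1%:R ^+ 2)).
  by rewrite ler_wpM2r ?exprn_ge0 // -natrX ler_nat rescount_le.
by rewrite -exprD ler_weXn2l ?ler1n.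
Qed.

Lemma bsum_rescount v n : bsum (fun c : nat => (rescount c.+1 v n)%:R / c.+1%:R ^+ (k - 1) : R) (2 / 1).
Proof. by apply: bsum_le (bsum_inv_sqr (lexx 1)) => c; exact: rescount_decay. Qed.

Definition nseries v n : R := limn (series (fun c : nat => (rescount c.+1 v n)%:R / c.+1%:R ^+ (k - 1) : R)).

Lemma hsum_nseries v n : hsum (fun c : nat => ((rescount c.+1 v n)%:R / c.+1%:R ^+ (k - 1) : R)%:C) (nseries v n)%:C.
Proof.
have b0 (c : nat) : 0 <= (rescount c.+1 v n)%:R / c.+1%:R ^+ (k - 1) :> R by rewrite divr_ge0 // exprn_ge0.
have [l hl] := hsum_ex_ge0 b0 (bsum_rescount v n).
by rewrite /nseries (hsum_series hl).
Qed.

Lemma eisenstein_fourier P : hsum cop_term P ->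
  hsum (fun p : 'cV[int]_N * nat => (nseries p.1 p.2)%:C * (fcf * ftm t z p)) (zt%:C * P).
Proof.
move=> hP; have [P' [hP1 hP2]] := hsum_cop; rewrite -(hsum_unique hP hP1) in hP2.
have hw := hsum_wterm hP2.
have [V hV] := choice (fun c => hsum_row_ex c hw).
have hVs := hsum_rows hw hV.
pose F (q : nat * ('cV[int]_N * nat)) : R[i] :=
  ((rescount q.1.+1 q.2.1 q.2.2)%:R / q.1.+1%:R ^+ (k - 1) : R)%:C * (fcf * ftm t z q.2).
have rows c : hsum (fun p => F (c, p)) (V c).
  apply: eq_hsum (hsum_wterm_row (ltn0Sn c) (hV c)) => p.
  by rewrite /F /= realcM realcV realcX -!natrC [_ / _]mulrC.
have [B hB] := bsum_fterm S_sym S_pos N_even k_gt z t0.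
(* The decay in c is uniform in (v, n), so a product majorant allows summing over c last and the
   series of counts to appear as coefficients. *)
have bF : bsum (fun q => normc (F q)) (2 / 1 * (normc fcf * B)).
  have := bsum_prod (fun c => _) (fun p => _) (bsum_inv_sqr (lexx (1 : R))) (bsumZ (normc_ge0 fcf) hB).
  move=> /(_ (fun c => _) (fun p => _)) h.
  apply: bsum_le (h _ _) => [q|c|p].
  - rewrite /F normcM normc_real_ge0 ?divr_ge0 ?exprn_ge0 // (normcM fcf).
    rewrite ler_wpM2r ?mulr_ge0 ?normc_ge0 //.
    exact: rescount_decay.
  - by rewrite invr_ge0 exprn_ge0 // addr_ge0.
  - by rewrite mulr_ge0 ?normc_ge0.
have hF := hsum_from_rows bF rows hVs; move/hsum_swap: hF => hF.
apply: (hsum_rows hF) => p.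
rewrite mulrC; apply: eq_hsum (hsumZ _ (hsum_nseries p.1 p.2)) => c.
by rewrite /F mulrC.
Qed.

End EisensteinFourier.

(** * Holomorphy of Fourier series *)

Section Differentiability.
Variables (K : numFieldType) (V W : normedModType K).

Lemma near_dist_lt (x0 : V) (d : K) : 0 < d -> \forall x \near x0, `|x - x0| < d.
Proof. by move=> d0; apply/nbhs_normP; exists d => // y /=; rewrite distrC. Qed.

Lemma lipschitz_linear_continuous (df : {linear V -> W}) (C : K) : 0 < C ->
  (forall h, `|df h| <= C * `|h|) -> continuous df.
Proof.
move=> C0 H x; apply/cvgrPdist_le => e e0.
have := near_dist_lt x (divr_gt0 e0 C0); apply: filterS => y xy.
rewrite -linearB; apply: (le_trans (H _)); rewrite distrC mulrC -ler_pdivlMr //.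
exact: ltW.
Qed.

Lemma differentiable_quadratic (f : V -> W) (x0 : V) (df : {linear V -> W}) (C e0 : K) :
  continuous df -> 0 < C -> 0 < e0 ->
  (forall h, `|h| < e0 -> `|f (h + x0) - (f x0 + df h)| <= C * `|h| ^+ 2) ->
  differentiable f x0.
Proof.
move=> dfc C0 e00 H; apply/diffP.
(* The differential is defined by choice, so exhibiting one linear map with the expansion validates
   it. *)
suff ex : exists df : {linear V -> W}, continuous df /\ forall x,
   f x = f (lim (nbhs x0)) + df (x - lim (nbhs x0)) +o_(x \near x0) (x - lim (nbhs x0)).
  exact: (getPex ex).
exists df; split => //; rewrite lim_id; last exact: norm_hausdorff.
have : f = (fun x => f x0 + df (x - x0)) +o_x0 (fun x => x - x0).
  apply/eqaddoP => e ep.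
  apply: filterS2 (near_dist_lt x0 e00) (near_dist_lt x0 (divr_gt0 ep C0)) => x h1 h2.
  have := H (x - x0) h1; rewrite subrK => h3; apply: (le_trans h3).
  rewrite expr2 mulrA ler_wpM2r //; rewrite mulrC -ler_pdivlMr //; exact: ltW.
by rewrite funeqE.
Qed.

End Differentiability.

Section FourierHolomorphic.
Variables (R : realType) (N : nat).

Local Notation V := (R[i] * 'cV[R[i]]_N)%type.

Definition pair_form (D0 : R[i]) (D : 'cV[R[i]]_N) (h : V) : R[i] := D0 * h.1 + dot D h.2.

Fact pair_form_linear D0 D : linear (pair_form D0 D).
Proof.
move=> a x y; rewrite /pair_form /= dotDr dotZr.
rewrite -[LHS]/(D0 * (a * x.1 + y.1) + (a * dot D x.2 + dot D y.2)).
by rewrite -[RHS]/(a * (D0 * x.1 + dot D x.2) + (D0 * y.1 + dot D y.2)); ring.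
Qed.
HB.instance Definition _ D0 D :=
  GRing.isLinear.Build R[i] V R[i] *:%R (pair_form D0 D) (pair_form_linear D0 D).

(** The norm on a module over R[i] takes values in R[i]; this is its real value. *)
Definition hnorm (h : V) : R := complex.Re `|h|.

Lemma hnormE (h : V) : `|h| = (hnorm h)%:C.
Proof. by apply/eqP; rewrite eq_sym; apply/eqP/RRe_real; exact: normr_real. Qed.

Lemma entry_le_norm (x : 'cV[R[i]]_N) i : `|x i 0| <= `|x|.
Proof.
rewrite -[leRHS]/(mx_norm x) mx_normE -[leLHS]nngE num_le.
exact: (le_bigmax _ (fun ij : 'I_N * 'I_1 => `|x ij.1 ij.2|%:nng) (i, 0)).
Qed.

Lemma hnorm1 (h : V) : normc h.1 <= hnorm h.
Proof. by rewrite -lecR -hnormE prod_normE comparable_le_max ?lexx ?real_comparable ?normr_real. Qed.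

Lemma hnorm2 (h : V) i : normc (h.2 i 0) <= hnorm h.
Proof.
rewrite -lecR -hnormE; apply: (le_trans (entry_le_norm h.2 i)).
by rewrite prod_normE comparable_le_max ?lexx ?real_comparable ?normr_real ?orbT.
Qed.

Lemma bsum_sum (I : choiceType) (J : Type) (r : seq J) (b : J -> I -> R) B :
  (forall j, bsum (b j) (B j)) -> bsum (fun i => \sum_(j <- r) b j i) (\sum_(j <- r) B j).
Proof. by move=> H s us; rewrite exchange_big; apply: ler_sum => j _; exact: H. Qed.

Definition emode (p : 'cV[int]_N * nat) (t : R[i]) (z : 'cV[R[i]]_N) : R[i] :=
  ee (p.2%:R * t + dot (zc R p.1) z).

Definition freq (p : 'cV[int]_N * nat) : R := 2 * pi * (p.2%:R + \sum_i `|(p.1 i 0)%:~R|).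

Definition phase (p : 'cV[int]_N * nat) (h : V) : R[i] := 2 * ipi R * (p.2%:R * h.1 + dot (zc R p.1) h.2).

Lemma freq_ge0 p : 0 <= freq p.
Proof. by rewrite !mulr_ge0 ?pi_ge0 // addr_ge0 // sumr_ge0. Qed.

Lemma normc_ipi2 : normc (2 * ipi R) = 2 * pi.
Proof.
rewrite normcM normc_nat /ipi normcM (normc_real_ge0 (pi_ge0 R)).
by rewrite (_ : normc 'i = 1) ?mulr1 // /normc /= expr0n expr1n add0r sqrtr1.
Qed.

Lemma normc_phase p h : normc (phase p h) <= hnorm h * freq p.
Proof.
rewrite /phase normcM normc_ipi2 /freq mulrCA ler_wpM2l ?mulr_ge0 ?pi_ge0 //.
apply: (le_trans (normcD _ _)); rewrite mulrDr; apply: lerD.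
  by rewrite normcM normc_nat mulrC ler_wpM2r // hnorm1.
apply: (le_trans (normc_sum _ _ _)); rewrite mulr_sumr; apply: ler_sum => i _.
by rewrite normcM mxE intrC normc_real mulrC ler_wpM2r // hnorm2.
Qed.

Lemma emodeD p (h : V) t z : emode p (h.1 + t) (h.2 + z) = emode p t z * cexp (phase p h).
Proof. by rewrite /emode /phase /ee -cexpD dotDr; congr cexp; ring. Qed.

Variables (cf : 'cV[int]_N * nat -> R[i]) (phi : R[i] -> 'cV[R[i]]_N -> R[i]).
Hypothesis hphi : forall t z, 0 < complex.Im t -> hsum (fun p => cf p * emode p t z) (phi t z).

(** Coordinatewise e^(c|x|) <= e^(c x) + e^(-c x); expanding the product yields one term per choice
    of signs. *)
Lemma prod_exp_abs (c : R) (v : 'cV[int]_N) : 0 <= c ->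
  expR (c * \sum_i `|(v i 0)%:~R|) <=
  \sum_(s : {ffun 'I_N -> bool}) expR (\sum_i (if s i then c else - c) * (v i 0)%:~R).
Proof.
move=> c0; rewrite (eq_bigr (fun s : {ffun 'I_N -> bool} =>
   \prod_i expR ((if s i then c else - c) * (v i 0)%:~R))); last by move=> s _; rewrite expR_sum.
rewrite -(bigA_distr_bigA (fun (i : 'I_N) (b : bool) => expR ((if b then c else - c) * (v i 0)%:~R))).
rewrite mulr_sumr expR_sum; apply: ler_prod => i _; rewrite expR_ge0 /= big_bool /=.
have [h|h] := ger0P ((v i 0)%:~R : R); first by rewrite lerDl expR_ge0.
by rewrite mulrN mulNr lerDr expR_ge0.
Qed.

(* The extra exponential is absorbed by moving t down and z in the 2^N imaginary diagonal
   directions. *)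
Lemma bsum_emode_exp (t : R[i]) z (e : R) : 0 <= e -> 2 * e < complex.Im t ->
  exists B, bsum (fun p => normc (cf p * emode p t z) * expR (2 * e * freq p)) B.
Proof.
move=> e0 et; pose t1 := t - (2 * e)%:C * 'i.
have t10 : 0 < complex.Im t1 by rewrite /t1 cImD cImN Im_realM /= mulr1 subr_gt0.
pose c := 4 * pi * e; have c0 : 0 <= c by rewrite !mulr_ge0 ?pi_ge0.
pose zs (s : {ffun 'I_N -> bool}) : 'cV[R[i]]_N :=
   z - \col_i ((if s i then 2 * e else - (2 * e))%:C * 'i).
have [B hB] := choice (fun s => hsum_bsum (hphi (zs s) t10)).
exists (\sum_s B s); apply: bsum_le (bsum_sum (index_enum _) hB) => p.
have nE s : normc (cf p * emode p t1 (zs s)) = normc (cf p * emode p t z) *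
    (expR (c * p.2%:R) * expR (\sum_i (if s i then c else - c) * (p.1 i 0)%:~R)).
  rewrite (normcM (cf p)) (normcM (cf p)) -mulrA; congr (_ * _).
  rewrite /emode !normc_ee -!expRD; congr expR.
  have -> : dot (zc R p.1) (zs s) = dot (zc R p.1) z - (\sum_i (if s i then 2 * e else - (2 * e)) * (p.1 i 0)%:~R)%:C * 'i.
    rewrite /zs dotDr dotNr; congr (_ - _); rewrite rmorph_sum mulr_suml /=; apply: eq_bigr => i _.
    by rewrite !mxE intrC realcM; ring.
  rewrite !cImD cImN !natrC !Im_realM /t1 cImD cImN Im_realM /= !mulr1.
  have -> : \sum_i (if s i then c else - c) * (p.1 i 0)%:~R =
     2 * pi * \sum_i (if s i then 2 * e else - (2 * e)) * (p.1 i 0)%:~R :> R.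
    by rewrite mulr_sumr; apply: eq_bigr => i _; rewrite /c; case: (s i); ring.
  by rewrite /c; ring.
rewrite (eq_bigr _ (fun s _ => nE s)) -mulr_sumr ler_wpM2l ?normc_ge0 // -mulr_sumr.
have -> : 2 * e * freq p = c * p.2%:R + c * \sum_i `|(p.1 i 0)%:~R| by rewrite /freq /c; ring.
by rewrite expRD ler_pM2l ?expR_gt0 //; exact: prod_exp_abs.
Qed.

Lemma sqr_le_expR (x : R) : 0 <= x -> x ^+ 2 <= 4 * expR x.
Proof.
move=> x0; have h : x / 2 <= expR (x / 2) by exact: le_expR.
have -> : expR x = expR (x / 2) ^+ 2 by rewrite expr2 -expRD -splitr.
have : (x / 2) ^+ 2 <= expR (x / 2) ^+ 2 by rewrite lerXn2r ?nnegrE ?expR_ge0 // divr_ge0.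
rewrite expr_div_n; lra.
Qed.

(* Absolute convergence at neighbouring points bounds the second-order remainder, so the
   series may be differentiated termwise. *)
Lemma fourier_holomorphic : holomorphic phi.
Proof.
move=> [t z] /= t0; rewrite /upper_half_plane /= in t0.
(* Lowering t by 2e still leaves it in the upper half plane. One e pays for the polynomial factors
   in the frequency, the other for the exponential of the increment. *)
pose e := complex.Im t / 4; have e0 : 0 < e by rewrite divr_gt0.
have et : 2 * e < complex.Im t by rewrite /e; lra.
have [B hB] := bsum_emode_exp z (ltW e0) et.
pose A p := cf p * emode p t z.
pose G p := normc (A p) * expR (2 * e * freq p).
have LG p : normc (A p) * freq p <= e^-1 * G p.
  rewrite /G [leRHS]mulrCA ler_wpM2l ?normc_ge0 // ler_pdivlMl //.
  apply: (@le_trans _ _ (expR (e * freq p))); first exact: le_expR.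
  by rewrite ler_expR ler_wpM2r ?freq_ge0 // ler_peMl ?(ltW e0) // ler1n.
have ie0 : 0 <= e^-1 by rewrite invr_ge0 ltW.
have [D0 hD0] : exists D0, hsum (fun p => A p * (2 * ipi R * p.2%:R)) D0.
  apply: hsum_ex (bsum_le _ (bsumZ ie0 hB)) => p; apply: le_trans (LG p).
  rewrite normcM ler_wpM2l ?normc_ge0 // normcM normc_ipi2 normc_nat /freq.
  by rewrite ler_wpM2l ?mulr_ge0 ?pi_ge0 // lerDl sumr_ge0.
have hD i : exists Di, hsum (fun p => A p * (2 * ipi R * (p.1 i 0)%:~R)) Di.
  apply: hsum_ex (bsum_le _ (bsumZ ie0 hB)) => p; apply: le_trans (LG p).
  rewrite normcM ler_wpM2l ?normc_ge0 // normcM normc_ipi2 intrC normc_real /freq.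
  rewrite ler_wpM2l ?mulr_ge0 ?pi_ge0 // (bigD1 i) //= addrCA lerDl addr_ge0 // sumr_ge0 //.
have [D hDs] := choice hD; pose Dv : 'cV[R[i]]_N := \col_i D i.
have hdf h : hsum (fun p => A p * phase p h) (pair_form D0 Dv h).
  have h2 := hsum_sum (index_enum 'I_N) (fun i => hsumZ (h.2 i 0) (hDs i)).
  have := hsumD (hsumZ h.1 hD0) h2.
  rewrite (_ : _ + _ = pair_form D0 Dv h); last first.
    by rewrite /pair_form /dot mulrC; congr (_ + _); apply: eq_bigr => i _; rewrite mxE mulrC.
  apply: eq_hsum => p; rewrite /phase /dot !mulrDr !mulr_sumr; congr (_ + _); first by ring.
  by apply: eq_bigr => i _; rewrite mxE; ring.
pose C := normc D0 + (\sum_i normc (D i)) + 1.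
have C0 : 0 < C by rewrite /C ltr_wpDl // addr_ge0 ?normc_ge0 // sumr_ge0 // => i _; exact: normc_ge0.
have dfc : continuous (pair_form D0 Dv).
  apply: (@lipschitz_linear_continuous _ _ _ (pair_form D0 Dv) C%:C); first by rewrite ltcR.
  move=> h; rewrite hnormE normr_normc -realcM lecR /pair_form.
  have r0 : 0 <= hnorm h by apply: le_trans (hnorm1 h); exact: normc_ge0.
  apply: (le_trans (normcD _ _)); rewrite /C -addrA mulrDl; apply: lerD.
    by rewrite normcM ler_wpM2l ?normc_ge0 // hnorm1.
  rewrite mulrDl mul1r; apply: (@le_trans _ _ ((\sum_i normc (D i)) * hnorm h)); last by rewrite lerDl.
  apply: (le_trans (normc_sum _ _ _)); rewrite mulr_suml; apply: ler_sum => i _.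
  by rewrite normcM mxE ler_wpM2l ?normc_ge0 // hnorm2.
have B0 := bsum_ge0 hB.
pose C2 := 12 * (e^-1 ^+ 2 * B) + 1.
have C20 : 0 < C2 by rewrite /C2 ltr_wpDl // !mulr_ge0 // exprn_ge0.
apply: (@differentiable_quadratic _ _ _ _ _ (pair_form D0 Dv) C2%:C e%:C dfc); rewrite ?ltcR //.
move=> h; rewrite hnormE ltcR => he.
have r0 : 0 <= hnorm h by apply: le_trans (hnorm1 h); exact: normc_ge0.
rewrite normr_normc -realcX -realcM lecR.
have t1 : 0 < complex.Im (h.1 + t).
  have := le_trans (Im_le_normc h.1) (hnorm1 h); rewrite ler_norml => /andP[+ _].
  by rewrite cImD; rewrite /e in he; lra.
have hrem : hsum (fun p => A p * (cexp (phase p h) - 1 - phase p h))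
    (phi (h.1 + t) (h.2 + z) - (phi t z + pair_form D0 Dv h)).
  rewrite opprD addrA.
  apply: eq_hsum (hsumB (hsumB (hphi (h.2 + z) t1) (hphi z t0)) (hdf h)) => p.
  by rewrite emodeD /A; ring.
apply: (@le_trans _ _ (12 * (e^-1 ^+ 2 * hnorm h ^+ 2) * B)); last first.
  have -> : 12 * (e^-1 ^+ 2 * hnorm h ^+ 2) * B = 12 * (e^-1 ^+ 2 * B) * hnorm h ^+ 2 by ring.
  by rewrite /C2 ler_wpM2r ?sqr_ge0 // lerDl.
have q0 : 0 <= 12 * (e^-1 ^+ 2 * hnorm h ^+ 2) by rewrite !mulr_ge0 ?exprn_ge0.
apply: (hsum_norm_le hrem); apply: bsum_le (bsumZ q0 hB) => p.
rewrite normcM [leRHS]mulrCA ler_wpM2l ?normc_ge0 //.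
apply: (le_trans (cexp_taylor2 _)).
have np := normc_phase p h; have f0 := freq_ge0 p.
apply: (@le_trans _ _ (3 * (hnorm h * freq p) ^+ 2 * expR (e * freq p))).
  apply: ler_pM; rewrite ?expR_ge0 ?mulr_ge0 ?exprn_ge0 ?normc_ge0 //.
    by rewrite ler_pM2l // !expr2; apply: ler_pM; rewrite ?normc_ge0.
  by rewrite ler_expR; apply: (le_trans np); rewrite ler_wpM2r // ltW.
have s := sqr_le_expR (mulr_ge0 (ltW e0) f0).
have -> : 2 * e * freq p = e * freq p + e * freq p by ring.
rewrite expRD [leRHS]mulrA ler_wpM2r ?expR_ge0 //.
have -> : 3 * (hnorm h * freq p) ^+ 2 = 3 * (e^-1 ^+ 2 * hnorm h ^+ 2) * (e * freq p) ^+ 2.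
  by field; rewrite gt_eqF.
have -> : 12 * (e^-1 ^+ 2 * hnorm h ^+ 2) * expR (e * freq p) =
  3 * (e^-1 ^+ 2 * hnorm h ^+ 2) * (4 * expR (e * freq p)) by ring.
by rewrite ler_wpM2l // !mulr_ge0 ?exprn_ge0.
Qed.

End FourierHolomorphic.

(** * The slash action and the cosets of the Jacobi group *)

Section TwoByTwo.

Lemma ord2 (i : 'I_2) : i = 0 \/ i = 1.
Proof. by case: i => [[|[|//]] h]; [left|right]; apply: val_inj. Qed.

Lemma mulmx2E (K : comNzRingType) m n (A : 'M[K]_(m, 2)) (B : 'M[K]_(2, n)) i j :
  (A *m B) i j = A i 0 * B 0 j + A i 1 * B 1 j.
Proof.
rewrite mxE !big_ord_recl big_ord0 addr0; congr (A _ _ * B _ _ + A _ _ * B _ _); exact: val_inj.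
Qed.

Lemma det2E (K : comNzRingType) (A : 'M[K]_2) : \det A = A 0 0 * A 1 1 - A 0 1 * A 1 0.
Proof.
rewrite (expand_det_row A ord0) !big_ord_recl big_ord0 addr0 /cofactor !det_mx11 !mxE.
rewrite (_ : (-1) ^+ (ord0 + ord0) = 1) // (_ : (-1) ^+ (ord0 + lift ord0 ord0) = -1); last exact: expr1.
rewrite mul1r mulN1r mulrN; congr (A _ _ * A _ _ - A _ _ * A _ _); exact: val_inj.
Qed.

Lemma sl2_det (M : SL2Z) : val M 0 0 * val M 1 1 - val M 0 1 * val M 1 0 = 1.
Proof. by rewrite -det2E; exact/eqP/(valP M). Qed.

Lemma col_mulmx2 m (X : 'M[int]_(m, 2)) (P : 'M[int]_2) j :
  col j (X *m P) = P 0 j *: col 0 X + P 1 j *: col 1 X.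
Proof. by apply/matrixP => i l; rewrite [LHS]mxE mulmx2E !mxE; ring. Qed.

Lemma sl2_inv_col (M : SL2Z) : invmx (val M) 0 0 = val M 1 1 /\ invmx (val M) 1 0 = - val M 1 0.
Proof.
pose v : 'cV[int]_2 := \col_i (if i == 0 then val M 1 1 else - val M 1 0).
have Mv : val M *m v = delta_mx 0 0.
  apply/matrixP => i j; rewrite ord1 mulmx2E !mxE /= mulrN.
  by case: (ord2 i) => ->; rewrite ?sl2_det //= mulrC subrr.
have vE : v = col 0 (invmx (val M)) by rewrite colE -Mv mulKmx // SL2Z_unitmx.
have E i : invmx (val M) i 0 = v i 0 by rewrite vE mxE.
by rewrite !E !mxE.
Qed.

End TwoByTwo.

Section SlashAction.
Variables (R : realType) (N : nat) (k : nat) (S : 'M[int]_N).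
Hypotheses (S_sym : S^T = S) (S_even : forall i, (2 %| S i i)%Z) (S_pos : pos_def R S)
  (k_even : ~~ odd k) (k_gt0 : (0 < k)%N).

Implicit Types (g h : jacobi_group N) (t : R[i]) (z : 'cV[R[i]]_N).

Definition jj g t : R[i] := (val g.1 1 0)%:~R * t + (val g.1 1 1)%:~R.
Definition jt g t : R[i] := ((val g.1 0 0)%:~R * t + (val g.1 0 1)%:~R) / jj g t.
Definition jw g t z := z + t *: zc R (col 0 g.2) + zc R (col 1 g.2).
Definition jz g t z := (jj g t)^-1 *: jw g t z.
Definition jexp g t z : R[i] :=
  form S (zc R (col 0 g.2)) (zc R (col 0 g.2)) * t + 2 * form S (zc R (col 0 g.2)) z
  - (val g.1 1 0)%:~R * form S (jw g t z) (jw g t z) / jj g t.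

Lemma slashE g (phi : R[i] -> 'cV[R[i]]_N -> R[i]) t z :
  slash k S g phi t z = jj g t ^- k * cexp (ipi R * jexp g t z) * phi (jt g t) (jz g t z).
Proof.
have perm (A B C D P : R[i]) : A * C = D -> A * (B * C * P) = B * D * P by move=> <-; ring.
rewrite /slash /slash_lattice /slash_SL2Z -/(jw g t z) -/(jj g t) -/(jt g t) -/(jz g t z).
apply: perm; rewrite -cexpD; congr cexp.
by rewrite /jexp /ipi -/(zc R (col 0 g.2)); ring.
Qed.

Lemma jj_neq0 g t : 0 < complex.Im t -> jj g t != 0.
Proof.
move=> t0; have := sl2_det g.1; apply: contra_eq_neq => h.
have /eqP := congr1 (@complex.Im R) h; rewrite cImD !intrC Im_realM addr0 mulf_eq0 intr_eq0.
rewrite (gt_eqF t0) orbF => /eqP c0.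
have /eqP := congr1 (@complex.Re R) h; rewrite /jj c0 mul0r add0r intrC /= intr_eq0 => /eqP ->.
by rewrite !mulr0 subr0 eq_sym oner_eq0.
Qed.

Lemma Im_jt g t : 0 < complex.Im t -> 0 < complex.Im (jt g t).
Proof.
move=> t0; have jn := jj_neq0 g t0.
have n0 : 0 < normc (jj g t) ^+ 2 by rewrite exprn_gt0 // normc_gt0.
rewrite -(pmulr_lgt0 _ n0) normc_sqr.
have h : jt g t * jj g t = (val g.1 0 0)%:~R * t + (val g.1 0 1)%:~R by rewrite divfK.
move: (jt g t) h => s h.
have h1 := congr1 (@complex.Re R) h; have h2 := congr1 (@complex.Im R) h.
have dt : (val g.1 0 0)%:~R * (val g.1 1 1)%:~R - (val g.1 0 1)%:~R * (val g.1 1 0)%:~R = 1 :> R.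
  by rewrite -!rmorphM -rmorphB /= sl2_det.
move: h1 h2; rewrite /jj !(cReM, cImM, cReD, cImD, intrC) /= !(mul0r, addr0, subr0).
move: (complex.Re s) (complex.Im s) (complex.Re t) (complex.Im t) t0 => p q u v v0.
move: dt; move: ((val g.1 0 0)%:~R : R) ((val g.1 0 1)%:~R : R) ((val g.1 1 0)%:~R : R) ((val g.1 1 1)%:~R : R).
move=> a b c d dt h1 h2.
rewrite (_ : q * _ = v) //.
transitivity ((c * u + d) * (p * (c * v) + q * (c * u + d)) - (c * v) * (p * (c * u + d) - q * (c * v))); first by ring.
rewrite h1 h2; transitivity (v * (a * d - b * c)); first by ring.
by rewrite dt mulr1.
Qed.

Lemma jj_mul g h t : 0 < complex.Im t -> jj (g * h)%g t = jj g (jt h t) * jj h t.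
Proof.
move=> t0; have jn := jj_neq0 h t0.
rewrite [RHS]mulrC {2}/jj mulrDr mulrCA [jj h t * jt h t]mulrC divfK //.
rewrite /jj [val (g * h)%g.1]/= !mulmx2E !(rmorphD, rmorphM) /=; ring.
Qed.

Lemma jt_mul g h t : 0 < complex.Im t -> jt (g * h)%g t = jt g (jt h t).
Proof.
move=> t0; have jn := jj_neq0 h t0.
rewrite {1}/jt jj_mul // [in RHS]/jt.
have -> : (val (g * h)%g.1 0 0)%:~R * t + (val (g * h)%g.1 0 1)%:~R =
   ((val g.1 0 0)%:~R * jt h t + (val g.1 0 1)%:~R) * jj h t.
  rewrite mulrDl -mulrA divfK // /jj [val (g * h)%g.1]/= !mulmx2E !(rmorphD, rmorphM) /=; ring.
by rewrite invfM mulrACA mulfV // mulr1.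
Qed.

Lemma zcD (u v : 'cV[int]_N) : zc R (u + v) = zc R u + zc R v.
Proof. exact: map_mxD. Qed.
Lemma zcZ (a : int) (u : 'cV[int]_N) : zc R (a *: u) = a%:~R *: zc R u.
Proof. exact: map_mxZ. Qed.

Lemma col_jmul g h j : zc R (col j (g * h)%g.2) =
  (val h.1 0 j)%:~R *: zc R (col 0 g.2) + (val h.1 1 j)%:~R *: zc R (col 1 g.2) + zc R (col j h.2).
Proof. by rewrite [(g * h)%g.2]/= linearD /= col_mulmx2 !zcD !zcZ. Qed.

Lemma jw_mul g h t z : 0 < complex.Im t ->
  jw (g * h)%g t z = jj h t *: jw g (jt h t) (jz h t z).
Proof.
move=> t0; have jn := jj_neq0 h t0.
rewrite [in RHS]/jw !scalerDr /jz [jj h t *: (_ *: jw _ _ _)]scalerA mulfV // scale1r scalerA.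
rewrite [jj h t * jt h t]mulrC divfK // /jw !col_jmul /jj !scalerDr !scalerDl !scalerA.
by apply/matrixP => i j; rewrite !mxE; ring.
Qed.

Lemma jz_mul g h t z : 0 < complex.Im t ->
  jz (g * h)%g t z = jz g (jt h t) (jz h t z).
Proof.
move=> t0; have jn := jj_neq0 h t0.
by rewrite {1}/jz jw_mul // jj_mul // scalerA invfM -mulrA mulVf // mulr1.
Qed.

(** The exponents satisfy the cocycle rule up to the last bracket. For integral data that bracket is
    an even integer, as (x, x) and (y, y) are even, so it is invisible after exponentiation. *)
Lemma cocycle_expand (a b c d cg dg t : R[i]) (x y x' y' w : 'cV[R[i]]_N) :
  let j := c * t + d in let s := (a * t + b) / j in let jg := cg * s + dg in
  let W := j^-1 *: w + s *: x + y in
  let X := a *: x + c *: y + x' in let z := w - t *: x' - y' in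
  j != 0 -> jg != 0 -> a * d - b * c = 1 ->
  form S X X * t + 2 * form S X z - (cg * a + dg * c) * form S (j *: W) (j *: W) / (jg * j) =
  (form S x' x' * t + 2 * form S x' z - c * form S w w / j)
  + (form S x x * s + 2 * form S x (j^-1 *: w) - cg * form S W W / jg)
  - (2 * form S (a *: x + c *: y) y' + a * b * form S x x + 2 * b * c * form S x y + c * d * form S y y).
Proof.
move=> j s jg W X z jn jgn det1.
have js : j * s = a * t + b by rewrite /s mulrC divfK.
have ii : j^-1 = a - c * s.
  apply: (mulfI jn); rewrite mulfV // mulrBr [j * (c * s)]mulrCA js.
  by rewrite -det1 /j; ring.
have step1 : (cg * a + dg * c) * form S (j *: W) (j *: W) / (jg * j) =
   cg * form S W W / jg + c * j * form S W W.
  rewrite formZl formZr; have -> : cg * a + dg * c = (cg + c * j * jg) / j.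
    apply: (mulIf jn); rewrite divfK // /jg.
    transitivity (cg * (a * j) + dg * c * j); first by ring.
    have -> : a * j = 1 + c * (j * s) by rewrite js -det1 /j; ring.
    by ring.
  by field; rewrite jn jgn.
(* The six identities are the coefficients of the six products of x, y and w in the difference of
   the two sides. *)
have k1 : c * j * (j^-1 * j^-1) - c * j^-1 = 0 by rewrite -[c * j * _]mulrA mulVKf // subrr.
have k2 : a - c * j * (j^-1 * s) - j^-1 = 0.
  by rewrite -[c * j * _]mulrA mulVKf // {1}ii subrr.
have k3 : c - c * j * j^-1 = 0 by rewrite mulfK // subrr.
have k4 : a * a * t - c * j * (s * s) - s + a * b = 0.
  have -> : c * j * (s * s) = c * s * (j * s) by ring.
  rewrite js; transitivity (a * (a * t + b) - s * (c * (a * t + b) + 1)); first by ring.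
  transitivity (a * (a * t + b) - s * (c * (a * t + b) + (a * d - b * c))); first by rewrite det1.
  rewrite -!js; transitivity (s * (a * j - c * (j * s) - (a * d - b * c))); first by ring.
  by rewrite js /j; ring.
have k5 : a * c * t - c * j * s + b * c = 0 by rewrite -[c * j * s]mulrA js; ring.
have k6 : c * c * t - c * j + c * d = 0 by rewrite /j; ring.
rewrite step1 /W /X /z !formLE (formC S_sym y x) (formC S_sym x' x) (formC S_sym x' y) (formC S_sym w x)
  (formC S_sym w y).
apply/eqP; rewrite -subr_eq0; apply/eqP.
set Bww := form S w w; set Bxw := form S x w; set Byw := form S y w; set Bxx := form S x x.
set Bxy := form S x y; set Byy := form S y y.
transitivity (- Bww * (c * j * (j^-1 * j^-1) - c * j^-1) + 2 * Bxw * (a - c * j * (j^-1 * s) - j^-1)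
  + 2 * Byw * (c - c * j * j^-1) + Bxx * (a * a * t - c * j * (s * s) - s + a * b)
  + 2 * Bxy * (a * c * t - c * j * s + b * c) + Byy * (c * c * t - c * j + c * d)).
  move: (j^-1) (form S x' x') (form S x x') (form S y x') (form S x' y') (form S x y') (form S y y')
    (form S x' w) Bww Bxw Byw Bxx Bxy Byy (jg^-1).
  by move=> *; ring.
by rewrite k1 k2 k3 k4 k5 k6 !mulr0 !addr0.
Qed.

Lemma cexp_ipi_even (n : int) : cexp (ipi R * (2 * n%:~R)) = 1.
Proof. by rewrite (_ : _ * _ = 2 * ipi R * n%:~R); [exact: ee_int | ring]. Qed.

Lemma cexp_congr (w w' : R[i]) (n : int) : w = w' + ipi R * (2 * n%:~R) -> cexp w = cexp w'.
Proof. by move=> ->; rewrite cexpD cexp_ipi_even mulr1. Qed.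

Lemma jexp_mul g h t z : 0 < complex.Im t ->
  cexp (ipi R * jexp (g * h)%g t z) =
  cexp (ipi R * jexp h t z) * cexp (ipi R * jexp g (jt h t) (jz h t z)).
Proof.
move=> t0; have jn := jj_neq0 h t0; have jgn := jj_neq0 g (Im_jt h t0).
pose a := val h.1 0 0; pose b := val h.1 0 1; pose c := val h.1 1 0; pose d := val h.1 1 1.
pose x := col 0 g.2; pose y := col 1 g.2; pose x' := col 0 h.2; pose y' := col 1 h.2.
pose n := - (form S (a *: x + c *: y) y' + a * b * halfq S x + b * c * form S x y + c * d * halfq S y).
have det1 : a%:~R * d%:~R - b%:~R * c%:~R = 1 :> R[i].
  by rewrite -!rmorphM -rmorphB /= sl2_det.
have E := @cocycle_expand a%:~R b%:~R c%:~R d%:~R (val g.1 1 0)%:~R (val g.1 1 1)%:~R t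
  (zc R x) (zc R y) (zc R x') (zc R y') (jw h t z) jn jgn det1.
have zE : jw h t z - t *: zc R x' - zc R y' = z.
  by rewrite /jw -/x' -/y' addrAC addrK addrK.
have -> : jexp (g * h)%g t z = jexp h t z + jexp g (jt h t) (jz h t z) + 2 * n%:~R.
  rewrite {1}/jexp jw_mul // jj_mul // col_jmul -/x -/y -/x' -/a -/c.
  have -> : (val (g * h)%g.1 1 0)%:~R = (val g.1 1 0)%:~R * a%:~R + (val g.1 1 1)%:~R * c%:~R :> R[i].
    by rewrite [val (g * h)%g.1]/= mulmx2E rmorphD !rmorphM.
  move: E; rewrite zE => /= ->; rewrite /jexp -/x -/x'; congr (_ + _ + _).
  rewrite /n rmorphN !rmorphD !rmorphM /= mulrN; congr (- _).
  rewrite !form_halfq //.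
  have fE (u v : 'cV[int]_N) : form S (zc R u) (zc R v) = (form S u v)%:~R.
    exact: (form_map S (intr : {rmorphism int -> R[i]})).
  by rewrite -!zcZ -zcD !fE; ring.
by rewrite !mulrDr !cexpD cexp_ipi_even mulr1.
Qed.

Lemma slash_mul g h phi t z : 0 < complex.Im t ->
  slash k S (g * h)%g phi t z = slash k S h (slash k S g phi) t z.
Proof.
move=> t0; rewrite (slashE h) (slashE (g * h)%g) (slashE g).
rewrite jexp_mul // jj_mul // jt_mul // jz_mul // exprMn invfM.
by move: (cexp _) (cexp _) => X Y; ring.
Qed.

(* At z = - (x t + y) the modulus of 1 | h is |c t + d|^-k e^(pi (x, x) Im t), which is 1
   for all t only if c = 0 and x = 0. *)
Lemma Gamma_inftyP h : @GammaJ_infty R N k S h <-> val h.1 1 0 = 0 /\ col 0 h.2 = 0.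
Proof.
split=> [H|[c0 x0] t z t0]; last first.
  rewrite slashE /jexp x0 c0 /jj c0 !mul0r subr0 mulr1.
  have -> : zc R (0 : 'cV[int]_N) = 0 by apply/matrixP => i j; rewrite !mxE.
  rewrite !formE !dot0l mul0r mulr0 addr0 mulr0 cexp0 mulr1 add0r.
  have d2 : val h.1 1 1 ^+ 2 = 1.
    have := sl2_det h.1; rewrite c0 mulr0 subr0 => /(congr1 absz); rewrite abszM => /eqP.
    rewrite muln_eq1 => /andP[_ /eqP]; move: (val h.1 1 1) => d d1.
    have [->|->] : d = 1 \/ d = -1 by lia.
      by rewrite expr1n.
    by rewrite sqrrN expr1n.
  rewrite -(odd_double_half k) (negbTE k_even) add0n -mul2n exprM -rmorphXn /= d2.
  by rewrite expr1n invr1.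
set c := val h.1 1 0; set d := val h.1 1 1; set x := col 0 h.2; set y := col 1 h.2.
pose X : R := form S (zr R x) (zr R x).
have XC : form S (zc R x) (zc R x) = X%:C.
  by rewrite zc_rc; exact: (form_map S (real_complex R)).
have nj t : 0 < complex.Im t -> normc (jj h t) ^+ k = expR (pi * (X * complex.Im t)).
  move=> t0; have jn := jj_neq0 h t0.
  have := H t (- (t *: zc R x + zc R y)) t0; rewrite slashE mulr1 /jexp.
  have -> : jw h t (- (t *: zc R x + zc R y)) = 0 by rewrite /jw -addrA addNr.
  rewrite -/x (formE _ 0) dot0l mulr0 mul0r subr0 !formLE XC => /(congr1 (@normc R)).
  rewrite normcM normcV normcX normc_cexp normc1 => e.
  have n0 : normc (jj h t) ^+ k != 0 by rewrite expf_neq0 // normc_eq0.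
  have -> : normc (jj h t) ^+ k = expR (complex.Re
      (ipi R * (X%:C * t + 2 * - (t * X%:C + form S (zc R x) (zc R y))))).
    by apply: (mulfI (invr_neq0 n0)); rewrite e mulVf.
  congr expR.
  have -> : form S (zc R x) (zc R y) = (form S (zr R x) (zr R y))%:C.
    by rewrite !zc_rc; exact: (form_map S (real_complex R)).
  by rewrite /ipi !(cReM, cImM, cReD, cImD, cReN, cImN) /=; ring.
(* The modulus of the automorphy factor depends on Im t only; moving along Im t = 1 shows that |c r
   + d| is constant, and r = 1, -1 give c = 0. *)
have nj2 (r : R) : (c%:~R * r + d%:~R) ^+ 2 = d%:~R ^+ 2 :> R.
  have i0 (r' : R) : 0 < complex.Im (r' +i* 1) by rewrite /= ltr01.
  have /eqP : normc (jj h (r +i* 1)) ^+ k = normc (jj h (0 +i* 1)) ^+ k by rewrite !nj.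
  rewrite eqrXn2 ?normc_ge0 // => /eqP e.
  have := congr1 (fun s => s ^+ 2) e; rewrite /= !normc_sqr /jj -/c -/d.
  rewrite !(cReM, cImM, cReD, cImD, intrC) /= !(mul0r, mulr0, add0r, addr0, subr0, mulr1).
  by move/addIr.
have c0 : c = 0.
  have := nj2 1; have := nj2 (-1); move=> e1 e2.
  have : (c%:~R : R) ^+ 2 = 0 by move: e1 e2; move: (c%:~R : R) (d%:~R : R) => u v; nra.
  by move/eqP; rewrite sqrf_eq0 intr_eq0 => /eqP.
split=> //; apply/eqP; apply: contraT => xn.
have zn : zr R x != 0.
  apply: contra xn => /eqP/matrixP e; apply/eqP/matrixP => i j; have /eqP := e i j.
  by rewrite !mxE intr_eq0 => /eqP.
have X0 : 0 < X by exact: S_pos.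
have dn : normc (jj h (0 +i* 1)) = 1.
  have := sl2_det h.1; rewrite -/c -/d c0 mulr0 subr0 => /(congr1 absz); rewrite abszM => /eqP.
  rewrite muln_eq1 => /andP[_ /eqP d1].
  by rewrite /jj -/c -/d c0 mul0r add0r intrC normc_real abs_intr d1.
have := nj (0 +i* 1) ltr01; rewrite dn expr1n /= mulr1 => /esym/eqP.
by rewrite gt_eqF // expR_gt1 mulr_gt0 // pi_gt0.
Qed.

End SlashAction.

(** * Representatives of the cosets *)

Section Cosets.
Variables (R : realType) (N : nat) (k : nat) (S : 'M[int]_N).
Hypotheses (S_sym : S^T = S) (S_even : forall i, (2 %| S i i)%Z) (S_pos : pos_def R S)
  (k_even : ~~ odd k) (k_gt0 : (0 < k)%N).

Local Notation Ginf := (@GammaJ_infty R N k S).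
Local Notation GinfP := (Gamma_inftyP S_pos k_even k_gt0).
Implicit Types (g h : jacobi_group N) (t : R[i]) (z : 'cV[R[i]]_N).

(* Up to a common sign, (c, d, gu g) is a complete invariant of the coset of g. *)
Definition gu g : 'cV[int]_N := val g.1 1 1 *: col 0 g.2 - val g.1 1 0 *: col 1 g.2.

Definition coset g : set (jacobi_group N) := [set (h * g)%g | h in Ginf].

Lemma Gamma_infty_sign h : Ginf h -> val h.1 1 1 * val h.1 1 1 = 1.
Proof.
move=> /GinfP[c0 _]; have := sl2_det h.1; rewrite c0 mulr0 subr0 => /(congr1 absz); rewrite abszM => /eqP.
rewrite muln_eq1 => /andP[_ /eqP]; move: (val h.1 1 1) => d d1.
by have [->|->] : d = 1 \/ d = -1 by lia.
Qed.

Lemma coset_invariants h g : Ginf h ->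
  [/\ val (h * g)%g.1 1 0 = val h.1 1 1 * val g.1 1 0,
      val (h * g)%g.1 1 1 = val h.1 1 1 * val g.1 1 1 &
      gu (h * g)%g = val h.1 1 1 *: gu g].
Proof.
move=> /GinfP[c0 x0].
have e1 : val (h * g)%g.1 1 0 = val h.1 1 1 * val g.1 1 0.
  by rewrite [val (h * g)%g.1]/= mulmx2E c0 mul0r add0r.
have e2 : val (h * g)%g.1 1 1 = val h.1 1 1 * val g.1 1 1.
  by rewrite [val (h * g)%g.1]/= mulmx2E c0 mul0r add0r.
split=> //; rewrite /gu e1 e2 [(h * g)%g.2]/= !linearD /= !col_mulmx2 x0 !scaler0 !add0r.
by apply/matrixP => i j; rewrite !mxE; ring.
Qed.

(** The first column of the inverse matrix is (d, -c). So the lower left entry of g' g^-1 vanishes,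
    and its first lattice vector is e gu(g') - gu(g) = 0. *)
Lemma invariants_coset e g g' : e * e = 1 -> val g'.1 1 0 = e * val g.1 1 0 ->
  val g'.1 1 1 = e * val g.1 1 1 -> gu g' = e *: gu g -> exists2 h, Ginf h & g' = (h * g)%g.
Proof.
move=> e2 ec ed eu; exists (g' * g^-1)%g; last by rewrite -mulgA mulVg mulg1.
have [i00 i10] := sl2_inv_col g.1; apply/GinfP; split.
  by rewrite [val (g' * g^-1)%g.1]/= mulmx2E i00 i10 ec ed; ring.
rewrite [(g' * g^-1)%g.2]/= linearD linearN /= !col_mulmx2 i00 i10.
have E : e *: gu g' = gu g by rewrite eu scalerA e2 scale1r.
have {E} : gu g = val g.1 1 1 *: col 0 g'.2 - val g.1 1 0 *: col 1 g'.2.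
  rewrite -E /gu ec ed scalerBr !scalerA !mulrA e2 !mul1r; exact: erefl.
rewrite /gu => E; rewrite !scaleNr -E subrr; exact: erefl.
Qed.

Lemma slash_ext g (phi psi : R[i] -> 'cV[R[i]]_N -> R[i]) t z :
  (forall t z, 0 < complex.Im t -> phi t z = psi t z) -> 0 < complex.Im t ->
  slash k S g phi t z = slash k S g psi t z.
Proof. by move=> E t0; rewrite !slashE E //; exact: Im_jt. Qed.

Lemma Gamma_infty1 : Ginf 1%g.
Proof. by apply/GinfP; split; [rewrite mxE | apply/matrixP => i j; rewrite !mxE]. Qed.

Lemma Gamma_inftyM h h' : Ginf h -> Ginf h' -> Ginf (h * h')%g.
Proof.
move=> H H' t z t0; rewrite slash_mul //.
by rewrite (slash_ext (psi := fun _ _ => 1) h' z H t0); exact: H'.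
Qed.

Lemma Gamma_inftyV h : Ginf h -> Ginf h^-1%g.
Proof.
move=> H t z t0; rewrite -(slash_ext (psi := fun _ _ => 1) h^-1%g z H t0).
by rewrite -slash_mul // mulgV; exact: Gamma_infty1.
Qed.

Lemma coset_self g : coset g g.
Proof. by exists 1%g; [exact: Gamma_infty1 | rewrite mul1g]. Qed.

Lemma coset_eq g g' : (exists2 h, Ginf h & g' = (h * g)%g) -> coset g' = coset g.
Proof.
move=> [h H ->]; apply/seteqP; split => x [h' H' <-].
  by exists (h' * h)%g; [exact: Gamma_inftyM | rewrite mulgA].
exists (h' * h^-1)%g; first by apply: Gamma_inftyM; [exact: H' | exact: Gamma_inftyV H].
by rewrite mulgA -(mulgA h') mulVg mulg1.
Qed.

Lemma coset_inj g g' : coset g = coset g' -> exists2 h, Ginf h & g' = (h * g)%g.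
Proof. by move=> E; have := coset_self g'; rewrite -E => -[h H <-]; exists h. Qed.

Lemma eisenstein_term_coset g t z : 0 < complex.Im t ->
  eisenstein_term k S (coset g) t z = slash k S g (fun _ _ => 1) t z.
Proof.
move=> t0; rewrite /eisenstein_term.
have [h H <-] : coset g (xget 1%g (coset g)) by apply: xgetPex; exists g; exact: coset_self.
by rewrite slash_mul // (slash_ext (psi := fun _ _ => 1) g z H t0).
Qed.

Definition mx2 (a b c d : int) : 'M[int]_2 :=
  \matrix_(i, j) (if i == 0 then (if j == 0 then a else b) else (if j == 0 then c else d)).

Lemma mx2_det a b c d : a * d - b * c = 1 -> \det (mx2 a b c d) == 1.
Proof. by move=> h; rewrite det2E !mxE /= h. Qed.

Definition cusp_rep (u : 'cV[int]_N) : jacobi_group N :=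
  (SL2Z_one, \matrix_(i, j) (if j == 0 then u i 0 else 0)).

(** The lattice part (a u, b u) is chosen so that its invariant d a u - c b u is u itself. *)
Definition cop_rep (q : coprime_pair * 'cV[int]_N) : jacobi_group N :=
  let ab := bezout (val q.1) in
  (insubd SL2Z_one (mx2 ab.1 ab.2 (val q.1).1.+1%:Z (val q.1).2),
   \matrix_(i, j) (if j == 0 then ab.1 * q.2 i 0 else ab.2 * q.2 i 0)).

Lemma cop_rep_val q : val (cop_rep q).1 =
  mx2 (bezout (val q.1)).1 (bezout (val q.1)).2 (val q.1).1.+1%:Z (val q.1).2.
Proof. by rewrite /cop_rep /= insubdK //; apply: mx2_det; exact: bezoutP. Qed.

Lemma cop_repE q : [/\ val (cop_rep q).1 1 0 = (val q.1).1.+1%:Z,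
  val (cop_rep q).1 1 1 = (val q.1).2, col 0 (cop_rep q).2 = (bezout (val q.1)).1 *: q.2,
  col 1 (cop_rep q).2 = (bezout (val q.1)).2 *: q.2 & gu (cop_rep q) = q.2].
Proof.
have e1 : val (cop_rep q).1 1 0 = (val q.1).1.+1%:Z by rewrite cop_rep_val mxE.
have e2 : val (cop_rep q).1 1 1 = (val q.1).2 by rewrite cop_rep_val mxE.
have e3 : col 0 (cop_rep q).2 = (bezout (val q.1)).1 *: q.2.
  by apply/matrixP => i j; rewrite !mxE ord1.
have e4 : col 1 (cop_rep q).2 = (bezout (val q.1)).2 *: q.2.
  by apply/matrixP => i j; rewrite !mxE ord1.
split => //; rewrite /gu e1 e2 e3 e4 !scalerA -scalerBl.
by rewrite [_ * (bezout _).1]mulrC [_ * (bezout _).2]mulrC bezoutP scale1r.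
Qed.

Lemma cusp_repE u : [/\ val (cusp_rep u).1 1 0 = 0, val (cusp_rep u).1 1 1 = 1,
  col 0 (cusp_rep u).2 = u, col 1 (cusp_rep u).2 = 0 & gu (cusp_rep u) = u].
Proof.
have e3 : col 0 (cusp_rep u).2 = u by apply/matrixP => i j; rewrite !mxE ord1.
have e4 : col 1 (cusp_rep u).2 = 0 by apply/matrixP => i j; rewrite !mxE.
have e1 : val (cusp_rep u).1 1 0 = 0 by rewrite /= mxE.
have e2 : val (cusp_rep u).1 1 1 = 1 by rewrite /= mxE.
by split => //; rewrite /gu e1 e2 e3 scale1r scale0r subr0.
Qed.

Lemma cusp_coset_inj : injective (fun u => coset (cusp_rep u)).
Proof.
move=> u v /coset_inj[h H E]; have [_ e2 e3] := coset_invariants (cusp_rep u) H.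
have [_ u1 _ _ uu] := cusp_repE u; have [_ v1 _ _ vu] := cusp_repE v.
move: e2 e3; rewrite -E u1 ?v1 uu vu mulr1 => <-; by rewrite scale1r.
Qed.

Lemma cop_coset_inj : injective (fun q => coset (cop_rep q)).
Proof.
move=> [p u] [p' u'] /coset_inj[h H E]; have [e1 e2 e3] := coset_invariants (cop_rep (p, u)) H.
have s2 := Gamma_infty_sign H.
have [u1 u2 _ _ uu] := cop_repE (p, u); have [v1 v2 _ _ vu] := cop_repE (p', u').
move: e1 e2 e3; rewrite -E u1 u2 v1 v2 uu vu /=.
move: (val h.1 1 1) s2 => e s2 e1 e2 e3.
(* Both first entries are positive, which excludes the sign -1. *)
have eE : e = 1 by nia.
rewrite eE scale1r in e3; rewrite e3; congr pair; apply: val_inj => /=.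
rewrite (surjective_pairing (sval p)) (surjective_pairing (sval p')); congr pair.
  by move/eqP: e1; rewrite eE mul1r eqz_nat eqSS => /eqP ->.
by rewrite e2 eE mul1r.
Qed.

Lemma cusp_cop_disjoint u q : coset (cusp_rep u) <> coset (cop_rep q).
Proof.
move=> /coset_inj[h H E]; have [e1 _ _] := coset_invariants (cusp_rep u) H.
have [u1 _ _ _ _] := cusp_repE u; have [v1 _ _ _ _] := cop_repE q.
by move: e1; rewrite -E u1 v1 mulr0.
Qed.

Lemma coset_cover g : (exists u, coset g = coset (cusp_rep u)) \/ (exists q, coset g = coset (cop_rep q)).
Proof.
have det1 := sl2_det g.1; have [c0|cn] := eqVneq (val g.1 1 0) 0.
  left; have s2 : val g.1 1 1 * val g.1 1 1 = 1.
    move: det1; rewrite c0 mulr0 subr0 => /(congr1 absz); rewrite abszM => /eqP.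
    rewrite muln_eq1 => /andP[_ /eqP]; move: (val g.1 1 1) => d d1.
    by have [->|->] : d = 1 \/ d = -1 by lia.
  exists (val g.1 1 1 *: gu g); apply: coset_eq.
  have [e1 e2 _ _ e5] := cusp_repE (val g.1 1 1 *: gu g).
  apply: (invariants_coset s2); rewrite ?e1 ?e2 ?e5 ?mulr0 ?mulr1 //.
  by rewrite scalerA s2 scale1r.
(* The sign making c positive is absorbed by minus the identity, which lies in the stabiliser. *)
right; have [e s2 ec] : exists2 e : int, e * e = 1 & 0 < e * val g.1 1 0.
  move: (val g.1 1 0) cn => c cn; have [h|h] := ltP 0 c; first by exists 1; rewrite ?mul1r.
  by exists (-1); lia.
pose c := (absz (e * val g.1 1 0)).-1.
have cE : c.+1%:Z = e * val g.1 1 0 by rewrite /c; lia.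
have cop : coprimez c.+1%:Z (e * val g.1 1 1).
  apply/coprimezP; exists (- (e * val g.1 0 1), e * val g.1 0 0) => /=; rewrite cE.
  transitivity ((e * e) * (val g.1 0 0 * val g.1 1 1 - val g.1 0 1 * val g.1 1 0)); first by ring.
  by rewrite s2 mul1r; exact: det1.
pose p : coprime_pair := exist _ (c, e * val g.1 1 1) cop.
exists (p, e *: gu g); apply: coset_eq.
have [e1 e2 _ _ e5] := cop_repE (p, e *: gu g).
apply: (invariants_coset s2); rewrite ?e1 ?e2 ?e5 /=.
- by rewrite cE mulrA s2 mul1r.
- by rewrite mulrA s2 mul1r.
- by rewrite scalerA s2 scale1r.
Qed.

Lemma slash_cusp u t z : slash k S (cusp_rep u) (fun _ _ => 1) t z =
  cexp (ipi R * (form S (zc R u) (zc R u) * t + 2 * form S (zc R u) z)).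
Proof.
have [e1 e2 e3 e4 _] := cusp_repE u.
rewrite slashE /jexp /jj e1 e2 e3 mulr1 !mul0r add0r subr0.
by rewrite [1%:~R]/(1 : R[i]) expr1n invr1 mul1r.
Qed.

Lemma slash_cop q t z : 0 < complex.Im t ->
  slash k S (cop_rep q) (fun _ _ => 1) t z = cop_term S k t z q.
Proof.
move=> t0; have [e1 e2 e3 e4 _] := cop_repE q; case: q e1 e2 e3 e4 => p u e1 e2 e3 e4.
have bz := bezoutP p; have cn := @cocycle_neq0 R t t0 (val p).1.+1 (val p).2 (ltn0Sn _).
rewrite slashE /cop_term /eterm /jexp /jw /jj e1 e2 e3 e4 mulr1 /= -[(_.+1)%:~R]pmulrn.
move: bz cn; move: (val p).1 (val p).2 (bezout (val p)).1 (bezout (val p)).2 => c0 d a b bz jn.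
have cC : (c0.+1%:R : R[i]) != 0 by rewrite pnatr_eq0.
have perm (A B C D : R[i]) : D = B * C -> A * D = B * (A * C) by move=> ->; ring.
apply: perm; rewrite !zcZ.
have det1 : a%:~R * d%:~R - b%:~R * c0.+1%:R = 1 :> R[i].
  by rewrite [c0.+1%:R]pmulrn -!rmorphM -rmorphB /= bz.
set U := zc R u; set j := c0.+1%:R * t + d%:~R in jn *; set c := c0.+1%:R in cC det1 j jn *.
have fU : form S U U = 2 * (halfq S u)%:~R by rewrite form_halfq.
have -> : a%:~R * ((halfq S u)%:~R / c) = a%:~R * (form S U U / 2 / c) by rewrite fU; field.
have -> : z + t *: (a%:~R *: U) + b%:~R *: U = z + (a%:~R * t + b%:~R) *: U.
  by rewrite scalerDl scalerA [t * _]mulrC addrA.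
rewrite /ee -cexpD; apply: (cexp_congr (n := - (a * b * halfq S u))).
have -> : 2 * (- (a * b * halfq S u))%:~R = - (a%:~R * b%:~R * form S U U) :> R[i].
  by rewrite fU rmorphN !rmorphM /=; ring.
rewrite !formLE (formC S_sym U z).
have js : c * (a%:~R * t + b%:~R) = a%:~R * j - 1.
  by rewrite -[X in _ - X]det1 /j; ring.
have bE : b%:~R = (a%:~R * j - 1) / c - a%:~R * t by rewrite -js; field.
clearbody j; clearbody c; rewrite bE.
by field; rewrite jn cC.
Qed.

Lemma hsum_cosets t z T P : 0 < complex.Im t -> hsum (cop_term S k t z) P ->
  hsum (fun u : 'cV[int]_N => cexp (ipi R * (form S (zc R u) (zc R u) * t + 2 * form S (zc R u) z))) T ->
  hsum ((fun C => eisenstein_term k S C t z) \_ (@right_cosets R N k S)) (T + P).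
Proof.
move=> t0 hP hT; pose f C := eisenstein_term k S C t z.
pose D0 := range (fun u => coset (cusp_rep u)); pose D1 := range (fun q => coset (cop_rep q)).
have h0 : hsum (f \_ D0) T.
  apply/(hsum_reindex _ cusp_coset_inj).
    by move=> C h; rewrite patchE; case: ifP => // /set_mem[u _ /h].
  apply: eq_hsum hT => u; rewrite patchE mem_set; last by exists u.
  by rewrite /f eisenstein_term_coset // slash_cusp.
have h1 : hsum (f \_ D1) P.
  apply/(hsum_reindex _ cop_coset_inj).
    by move=> C h; rewrite patchE; case: ifP => // /set_mem[u _ /h].
  apply: eq_hsum hP => q; rewrite patchE mem_set; last by exists q.
  by rewrite /f eisenstein_term_coset // slash_cop.
apply: eq_hsum (hsumD h0 h1) => C; rewrite !patchE.
have [i0|n0] := boolP (C \in D0).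
  have -> : (C \in D1) = false.
    apply/negP => /set_mem[q _ Cq]; have [u _ Cu] := set_mem i0.
    by apply: (@cusp_cop_disjoint u q); rewrite Cu Cq.
  have [u _ Cu] := set_mem i0; rewrite mem_set ?addr0 //; by exists (cusp_rep u).
have [i1|n1] := boolP (C \in D1).
  have [u _ Cu] := set_mem i1; rewrite mem_set ?add0r //; by exists (cop_rep u).
rewrite addr0; case: ifP => // /set_mem[g _ Cg]; exfalso.
have [[u Cu]|[q Cq]] := coset_cover g.
  by move/negP: n0; apply; apply/mem_set; exists u => //; rewrite -Cu.
by move/negP: n1; apply; apply/mem_set; exists q => //; rewrite -Cq.
Qed.

End Cosets.

(** * The Eisenstein series *)

Section Assembly.
Variables (R : realType) (N k : nat) (S : 'M[int]_N).
Hypotheses (S_sym : S^T = S) (S_even : forall i, (2 %| S i i)%Z) (S_pos : pos_def R S)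
  (N_even : ~~ odd N) (k_even : ~~ odd k) (k_gt : (2 + N < k)%N).

Let k_gt0 : (0 < k)%N. Proof. by lia. Qed.
Local Notation a := (k - N./2 - 1)%N.
Let a_gt0 : (0 < a)%N. Proof. by lia. Qed.
Let kE : (k - N./2 = a.+1)%N. Proof. by lia. Qed.
Let kN2 : (a.+1 = k - N + N./2)%N.
Proof. by have := odd_double_half N; rewrite (negbTE N_even); lia. Qed.

Local Notation dvec := (dual_vec R S).
Local Notation dq := (dualq R S).
Local Notation zt := (zeta ((k - N)%:R : R)).
Local Notation beta := (Defs.beta k S).
Implicit Types (t : R[i]) (z : 'cV[R[i]]_N) (p : 'cV[int]_N * nat).

(** For l = S^-1 v one has (l, x) = v.x, so the real condition on [Qdual] is an integral
    congruence. *)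
Lemma Ncount_rescount n v c : Ncount S n (dvec v) c = rescount S c v n.
Proof.
apply: eq_card => x; rewrite !inE; set y := oint x.
have -> : Qdual S n (dvec v) (map_mx (fun i : 'I_c => (i : nat)%:Z) x) =
   (halfq S y - dot v y + n%:Z)%:~R.
  rewrite /Qdual -/(oint x) -/y -/(zr R y) form_dual_vecR // form_halfq //.
  rewrite (dot_map (intr : {rmorphism int -> R})) !(rmorphD, rmorphN) /= -pmulrn; by field.
apply/asboolP/dvdzP => -[m e]; exists m.
  by apply/eqP; rewrite -(eqr_int R) e rmorphM /= -pmulrn mulrC.
by rewrite e rmorphM /= -pmulrn mulrC.
Qed.

Lemma fourier_modeE n v t z : fourier_mode S n%:Z (dvec v) t z = emode (v, n) t z.
Proof.
rewrite /fourier_mode /emode -/(rc (dvec v)) form_dual_vec // /ee /ipi -pmulrn /=.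
by congr cexp; ring.
Qed.

(** The powers of i combine by k - N/2 = (k - N) + N/2: the factor i^(-N/2) of theta inversion
    reduces (-2 pi i)^(k - N/2) to i^(k-N) (-2 pi)^(k - N/2). *)
Lemma fourier_coefficient n v : dq v < n%:R ->
  zt%:C^-1 * ((nseries R S k v n)%:C * (fcoef R S k * (gap R S v n ^+ a)%:C)) = beta n (dvec v).
Proof.
move=> vn; have m2 : (2 <= k - N)%N by lia.
have [_ z1] := hsum_zeta R m2.
have zn : zt != 0 by rewrite gt_eqF // (lt_le_trans ltr01).
have znC : zt%:C != 0 by apply/eqP => -[] /eqP; apply/negP.
have gE : gap R S v n = Delta S n (dvec v) by apply/max_idPr; rewrite subr_ge0 ltW.
rewrite gE /Defs.beta /fcoef /lip_coef.
have -> : (fun i : nat => (Ncount S n (dvec v) i.+1)%:R / i.+1%:R ^+ (k - 1)) =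
   (fun i : nat => (rescount S i.+1 v n)%:R / i.+1%:R ^+ (k - 1)) :> (nat -> R).
  by apply/funext => i; rewrite Ncount_rescount.
rewrite -/(nseries R S k v n).
have -> : (- (2 * pi)) ^+ (k - N./2) = (- (2 * pi)) ^+ a.+1 :> R by congr (_ ^+ _); exact: kE.
have iE : 'i ^+ a.+1 = 'i ^+ (k - N) * 'i ^+ N./2 :> R[i] by rewrite -exprD; congr (_ ^+ _); exact: kN2.
have -> : - (2 * ipi R) = (- (2 * pi))%:C * 'i by rewrite realcN realcM -[(2%:R)%:C]natrC /ipi; ring.
rewrite exprMn iE (realcX (- (2 * pi))) !realcM !realcV ?realcM -!natrC.
have in0 : ('i : R[i]) != 0 by apply/eqP => /(congr1 (@complex.Im R))/eqP; rewrite /= oner_eq0.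
have fn : (a`!%:R : R[i]) != 0 by rewrite pnatr_eq0 -lt0n fact_gt0.
have := expf_neq0 N./2 in0.
move: ('i ^+ N./2) ('i ^+ (k - N)) ((- (2 * pi))%:C ^+ a.+1) (a`!%:R) fn ((nseries R S k v n)%:C)
  ((covolume R S)%:C^-1) ((Delta S n (dvec v) ^+ a)%:C) (zt%:C) znC => I J PI F Fn NS V D Z Zn In.
by field; rewrite Zn Fn In.
Qed.

Definition cusp_coef p : R[i] := if dq p.1 < p.2%:R then beta p.2 (dvec p.1) else 0.

Lemma hsum_cusp_coef t z P : 0 < complex.Im t -> hsum (cop_term S k t z) P ->
  hsum (fun p => cusp_coef p * emode p t z) P.
Proof.
move=> t0 hP; have m2 : (2 <= k - N)%N by lia.
have [_ z1] := hsum_zeta R m2.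
have zn : zt != 0 by rewrite gt_eqF // (lt_le_trans ltr01).
have znC : zt%:C != 0 by apply/eqP => -[] /eqP; apply/negP.
have h := hsumZ (zt%:C^-1) (eisenstein_fourier S_sym S_even S_pos N_even k_gt t0 hP).
rewrite mulKf // in h; apply: eq_hsum h => -[v n].
rewrite /cusp_coef [(v, n).1]/= [(v, n).2]/=; case: ltP => vn.
  rewrite -fourier_coefficient // /fterm /emode /=.
  by move: (ee _) => X; ring.
have -> : fterm S k t z (v, n) = 0.
  rewrite /fterm /gap /=; have /max_idPl -> : n%:R - dq v <= 0 by rewrite subr_le0.
  by rewrite expr0n; move: a_gt0; case: (a) => // b _; rewrite mul0r.
by rewrite !mulr0 mul0r.
Qed.

(** A lattice vector x is S^-1 (S x) in the dual lattice, and its theta term sits on the boundary n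
    = (x, x)/2 of the support. *)
Definition theta_index (x : 'cV[int]_N) : 'cV[int]_N * nat := (S *m x, absz (halfq S x)).
Definition theta_coef p : R[i] := (`[< exists x, theta_index x = p >])%:R.

Lemma zr_mul (x : 'cV[int]_N) : zr R (S *m x) = map_mx intr S *m zr R x.
Proof. exact: map_mxM. Qed.

Lemma dvec_gram x : dvec (S *m x) = zr R x.
Proof. by rewrite /dual_vec zr_mul mulKmx // gram_unit. Qed.

Lemma halfq_ge0 x : 0 <= halfq S x.
Proof.
rewrite -(ler0z R); have : 0 <= form S (zr R x) (zr R x).
  have [->|/S_pos/ltW//] := eqVneq (zr R x) 0; by rewrite formE dot0l.
by rewrite form_halfq // pmulr_rge0.
Qed.

Lemma dualq_gram x : dq (S *m x) = (absz (halfq S x))%:R.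
Proof.
rewrite /dualq dvec_gram form_halfq // mulrC mulKf //.
by rewrite pmulrn gez0_abs // halfq_ge0.
Qed.

Lemma theta_index_inj : injective theta_index.
Proof.
move=> x y [] /(congr1 dvec) + _; rewrite !dvec_gram => /matrixP e.
by apply/matrixP => i j; have /eqP := e i j; rewrite !mxE eqr_int => /eqP.
Qed.

Local Notation theta_term t z := (fun u : 'cV[int]_N =>
  cexp (ipi R * (form S (zc R u) (zc R u) * t + 2 * form S (zc R u) z))).

Lemma hsum_theta_coef t z T : hsum (theta_term t z) T ->
  hsum (fun p => theta_coef p * emode p t z) T.
Proof.
move=> hT; apply/(hsum_reindex _ theta_index_inj).
  move=> p h; rewrite /theta_coef; case: asboolP => [[x /h]|_] //; by rewrite mul0r.
apply: eq_hsum hT => x; rewrite /theta_coef asboolT; last by exists x.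
rewrite mul1r /emode /theta_index /ee [(_, _).1]/= [(_, _).2]/=; congr cexp.
rewrite -(form_dual_vec S_sym S_pos) dvec_gram -zc_rc form_halfq // [(absz _)%:R]pmulrn gez0_abs ?halfq_ge0 //.
by ring.
Qed.

Lemma eisenstein_sums t z : 0 < complex.Im t -> exists T P,
  [/\ hsum (theta_term t z) T, hsum (cop_term S k t z) P, eisenstein k S t z = T + P &
   hsum ((fun C => eisenstein_term k S C t z) \_ (@right_cosets R N k S)) (T + P)].
Proof.
move=> t0; have [B hB] := bsum_theta S_sym S_pos z t0; have [T hT] := hsum_ex hB.
have [P [hP _]] := hsum_cop S_sym S_even S_pos N_even k_gt z t0.
have h := hsum_cosets S_sym S_even S_pos k_even k_gt0 t0 hP hT.
by exists T, P; split => //; exact: hsum_csum.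
Qed.

Lemma hsum_theta_unique t z T : hsum (theta_term t z) T -> Defs.theta S t z = T.
Proof.
move=> hT; apply: hsum_csum; apply: eq_hsum hT => x; rewrite patchE mem_set //.
Qed.

Definition eis_coef p : R[i] := theta_coef p + cusp_coef p.

Lemma hsum_eis_coef t z : 0 < complex.Im t ->
  hsum (fun p => eis_coef p * emode p t z) (eisenstein k S t z).
Proof.
move=> t0; have [T [P [hT hP -> _]]] := eisenstein_sums z t0.
apply: eq_hsum (hsumD (hsum_theta_coef hT) (hsum_cusp_coef t0 hP)) => p.
by rewrite /eis_coef mulrDl.
Qed.

Lemma eis_coef_support p : p.2%:R < dq p.1 -> eis_coef p = 0.
Proof.
move=> h; rewrite /eis_coef /cusp_coef ltNge (ltW h) /= addr0 /theta_coef.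
case: asboolP => // -[x e]; move: h; rewrite -e dualq_gram ltxx. by [].
Qed.

(** Slashing by g sends the term of a coset C to the term of C g, and right translation permutes the
    cosets; absolute convergence justifies the reindexing. *)
Lemma eisenstein_invariant g t z : 0 < complex.Im t ->
  slash k S g (@eisenstein R N k S) t z = eisenstein k S t z.
Proof.
move=> t0; have t1 := Im_jt g t0.
have [T [P [_ _ E h]]] := eisenstein_sums z t0.
have [T' [P' [_ _ E' h']]] := eisenstein_sums (jz g t z) t1.
rewrite slashE E E'; set mu := _ * cexp _.
have bij : bijective (fun C : set (jacobi_group N) => [set (x * g)%g | x in C]).
  exists (fun C => [set (x * g^-1)%g | x in C]) => C; apply/seteqP; split => x.
  - by move=> [_ [y Cy <-] <-]; rewrite -mulgA mulgV mulg1.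
  - by move=> Cx; exists (x * g)%g; [exists x | rewrite -mulgA mulgV mulg1].
  - by move=> [_ [y Cy <-] <-]; rewrite -mulgA mulVg mulg1.
  - by move=> Cx; exists (x * g^-1)%g; [exists x | rewrite -mulgA mulVg mulg1].
have cosetM h1 : [set (x * g)%g | x in coset R k S h1] = coset R k S (h1 * g)%g.
  apply/seteqP; split => x.
    by move=> [_ [y Cy <-] <-]; exists y => //; rewrite mulgA.
  by move=> [y Cy <-]; exists (y * h1)%g; [exists y | rewrite mulgA].
move/(hsum_bij _ _ bij): h => h; apply: (hsum_unique _ h).
apply: eq_hsum (hsumZ mu h') => C; rewrite !patchE.
have [iC|nC] := boolP (C \in @right_cosets R N k S).
  have [h1 _ CE] := set_mem iC; have {CE} CE : C = coset R k S h1 := esym CE.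
  rewrite CE cosetM mem_set; last by exists (h1 * g)%g.
  by rewrite !eisenstein_term_coset // (slash_mul k S_sym S_even h1 g) // (slashE k S g).
rewrite mulr0; case: ifP => // /set_mem[h1 _ e]; exfalso.
move/negP: nC; apply; apply/mem_set; exists (h1 * g^-1)%g => //.
apply: (bij_inj bij); have := cosetM (h1 * g^-1)%g; rewrite -mulgA mulVg mulg1 => E1.
exact: etrans E1 e.
Qed.

(** The coefficients live on integer vectors v; here they are carried to l = S^-1 v, with 0 for
    negative n and off the dual lattice. *)
Definition jacobi_coef (n : int) (l : 'cV[R]_N) : R[i] :=
  let v := xget 0 [set v | dvec v = l] in
  if (0 <= n) && `[< dvec v = l >] then eis_coef (v, absz n) else 0.

Lemma jacobi_coefE v (n : nat) : jacobi_coef n%:Z (dvec v) = eis_coef (v, n).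
Proof.
rewrite /jacobi_coef.
have e : dvec (xget 0 [set v' | dvec v' = dvec v]) = dvec v.
  by apply: (@xgetPex _ 0 [set v' | dvec v' = dvec v]); exists v.
by rewrite (dual_vec_inj S_sym S_pos e) /= asboolT.
Qed.

(** Generic in f because the two expansions of the theorem index n by integers and by natural
    numbers respectively. *)
Lemma index_inj (X : choiceType) (f : nat -> X) : injective f ->
  injective (fun p => (f p.2, dvec p.1)).
Proof. by move=> fi [v n] [w m] [] /= /fi -> /(dual_vec_inj S_sym S_pos) ->. Qed.

Lemma hsum_jacobi_coef t z : 0 < complex.Im t ->
  hsum ((fun q : int * 'cV[R]_N => jacobi_coef q.1 q.2 * fourier_mode S q.1 q.2 t z)
    \_ (@jacobi_fourier_support R N S)) (eisenstein k S t z).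
Proof.
move=> t0; have Posz_inj : injective Posz by move=> m n [].
have inj := index_inj Posz_inj.
apply/(hsum_reindex _ inj).
  move=> [n l] h; rewrite patchE /= /jacobi_coef; case: ifP => // _.
  case: ifP => [/andP[n0 /asboolP e]|_]; last by rewrite mul0r.
  by have := h (xget 0 [set v | dvec v = l], absz n); rewrite /= e gez0_abs.
apply: eq_hsum (hsum_eis_coef z t0) => -[v n]; rewrite patchE /= jacobi_coefE fourier_modeE.
case: ifP => // /negbT; have [h|h] := leP (dq v) n%:R.
  move/negP; case; apply/mem_set; split; first by exists v.
  by move: h; rewrite /dualq ler_pdivrMr //= -pmulrn subr_ge0 mulrC.
by rewrite eis_coef_support ?mul0r.
Qed.

Lemma hsum_beta t z P : 0 < complex.Im t -> hsum (cop_term S k t z) P ->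
  hsum ((fun q : nat * 'cV[R]_N => beta q.1 q.2 * fourier_mode S q.1%:Z q.2 t z)
    \_ (@eisenstein_fourier_support R N S)) P.
Proof.
move=> t0 hP; have inj := index_inj (fun m n : nat => @id (m = n)).
apply/(hsum_reindex _ inj).
  move=> [n l] h; rewrite patchE; case: ifP => // /set_mem[_ [v _ e] _].
  by case: (h (v, n)); congr pair; exact: e.
apply: eq_hsum (hsum_cusp_coef t0 hP) => -[v n]; rewrite patchE /= fourier_modeE /cusp_coef /=.
have q0 := dualq_ge0 S_pos v.
case: ltP => h.
  rewrite mem_set //; split => //=; last by exists v.
  by rewrite lt0n; apply: contraTneq h => ->; rewrite -leNgt.
rewrite mul0r; case: ifP => // /set_mem[_ _ /=]; rewrite -/(dq v) => h'.
by move: h'; rewrite ltNge h.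
Qed.

End Assembly.

Theorem theorem2p4 (R : realType) (N k : nat) (S : 'M[int]_N)
    (S_sym : S^T = S) (S_even : forall i, (2 %| S i i)%Z) (S_pos : pos_def R S)
    (N_even : ~~ odd N) (k_even : ~~ odd k) (k_gt : (2 + N < k)%N) :
  [/\ (forall (t : R[i]) (z : 'cV[R[i]]_N), upper_half_plane t ->
        abs_summable (@right_cosets R N k S)
          (fun C => eisenstein_term k S C t z)),
      holomorphic_jacobi_form k S (@eisenstein R N k S)
    & forall (t : R[i]) (z : 'cV[R[i]]_N), upper_half_plane t ->
        let term (p : nat * 'cV[R]_N) :=
          beta k S p.1 p.2 * fourier_mode S p.1%:Z p.2 t z in
        abs_summable (eisenstein_fourier_support S) term /\
        eisenstein k S t z
          = theta S t z + csum (eisenstein_fourier_support S) term].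
Proof.
split=> [t z t0||t z t0].
- have [T [P [_ _ _ h]]] := eisenstein_sums S_sym S_even S_pos N_even k_even k_gt z t0.
  exact: hsum_abs_summable h.
- split=> [|g t z t0|].
  + apply: (fourier_holomorphic (cf := @eis_coef R N k S)) => t z t0.
    exact: hsum_eis_coef.
  + exact: eisenstein_invariant.
  + exists (@jacobi_coef R N k S) => t z t0 term.
    have h := hsum_jacobi_coef S_sym S_even S_pos N_even k_even k_gt z t0.
    by split; [exact: hsum_abs_summable h | rewrite (hsum_csum h)].
- have [T [P [hT hP E _]]] := eisenstein_sums S_sym S_even S_pos N_even k_even k_gt z t0.
  have h := hsum_beta S_sym S_even S_pos N_even k_even k_gt t0 hP.
  split; first exact: hsum_abs_summable h.
  by rewrite E (hsum_csum h) (hsum_theta_unique hT).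
Qed.
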